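(* Let $n\geq2$ and $\beta\geq n+1$, let $\omega(x)=1+|x|^2$ on $\mathbb{R}^n$, let $\mu_\beta$ be the generalised Cauchy probability measure with density proportional to $\omega^{-\beta}$, and let $Lf=\omega\Delta f-2(\beta-1)\langle x,df\rangle$, with associated semigroup $(\mathbf{P}_t)_{t\geq0}$. Then $\lambda_1(-L)\geq2(\beta-1)$, and for all $f\in\mathcal{C}_c^\infty(\mathbb{R}^n)$, $$2(\beta-1)\mathrm{Var}_{\mu_\beta}(f)-\int_{\mathbb{R}^n}|df|^2(1+|x|^2)\,d\mu_\beta=-2\int_0^{+\infty}\!\int_{\mathbb{R}^n}\Big\{\frac{\beta-(n+1)}{\beta-2}\|\omega\,\mathrm{Hess}(\mathbf{P}_tf)\|^2_{HS}+\frac{n}{\beta-2}\Big[\|\omega\,\mathrm{Hess}(\mathbf{P}_tf)\|_{HS}^2-\frac1n(\omega\Delta\mathbf{P}_tf)^2\Big]\Big\}\,d\mu_\beta\,dt.$$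
   Context: $d\mu_\beta=\frac{1}{Z_{n,\beta}}(1+|x|^2)^{-\beta}dx$, with $Z_{n,\beta}$ the normalising constant. The operator $L$, defined on $\mathcal{C}_c^\infty(\mathbb{R}^n)$, is symmetric and essentially self-adjoint in $L^2(\mu_\beta)$; its self-adjoint extension, still denoted $L$, has domain $\mathcal{D}(L)\subset L^2(\mu_\beta)$, and $\mathbf{P}_t=e^{tL}$ is the $L^2(\mu_\beta)$-semigroup it generates. $\|\cdot\|_{HS}$ is the Hilbert-Schmidt norm. The spectral gap is $$\lambda_1(-L)=\inf\left\{\frac{\int_{\mathbb{R}^n}-f\,Lf\,d\mu_\beta}{\mathrm{Var}_{\mu_\beta}(f)}\ :\ f\in\mathcal{D}(L),\ \mathrm{Var}_{\mu_\beta}(f)\neq0\right\}.$$ *)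

(* Defs.v *)
From HB Require Import structures.
From mathcomp Require Import all_boot all_order all_algebra.
From mathcomp Require Import all_classical all_reals all_analysis.
From mathcomp Require Import measurable_realfun.

Set Implicit Arguments.
Unset Strict Implicit.
Unset Printing Implicit Defensive.
Import Order.TTheory GRing.Theory Num.Theory.
Import numFieldNormedType.Exports.

Local Open Scope classical_set_scope.
Local Open Scope ring_scope.

(* [R^n] is ['rV[R]_n]. The library puts a sigma-algebra on tuples but not on
   row vectors; we do the same with the coordinates of a row vector. Over the
   reals this product sigma-algebra is the Borel sigma-algebra. *)
Section measurable_rV.
Context (R : realType) (n : nat).

Let coord : 'I_n -> 'rV[R]_n -> R := fun i x => x ord0 i.

Let rV_set0 : g_sigma_preimage coord set0.
Proof. exact: sigma_algebra0. Qed.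

Let rV_setC A : g_sigma_preimage coord A -> g_sigma_preimage coord (~` A).
Proof. exact: sigma_algebraC. Qed.

Let rV_bigcup (F : _^nat) : (forall i, g_sigma_preimage coord (F i)) ->
  g_sigma_preimage coord (\bigcup_i (F i)).
Proof. exact: sigma_algebra_bigcup. Qed.

HB.instance Definition _ := @isMeasurable.Build default_measure_display
  'rV[R]_n (g_sigma_preimage coord) rV_set0 rV_setC rV_bigcup.

End measurable_rV.

Lemma measurable_coord (R : realType) n (i : 'I_n) :
  measurable_fun [set: 'rV[R]_n] (fun x : 'rV[R]_n => x ord0 i).
Proof.
move=> _ Y mY; rewrite setTI; apply: sub_sigma_algebra => /=.
rewrite -bigcup_seq/=; exists i => /=; first by rewrite mem_index_enum.
by exists Y => //; rewrite setTI.
Qed.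

Lemma measurable_fun_rV d (T : measurableType d) (R : realType) n
    (f : T -> 'rV[R]_n) :
  (forall i, measurable_fun [set: T] (fun t => f t ord0 i)) ->
  measurable_fun [set: T] f.
Proof.
move=> mf.
have H : g_sigma_preimage (fun (i : 'I_n) (x : 'rV[R]_n) => x ord0 i) `<=`
    [set A | measurable (f @^-1` A)].
  apply: smallest_sub.
    split => /=.
    - by rewrite preimage_set0.
    - by move=> A mA; rewrite setTD preimage_setC; exact: measurableC.
    - by move=> F mF; rewrite preimage_bigcup; exact: bigcupT_measurable.
  rewrite -bigcup_seq => A [i _] [B mB <-] /=.
  by have := mf i measurableT B mB; rewrite !setTI.
by move=> _ A mA; rewrite setTI; exact: H.
Qed.

(* Lebesgue measure on [R^n], by recursion on [n]: the image of the product
   measure on [R * R^n] under [(a, v) |-> (a, v_0, ..., v_(n-1))]. *)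
Section rV_cons.
Context (R : realType) (n : nat).

Definition rV_cons (p : measurableTypeR R * 'rV[R]_n) : 'rV[R]_n.+1 :=
  \row_i (if unlift ord0 i is Some j then p.2 ord0 j else p.1).

Definition rV_uncons (v : 'rV[R]_n.+1) : measurableTypeR R * 'rV[R]_n :=
  (v ord0 ord0, \row_i v ord0 (lift ord0 i)).

Lemma rV_consK : cancel rV_cons rV_uncons.
Proof.
move=> [a v]; rewrite /rV_uncons /rV_cons; congr pair => /=.
  by rewrite mxE unlift_none.
by apply/rowP => i; rewrite !mxE liftK.
Qed.

Lemma rV_unconsK : cancel rV_uncons rV_cons.
Proof.
move=> v; apply/rowP => i; rewrite !mxE.
by case: unliftP => [j ->|->] //=; rewrite mxE.
Qed.

Lemma measurable_rV_cons : measurable_fun [set: measurableTypeR R * 'rV[R]_n] rV_cons.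
Proof.
apply: measurable_fun_rV => i; rewrite /rV_cons.
under eq_fun do rewrite mxE.
case: unliftP => [j _|_]; last exact: measurable_fst.
exact: (measurableT_comp (@measurable_coord R n j) measurable_snd).
Qed.

Lemma measurable_rV_uncons : measurable_fun [set: 'rV[R]_n.+1] rV_uncons.
Proof.
apply/measurable_fun_pairP; split => /=; first exact: measurable_coord.
apply: measurable_fun_rV => i; rewrite /rV_uncons /comp/=.
under eq_fun do rewrite mxE.
exact: measurable_coord.
Qed.

Variable mu : {sigma_finite_measure set 'rV[R]_n -> \bar R}.

Definition rV_cons_measure : set 'rV[R]_n.+1 -> \bar R :=
  pushforward (lebesgue_measure \x mu)%E rV_cons.

Let lm_mu : {measure set (measurableTypeR R * 'rV[R]_n)%type -> \bar R} :=
  (lebesgue_measure \x mu)%E.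

Let push : {measure set 'rV[R]_n.+1 -> \bar R}.
Proof.
by refine [the measure _ _ of pushforward lm_mu rV_cons]; exact: measurable_rV_cons.
Defined.

HB.instance Definition _ := isMeasure.Build _ _ _ rV_cons_measure
  (measure0 push) (measure_ge0 push) (@measure_semi_sigma_additive _ _ _ push).

Let rV_cons_sigma_finite : sigma_finite setT rV_cons_measure.
Proof.
have /sigma_finiteP[F [TF ndF Foo]] := sigma_finiteT (@lebesgue_measure R).
have /sigma_finiteP[G [TG ndG Goo]] := sigma_finiteT mu.
exists (fun k => rV_uncons @^-1` (F k `*` G k)).
  rewrite -preimage_bigcup -(@preimage_setT _ _ rV_uncons); congr (_ @^-1` _).
  rewrite -setXTT TF TG predeqE => -[x y]; split.
    move=> [/= [i _ Fix] [k _ Gky]]; exists (maxn i k) => //; split.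
    - by move: x Fix; exact/subsetPset/ndF/leq_maxl.
    - by move: y Gky; exact/subsetPset/ndG/leq_maxr.
  by move=> [k _ []/= ? ?]; split; exists k.
move=> k; have [mF Fk] := Foo k; have [mG Gk] := Goo k; split.
  rewrite -[X in measurable X]setTI.
  by apply: measurable_rV_uncons => //; exact: measurableX.
rewrite /rV_cons_measure /pushforward -comp_preimage.
rewrite (_ : rV_uncons \o rV_cons = idfun) ?preimage_id; last first.
  by apply/funext => p; exact: rV_consK.
rewrite product_measure1E//; apply: lte_mul_pinfty => //.
by rewrite ge0_fin_numE.
Qed.

HB.instance Definition _ := Measure_isSigmaFinite.Build _ _ _ rV_cons_measure
  rV_cons_sigma_finite.

End rV_cons.

Fixpoint lebesgue_rV (R : realType) (n : nat) :
    {sigma_finite_measure set 'rV[R]_n -> \bar R} :=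
  match n with
  | 0 => dirac (0 : 'rV[R]_0)
  | m.+1 => rV_cons_measure (lebesgue_rV R m)
  end.

Lemma lebesgue_rV_box (R : realType) (n : nat) (A : 'I_n -> set R) :
  (forall i, measurable (A i)) ->
  lebesgue_rV R n [set x | forall i, A i (x ord0 i)] =
  (\prod_(i < n) lebesgue_measure (A i))%E.
Proof.
elim: n A => [|n IHn] A mA.
  by rewrite big_ord0 /= diracE mem_set//= => -[].
rewrite big_ord_recl /= -(IHn (fun i => A (lift ord0 i)))//.
rewrite /rV_cons_measure /pushforward.
have -> : @rV_cons R n @^-1` [set x | forall i, A i (x ord0 i)] =
    (A ord0 : set (measurableTypeR R)) `*`
    [set x : 'rV[R]_n | forall i, A (lift ord0 i) (x ord0 i)].
  apply/seteqP; split=> [[a v] /= H|[a v] /= [Aa Av] i].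
    split=> [|i]; first by have := H ord0; rewrite mxE unlift_none.
    by have := H (lift ord0 i); rewrite mxE liftK.
  by rewrite mxE; case: unliftP => [j ->|->].
rewrite product_measure1E//; first exact: mA.
rewrite (_ : [set x | _] =
    \bigcap_i ((fun x : 'rV[R]_n => x ord0 i) @^-1` A (lift ord0 i))); last first.
  by apply/seteqP; split=> [x Ax i _|x Ax i]; [exact: Ax|exact: (Ax i I)].
apply: fin_bigcap_measurable => // i _.
by rewrite -[X in measurable X]setTI; exact: measurable_coord.
Qed.

Section differential_operators.
Context (R : realType) (n : nat).
Implicit Types (f : 'rV[R]_n -> R) (x : 'rV[R]_n).

Definition sqnorm x : R := \sum_i x ord0 i ^+ 2.

Definition omega x : R := 1 + sqnorm x.

Definition partial (i : 'I_n) f : 'rV[R]_n -> R :=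
  fun x => 'D_(delta_mx ord0 i) f x.

(* [|df|^2]. *)
Definition sqgrad f x : R := \sum_i partial i f x ^+ 2.

(* [<x, df>]. *)
Definition radial f x : R := \sum_i x ord0 i * partial i f x.

Definition laplacian f x : R := \sum_i partial i (partial i f) x.

(* All iterated partial derivatives of [f] exist and are differentiable, hence
   continuous. *)
Definition smooth f := forall (s : seq 'I_n) x,
  differentiable (foldr partial f s) x.

Definition test_function f :=
  smooth f /\ compact (closure [set x | f x != 0]).

Definition cauchyL (beta : R) f x : R :=
  omega x * laplacian f x - 2 * (beta - 1) * radial f x.

End differential_operators.

Section cauchy_measure.
Context (R : realType) (n : nat) (beta : R).

Lemma measurable_omega : measurable_fun [set: 'rV[R]_n] (@omega R n).
Proof.
apply: measurable_funD => //; apply: measurable_sum => i.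
by apply: measurable_funX; exact: measurable_coord.
Qed.

Definition omega_measure (A : set 'rV[R]_n) : \bar R :=
  (\int[lebesgue_rV R n]_(x in A) (omega x `^ (- beta))%:E)%E.

Let omega_measure0 : omega_measure set0 = 0%E.
Proof. exact: integral_set0. Qed.

Let omega_measure_ge0 A : (0 <= omega_measure A)%E.
Proof. by apply: integral_ge0 => x _; rewrite lee_fin powR_ge0. Qed.

Let omega_measure_sigma_additive : semi_sigma_additive omega_measure.
Proof.
apply: semi_sigma_additive_nng_induced => [|x]; last by rewrite lee_fin powR_ge0.
apply/measurable_EFinP/(measurableT_comp (measurable_powR _)).
exact: measurable_omega.
Qed.

HB.instance Definition _ := isMeasure.Build _ _ _ omega_measure
  omega_measure0 omega_measure_ge0 omega_measure_sigma_additive.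

(* [mnormalize] divides by the total mass [Z_{n, beta}]; its second argument is
   only used when that mass is 0 or +oo, i.e. for [beta <= n / 2]. *)
Definition cauchy_measure : probability 'rV[R]_n R :=
  mnormalize omega_measure (dirac (0 : 'rV[R]_n)).

End cauchy_measure.

(* Closed operators and semigroups on [L^2(mu)]. The elements of [L^2(mu)] are
   represented by functions, an operator by its graph, and all the notions below
   are invariant under equality [mu]-almost everywhere. *)
Section L2_operators.
Context d (T : measurableType d) (R : realType).
Variable mu : {measure set T -> \bar R}.

Definition L2norm (f : T -> R) : \bar R := 'N[mu]_2%:E[EFin \o f]%E.

Definition L2_cvg I (F : set_system I) (f_ : I -> T -> R) (f : T -> R) :=
  L2norm (f_ i \- f) @[i --> F] --> 0%E.

(* Graph of the closure of the operator [A] of domain [D]; when the latter is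
   essentially self-adjoint, its closure is its unique self-adjoint
   extension. *)
Definition op_closure (D : set (T -> R)) (A : (T -> R) -> T -> R)
    (f g : T -> R) :=
  [/\ f \in Lfun mu 2%:E, g \in Lfun mu 2%:E &
    exists f_ : nat -> T -> R, [/\ forall k, D (f_ k),
      L2_cvg \oo f_ f & L2_cvg \oo (fun k => A (f_ k)) g]].

(* Graph of the infinitesimal generator of [P]. *)
Definition infinitesimal_generator (P : R -> (T -> R) -> T -> R)
    (f g : T -> R) :=
  [/\ f \in Lfun mu 2%:E, g \in Lfun mu 2%:E &
    L2_cvg 0^'+ (fun t => t^-1 \*o (P t f \- f)) g].

(* [P t = e^(tA)], [t >= 0]: [P] is the strongly continuous semigroup of bounded
   operators of [L^2(mu)] generated by [A]. *)
Record generated_semigroup (A : (T -> R) -> (T -> R) -> Prop)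
    (P : R -> (T -> R) -> T -> R) : Prop := GeneratedSemigroup {
  sg_L2 : forall t f, 0 <= t -> f \in Lfun mu 2%:E -> P t f \in Lfun mu 2%:E;
  sg_linear : forall t (a : R) f g, 0 <= t ->
    f \in Lfun mu 2%:E -> g \in Lfun mu 2%:E ->
    P t (fun x => a * f x + g x) = (fun x => a * P t f x + P t g x) %[ae mu];
  sg_bounded : forall t, 0 <= t -> exists C : R,
    forall f, f \in Lfun mu 2%:E -> (L2norm (P t f) <= C%:E * L2norm f)%E;
  sg_id : forall f, f \in Lfun mu 2%:E -> P 0 f = f %[ae mu];
  sg_comp : forall s t f, 0 <= s -> 0 <= t -> f \in Lfun mu 2%:E ->
    P (s + t) f = P s (P t f) %[ae mu];
  sg_cvg : forall f, f \in Lfun mu 2%:E -> L2_cvg 0^'+ (fun t => P t f) f;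
  sg_generator : forall f g, infinitesimal_generator P f g <-> A f g
}.

End L2_operators.

Definition spectral_gap d (T : measurableType d) (R : realType)
    (mu : probability T R) (A : (T -> R) -> (T -> R) -> Prop) : \bar R :=
  ereal_inf [set q | exists f g : T -> R, [/\ A f g, 'V_mu[f] != 0%E &
    q = ((\int[mu]_x (- f x * g x))%R / fine 'V_mu[f])%:E ]].

(* Hessian, in the sense of distributions, of an element [f] of [L^2(mu)]; if
   [f] is C^2, this is its usual Hessian up to a null set. *)
Section weak_hessian.
Context (R : realType) (n : nat).
Notation lebesgue := (lebesgue_rV R n).

Definition locally_integrable_rV (f : 'rV[R]_n -> R) :=
  measurable_fun [set: 'rV[R]_n] f /\
  forall K, compact K -> lebesgue.-integrable K (EFin \o f).

Definition is_weak_hessian (f : 'rV[R]_n -> R) (H : 'rV[R]_n -> 'M[R]_n) :=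
  forall i j, locally_integrable_rV (fun x => H x i j) /\
    forall phi, test_function phi ->
      (\int[lebesgue]_x (H x i j * phi x) =
       \int[lebesgue]_x (f x * partial i (partial j phi) x))%R.

Definition has_weak_hessian f := exists H, is_weak_hessian f H.

Definition Hess (f : 'rV[R]_n -> R) : 'rV[R]_n -> 'M[R]_n :=
  xget (fun=> 0) [set H | is_weak_hessian f H].

End weak_hessian.

Definition norm_HS (R : realType) n (A : 'M[R]_n) : R :=
  Num.sqrt (\sum_i \sum_j A i j ^+ 2).

(* Main.v *)
(* Write [c = beta - 1], [A f = - \int f L f] and
   [Q f = c / (c - 1) * |w Hess f|^2 - 1 / (c - 1) * (w Delta f)^2].
   Integrating by parts twice gives, for test functions,
   [\int Q f = \int (L f)^2 - 2 c A f], and [Q f >= 0] because [n <= c]. The left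
   side controls the [L^2] norm of [w Hess f] by the graph norm of [L], so the
   Hessian is closed and the identity holds on the whole domain of [L].
   Along the orbit, [p t = \int (P_t f)^2] satisfies [p' = - 2 A (P_t f)] and
   [A (P_t f)' = - 2 \int (L P_t f)^2], so that
   [2 \int Q (P_t f) = (2 c p - A (P_t f))'].
   Now [<P_t f, P_s f> = p ((t + s) / 2)] and [p] is nonincreasing, so [P_t f]
   converges as [t] goes to [+oo]; its limit is in the kernel of [L], hence has
   zero weak gradient, hence is the constant [\int f]. Integrating over [t] gives
   the formula, and its right-hand side is nonpositive: this is the spectral gap
   on test functions, which pass to the closure. *)
Require Import Defs.
From HB Require Import structures.
From mathcomp Require Import all_boot all_order all_algebra.
From mathcomp Require Import all_classical all_reals all_analysis.
From mathcomp Require Import measurable_realfun ring lra.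

Set Implicit Arguments.
Unset Strict Implicit.
Unset Printing Implicit Defensive.
Import Order.TTheory GRing.Theory Num.Theory.
Import numFieldNormedType.Exports.

Local Open Scope classical_set_scope.
Local Open Scope ring_scope.

(** * Integration on row vectors *)

(** The obstacle is that [P t f] is not a test function: all that is known of it is that it lies in
    the domain of the generator, that is, in the graph closure of [cauchyL] on test functions. So
    every fact about orbits is either an inequality or an identity between inner products, which
    passes to the closure by continuity, or a distributional statement, which passes to it by
    pairing with a fixed test function. The second kind covers both the Hessian of [P t f] and the
    vanishing weak gradient of elements of the kernel. In time, the second derivative of [p] asks
    for data in the domain of the square of the generator; test functions are such data because
    [cauchyL] maps test functions to test functions. Differentiating inner products along orbits
    asks for bounds on [P t] that are uniform for bounded [t], whereas the semigroup is given with
    one bound for each [t]; a uniform boundedness argument supplies them. Elements of the space are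
    functions rather than classes, so the abstract part works with a seminorm and replaces equality
    by a difference of zero seminorm. *)

Lemma rat_approx (R : realType) (x w : R) : 0 < w -> exists q : rat, `|x - ratr q| < w.
Proof.
move=> w0; have [|q] := @rat_in_itvoo R (x - w) (x + w); first by lra.
by rewrite in_itv/= => /andP[? ?]; exists q; rewrite ltr_norml; apply/andP; split; lra.
Qed.

Section rV_measurability.
Context (R : realType) (n : nat).
Implicit Types (x y : 'rV[R]_n) (f : 'rV[R]_n -> R).

Lemma ball_rV x e y : 0 < e -> (forall i, `|x ord0 i - y ord0 i| < e) -> ball x e y.
Proof. by move=> e0 H; split=> // i j; rewrite (ord1 i); exact: H. Qed.

(** The sigma-algebra is generated by the coordinates, so an open set is exhibited as the union of
    the countably many cubes with rational centre and half-side [1/(k+1)] that it contains. *)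
Lemma open_measurable_rV (A : set 'rV[R]_n) : open A -> measurable A.
Proof.
move=> oA.
pose B (p : 'rV[rat]_n * nat) : set 'rV[R]_n :=
  \bigcap_(i in [set: 'I_n]) [set x : 'rV[R]_n | `|x ord0 i - ratr (p.1 ord0 i)| < p.2.+1%:R^-1].
have mB p : measurable (B p).
  apply: fin_bigcap_measurable => // i _.
  rewrite (_ : [set _ | _] = (fun x : 'rV[R]_n => x ord0 i) @^-1`
      (ball (ratr (p.1 ord0 i) : R) p.2.+1%:R^-1)).
    rewrite -[X in measurable X]setTI; apply: measurable_coord => //.
    exact: measurable_ball.
  by apply/seteqP; split => x /=; rewrite /ball/= distrC.
have -> : A = \bigcup_(p in [set p | B p `<=` A]) B p.
  apply/seteqP; split=> [x Ax|x [p pA] /pA//].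
  have [e /= e0 eA] := (@nbhs_ballP _ _ x A).1 (open_nbhs_nbhs (conj oA Ax)).
  (* A point of the chosen cube is within [1/(k+1) < e/2] of its centre, and so is [x]; the cube
     therefore stays in the ball of radius [e]. *)
  have e2 : 0 < e / 2 by lra.
  have [k _ /(_ k (leqnn k)) kP] := near_infty_natSinv_lt (PosNum e2).
  have k0 : 0 < k.+1%:R^-1 :> R by rewrite invr_gt0.
  have qP i := rat_approx (x ord0 i) k0.
  pose q i := xchoose (qP i).
  exists (\row_i q i, k) => /= [|i _ /=]; last by rewrite mxE; exact: (xchooseP (qP i)).
  move=> y By; apply: eA; apply: ball_rV => // i.
  have := By i I; rewrite /= mxE -/(q i) => yq.
  have := xchooseP (qP i); rewrite -/(q i) => xq.
  rewrite (le_lt_trans (ler_distD (ratr (q i)) _ _))// distrC (splitr e) ltrD//.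
    by rewrite distrC (lt_trans xq).
  by rewrite distrC (lt_trans yq).
by rewrite bigcup_mkcond; apply: countable_bigcupT_measurable => // p; case: ifP.
Qed.

Lemma continuous_measurable_rV f : continuous f -> measurable_fun setT f.
Proof.
move=> /continuousP cf; apply: (measurability _ (RGenOpens.measurableE R)).
move=> _ [_ [a [b ->] <-]]; rewrite setTI; apply: open_measurable_rV.
by apply: cf; exact: interval_open.
Qed.

Definition box (M : R) : set 'rV[R]_n := [set x | forall i, `|x ord0 i| <= M].

Lemma box_setE M : box M = [set x | forall i, `[- M, M]%classic (x ord0 i)].
Proof.
by apply/seteqP; split=> x /= H i; have := H i; rewrite /= in_itv/= ler_norml.
Qed.

Lemma compact_box M : compact (box M).
Proof.
rewrite box_setE; apply: (@rV_compact R n (fun _ => `[-M, M]%classic)) => i.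
exact: segment_compact.
Qed.

Lemma hausdorff_rV : hausdorff_space 'rV[R]_n.
Proof. exact: norm_hausdorff. Qed.

Lemma compact_measurable_rV (K : set 'rV[R]_n) : compact K -> measurable K.
Proof.
move=> /(compact_closed hausdorff_rV) cK; rewrite -[K]setCK.
by apply: measurableC; apply: open_measurable_rV; exact: closed_openC.
Qed.

Lemma lebesgue_box_lty M : (lebesgue_rV R n (box M) < +oo)%E.
Proof.
rewrite box_setE (@lebesgue_rV_box R n (fun=> `[- M, M]%classic)); last first.
  by move=> i; exact: measurable_itv.
rewrite ltey_eq; apply/orP; left.
apply: (big_ind (fun x : \bar R => x \is a fin_num)) => // [a b|i _]; first exact: fin_numM.
by rewrite lebesgue_measure_itv/=; case: ifP.
Qed.

End rV_measurability.

Section bounded_support.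
Context (R : realType) (n : nat).
Implicit Types (f g : 'rV[R]_n -> R).

(** A form of compact support (see [bsuppP]) without closures, hence easy to carry through products,
    partial derivatives and slices. *)
Definition bsupp f := exists M : R, forall x, f x != 0 -> box M x.

Lemma box_sub (M N : R) : M <= N -> @box R n M `<=` box N.
Proof. by move=> MN x Mx i; rewrite (le_trans (Mx i)). Qed.

Lemma compact_bounded_box (K : set 'rV[R]_n) : compact K -> exists M : R, K `<=` box M.
Proof.
move=> /compact_bounded [M [_ /(_ (M + 1))]]; rewrite ltrDl => /(_ ltr01) H.
exists (M + 1) => x /H xM i; apply: le_trans xM.
rewrite /Num.Def.normr/= mx_normrE; apply/bigmax_geP; right.
by exists (ord0, i).
Qed.

Lemma bsuppP f : compact (closure [set x | f x != 0]) <-> bsupp f.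
Proof.
split=> [/compact_bounded_box[M H]|[M fM]].
  by exists M => x fx; apply: H; exact: subset_closure.
apply: (subclosed_compact _ (@compact_box R n M)); first exact: closed_closure.
have /closure_id -> : closed (@box R n M).
  by apply: compact_closed; [exact: hausdorff_rV|exact: compact_box].
exact: closure_subset.
Qed.

Lemma bsuppD f g : bsupp f -> bsupp g -> bsupp (fun x => f x + g x).
Proof.
move=> [A fA] [B gB]; exists (Num.max A B) => x.
have [fx0|fx _] := eqVneq (f x) 0.
  by rewrite fx0 add0r => /gB; apply: box_sub; rewrite le_max lexx orbT.
by apply: box_sub (fA x fx); rewrite le_max lexx.
Qed.

Lemma bsuppM f g : bsupp f -> bsupp (fun x => f x * g x).
Proof.
by move=> [A fA]; exists A => x; rewrite mulf_eq0 negb_or => /andP[/fA].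
Qed.

Lemma bsuppMr f g : bsupp f -> bsupp (fun x => g x * f x).
Proof.
by move=> [A fA]; exists A => x; rewrite mulf_eq0 negb_or => /andP[_ /fA].
Qed.

Lemma continuous_bounded_box f M : continuous f ->
  exists2 C, 0 <= C & forall x, box M x -> `|f x| <= C.
Proof.
move=> cf.
have : compact (f @` box M).
  by apply: continuous_compact; [exact: continuous_subspaceT|exact: compact_box].
move=> /compact_bounded [C [_ /(_ (`|C| + 1))]].
rewrite (le_lt_trans (ler_norm C)) ?ltrDl// => /(_ isT) H.
by exists (`|C| + 1) => // x xM; apply: H; exists x.
Qed.

Lemma continuous_bsupp_integrable f : continuous f -> bsupp f ->
  (lebesgue_rV R n).-integrable setT (EFin \o f).
Proof.
move=> cf [M fM]; have [C C0 CP] := continuous_bounded_box M cf.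
have mB : measurable (@box R n M) by apply: compact_measurable_rV; exact: compact_box.
apply: (@le_integrable _ _ _ _ _ _ _ (EFin \o (fun x => C * \1_(box M) x))) => //.
- by apply/measurable_EFinP; exact: continuous_measurable_rV.
- move=> x _ /=; rewrite lee_fin indicE.
  have [fx0|/fM xM] := eqVneq (f x) 0; first by rewrite fx0 normr0.
  by rewrite (mem_set xM) mulr1 (ger0_norm C0); exact: CP.
- apply/integrableP; split.
    by apply/measurable_EFinP; apply: measurable_funM => //; exact: measurable_indic.
  under eq_integral do rewrite /= ger0_norm ?mulr_ge0// EFinM.
  rewrite integralZl//.
    by rewrite integral_indic// setIT lte_mul_pinfty// lebesgue_box_lty.
  apply/integrableP; split; first by apply/measurable_EFinP; exact: measurable_indic.
  under eq_integral do rewrite /= ger0_norm//.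
  by rewrite integral_indic// setIT lebesgue_box_lty.
Qed.

End bounded_support.

Section fubini_rV.
Context (R : realType) (n : nat).
Notation leb := (lebesgue_rV R).

Lemma measurable_rV_cons_comp (F : 'rV[R]_n.+1 -> \bar R) : measurable_fun setT F ->
  measurable_fun setT (fun p : measurableTypeR R * 'rV[R]_n => F (rV_cons p)).
Proof. by move=> mF; apply: (measurableT_comp mF); exact: measurable_rV_cons. Qed.

Lemma ge0_integral_rV_cons (F : 'rV[R]_n.+1 -> \bar R) :
  measurable_fun setT F -> (forall x, 0 <= F x)%E ->
  (\int[leb n.+1]_x F x =
   \int[lebesgue_measure]_a \int[leb n]_v F (rV_cons (a, v)))%E.
Proof.
move=> mF F0; rewrite /= (ge0_integral_pushforward (@measurable_rV_cons R n))//.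
rewrite preimage_setT.
by rewrite (fubini_tonelli1 (fun p => F (rV_cons p)))//; exact: measurable_rV_cons_comp.
Qed.

Section integrable.
Variable F : 'rV[R]_n.+1 -> \bar R.
Hypothesis iF : (leb n.+1).-integrable setT F.

Let iF' : (lebesgue_measure \x leb n)%E.-integrable setT
  (fun p : measurableTypeR R * 'rV[R]_n => F (rV_cons p)).
Proof.
have mF := measurable_int _ iF; apply/integrableP; split; first exact: measurable_rV_cons_comp.
have /integrableP[_] := iF.
rewrite /= (ge0_integral_pushforward (@measurable_rV_cons R n)) ?preimage_setT//.
exact: measurableT_comp.
Qed.

Lemma integral_rV_cons12 : (\int[leb n.+1]_x F x =
   \int[lebesgue_measure]_a \int[leb n]_v F (rV_cons (a, v)))%E.
Proof.
rewrite /= (integral_pushforward (@measurable_rV_cons R n)) ?preimage_setT//; last first.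
  exact: measurable_int iF.
by rewrite -(integral12_prod_meas1 iF').
Qed.

Lemma integral_rV_cons21 : (\int[leb n.+1]_x F x =
   \int[leb n]_v \int[lebesgue_measure]_a F (rV_cons (a, v)))%E.
Proof.
rewrite /= (integral_pushforward (@measurable_rV_cons R n)) ?preimage_setT//; last first.
  exact: measurable_int iF.
by rewrite -(integral21_prod_meas1 iF').
Qed.

End integrable.

End fubini_rV.

(** Serves twice: to bound the mass of the Cauchy weight by a product of one-dimensional integrals,
    and to integrate tensor products of bumps. *)
Lemma integral_prod_coord (R : realType) (n : nat) (g : 'I_n -> R -> R) :
  (forall i, measurable_fun setT (g i)) -> (forall i x, 0 <= g i x) ->
  (\int[lebesgue_rV R n]_x (\prod_i g i (x ord0 i))%:E =
   \prod_i \int[lebesgue_measure]_a (g i a)%:E)%E.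
Proof.
elim: n g => [|n IH] g mg g0.
  rewrite big_ord0 /=; under eq_integral do rewrite big_ord0.
  rewrite integral_cst// mul1e; exact: diracT.
rewrite ge0_integral_rV_cons; last 2 first.
- apply/measurable_EFinP; apply: measurable_prod => i _.
  exact: (measurableT_comp (mg i) (@measurable_coord _ _ _)).
- by move=> x; rewrite lee_fin prodr_ge0.
rewrite big_ord_recl -(IH (fun i => g (lift ord0 i)))//.
transitivity (\int[lebesgue_measure]_a ((g ord0 a)%:E *
  \int[lebesgue_rV R n]_x (\prod_i g (lift ord0 i) (x ord0 i))%:E))%E.
  apply: eq_integral => a _.
  rewrite -ge0_integralZl//.
  - apply: eq_integral => v _; rewrite big_ord_recl EFinM mxE unlift_none.
    by congr (_ * _%:E)%E; apply: eq_bigr => i _; rewrite mxE liftK.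
  - apply/measurable_EFinP; apply: measurable_prod => i _.
    exact: (measurableT_comp (mg _) (@measurable_coord _ _ _)).
  - by move=> x _; rewrite lee_fin prodr_ge0.
  - by rewrite lee_fin.
rewrite ge0_integralZr//.
- by apply/measurable_EFinP; exact: mg.
- by move=> x _; rewrite lee_fin.
- by apply: integral_ge0 => x _; rewrite lee_fin prodr_ge0.
Qed.

(** * Integrals of partial derivatives of compactly supported functions *)

Section divergence.
Context (R : realType).

Lemma integral_derivative_bsupp (g g' : R -> R) (M : R) :
  (forall x : R, is_derive x 1 g (g' x)) -> continuous g' ->
  (forall x, g x != 0 -> `|x| <= M) -> (forall x, g' x != 0 -> `|x| <= M) ->
  (\int[lebesgue_measure]_x (g' x)%:E = 0)%E.
Proof.
move=> dg cg' gM g'M.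
(* Strictly beyond the support, so that [g] vanishes at both ends of the interval on which the
   fundamental theorem is applied. *)
pose N : R := `|M| + 1.
have MN : M < N by rewrite /N (le_lt_trans (ler_norm M))// ltrDl.
have cg : continuous g.
  by move=> x; apply: differentiable_continuous; apply/derivable1_diffP; case: (dg x).
have N0 : - N < N by rewrite gtrN// ltr_wpDl.
transitivity (\int[lebesgue_measure]_(x in `[(- N)%R, N]) (g' x)%:E)%E.
  rewrite [RHS]integral_mkcond; apply: eq_integral => x _.
  rewrite patchE; case: ifPn => // /negP xN; congr EFin; apply/eqP.
  apply/negPn/negP => /g'M xM; apply: xN; rewrite inE/= in_itv/= -ler_norml.
  by rewrite (le_trans xM)// ltW.
have z (x : R) : `|x| = N -> g x = 0.
  by move=> xN; apply/eqP/negPn/negP => /gM; rewrite xN leNgt MN.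
rewrite (@continuous_FTC2 _ _ g)//.
- by rewrite !z ?subee// ?normrN gtr0_norm// /N ltr_wpDl.
- exact: continuous_subspaceT.
- split => [x _| |]; first by case: (dg x).
  + by apply: cvg_at_right_filter; exact: cg.
  + by apply: cvg_at_left_filter; exact: cg.
- by move=> x _; rewrite derive1E; case: (dg x).
Qed.

Lemma rV_consD n (a h : R) (v : 'rV[R]_n) :
  rV_cons (h + a, v) = h *: delta_mx ord0 ord0 + rV_cons (a, v).
Proof.
apply/rowP => i; rewrite !mxE; case: unliftP => [j ->|->] /=.
  by rewrite mulr0 add0r.
by rewrite ?eqxx mulr1.
Qed.

Lemma rV_cons_lift n (a h : R) (v : 'rV[R]_n) i :
  rV_cons (a, h *: delta_mx ord0 i + v) =
  h *: delta_mx ord0 (lift ord0 i) + rV_cons (a, v).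
Proof.
apply/rowP => k; rewrite !mxE; case: unliftP => [j ->|->] /=.
  by rewrite !mxE /= ?(inj_eq (@lift_inj _ ord0)).
by rewrite ?eq_liftF mulr0 add0r.
Qed.

Lemma continuous_rV_cons_r n (a : R) : continuous (fun v : 'rV[R]_n => rV_cons (a, v)).
Proof.
move=> v; apply/(@cvg_ballP _ _ _ (nbhs v)) => e e0; near=> w.
have vw : ball v e w by near: w; exact: nbhsx_ballx.
apply: ball_rV => // i; rewrite !mxE; case: unliftP => [j _|_].
  by have [_ /(_ ord0 j)] := vw.
by rewrite /= subrr normr0.
Unshelve. all: by end_near. Qed.

Lemma continuous_rV_cons_l n (v : 'rV[R]_n) : continuous (fun a : R => rV_cons (a, v)).
Proof.
move=> a; apply/(@cvg_ballP _ _ _ (nbhs a)) => e e0; near=> b.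
have ab : ball a e b by near: b; exact: nbhsx_ballx.
apply: ball_rV => // i; rewrite !mxE; case: unliftP => [j _|_]//=.
by rewrite /= subrr normr0.
Unshelve. all: by end_near. Qed.

(** Outside the box of size [M + 1], a displacement of length less than 1 stays outside the box of
    size [M], so the difference quotients vanish near 0. *)
Lemma bsupp_partial n (f : 'rV[R]_n -> R) i : bsupp f -> bsupp (partial i f).
Proof.
move=> [M fM]; exists (M + 1) => x; apply: contra_neqP => /existsNP[j /negP].
rewrite -ltNge => xj.
suff : h^-1 *: (f (h *: delta_mx ord0 i + x) - f x) @[h --> 0^'] --> (0 : R).
  by move=> /cvg_lim; exact.
apply: cvg_near_cst; near=> h.
have h1 : `|h| < 1 by near: h; exact: dnbhs0_lt.
have fx0 : f x = 0.
  by apply/eqP/negPn/negP => /fM /(_ j); rewrite leNgt => /negP; apply; lra.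
have fhx0 : f (h *: delta_mx ord0 i + x) = 0.
  apply/eqP/negPn/negP => /fM /(_ j); rewrite !mxE/= => H.
  have := ler_normB (h * (j == i)%:R + x ord0 j) (h * (j == i)%:R).
  rewrite addrAC subrr add0r => H'.
  have : `|h * (j == i)%:R| < 1.
    by case: (j == i); rewrite ?mulr1// mulr0 normr0.
  lra.
by rewrite fx0 fhx0 subrr scaler0.
Unshelve. all: by end_near. Qed.

Lemma is_derive_slice_l n (f : 'rV[R]_n.+1 -> R) v (a : R) :
  derivable f (rV_cons (a, v)) (delta_mx ord0 ord0) ->
  is_derive a 1 (fun a => f (rV_cons (a, v))) (partial ord0 f (rV_cons (a, v))).
Proof.
move=> df; have E : (fun h : R => h^-1 *: (f (rV_cons (h *: 1 + a, v)) - f (rV_cons (a, v)))) =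
    (fun h => h^-1 *: (f (h *: delta_mx ord0 ord0 + rV_cons (a, v)) - f (rV_cons (a, v)))).
  by apply/funext => h; rewrite -rV_consD [h *: 1]mulr1.
apply: DeriveDef; first by rewrite /derivable E.
by rewrite /derive E.
Qed.

Lemma partial_slice_r n (f : 'rV[R]_n.+1 -> R) v a i :
  partial i (fun v => f (rV_cons (a, v))) v = partial (lift ord0 i) f (rV_cons (a, v)).
Proof.
have E : (fun h : R => h^-1 *: (f (rV_cons (a, h *: delta_mx ord0 i + v)) -
      f (rV_cons (a, v)))) = (fun h => h^-1 *:
      (f (h *: delta_mx ord0 (lift ord0 i) + rV_cons (a, v)) - f (rV_cons (a, v)))).
  by apply/funext => h; rewrite rV_cons_lift.
by rewrite /partial /derive E.
Qed.

Lemma derivable_slice_r n (f : 'rV[R]_n.+1 -> R) v a i :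
  derivable f (rV_cons (a, v)) (delta_mx ord0 (lift ord0 i)) ->
  derivable (fun v => f (rV_cons (a, v))) v (delta_mx ord0 i).
Proof.
move=> df; have E : (fun h : R => h^-1 *: (f (rV_cons (a, h *: delta_mx ord0 i + v)) -
      f (rV_cons (a, v)))) = (fun h => h^-1 *:
      (f (h *: delta_mx ord0 (lift ord0 i) + rV_cons (a, v)) - f (rV_cons (a, v)))).
  by apply/funext => h; rewrite rV_cons_lift.
by rewrite /derivable E.
Qed.

(** Induction on the dimension. For the first coordinate, Fubini puts the one-dimensional integral
    inside and it vanishes by the fundamental theorem; for the others, the inner integral is over
    the remaining coordinates and the induction hypothesis applies to each slice. *)
Lemma integral_partial n (f : 'rV[R]_n -> R) i : continuous f -> bsupp f ->
  (forall x, derivable f x (delta_mx ord0 i)) -> continuous (partial i f) ->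
  (\int[lebesgue_rV R n]_x (partial i f x)%:E = 0)%E.
Proof.
elim: n f i => [f []//|n IH] f i cf sf df cdf.
have intf := continuous_bsupp_integrable cdf (bsupp_partial i sf).
have [M fM] := sf; have [M' dfM'] := bsupp_partial i sf.
case: (unliftP ord0 i) => [j|] ij; last first.
  rewrite (integral_rV_cons21 intf) integral0_eq// => v _ /=.
  subst i; apply: (@integral_derivative_bsupp (fun a => f (rV_cons (a, v))) _ (Num.max M M')).
  - by move=> a; exact: is_derive_slice_l.
  - by move=> a; apply: continuous_comp; [exact: continuous_rV_cons_l|exact: cdf].
  - move=> a /fM /(_ ord0); rewrite mxE unlift_none/= => H.
    by rewrite (le_trans H)// le_max lexx.
  - move=> a /dfM' /(_ ord0); rewrite mxE unlift_none/= => H.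
    by rewrite (le_trans H)// le_max lexx orbT.
rewrite (integral_rV_cons12 intf) integral0_eq// => a _ /=.
subst i; under eq_integral do rewrite -partial_slice_r.
apply: IH.
- by move=> v; apply: continuous_comp; [exact: continuous_rV_cons_r|exact: cf].
- exists M => v /fM vM i; by have := vM (lift ord0 i); rewrite mxE liftK.
- by move=> v; exact: derivable_slice_r.
- rewrite (_ : partial j _ = fun v => partial (lift ord0 j) f (rV_cons (a, v))).
    by move=> v; apply: continuous_comp; [exact: continuous_rV_cons_r|exact: cdf].
  by apply/funext => v; rewrite partial_slice_r.
Qed.

End divergence.

Section density_measure.
Context d (T : measurableType d) (R : realType) (mu : {measure set T -> \bar R}).
Variable w : T -> \bar R.
Hypotheses (mw : measurable_fun setT w) (w0 : forall x, (0 <= w x)%E).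

Definition density_measure (A : set T) : \bar R := (\int[mu]_(x in A) w x)%E.

Let density0 : density_measure set0 = 0%E.
Proof. exact: integral_set0. Qed.

Let density_ge0 A : (0 <= density_measure A)%E.
Proof. by apply: integral_ge0 => x _. Qed.

Let density_sigma_additive : semi_sigma_additive density_measure.
Proof. exact: semi_sigma_additive_nng_induced. Qed.

HB.instance Definition _ := isMeasure.Build _ _ _ density_measure
  density0 density_ge0 density_sigma_additive.

Definition density : {measure set T -> \bar R} := density_measure.

End density_measure.

(** * Open boxes determine locally integrable functions *)

Section boxes.
Context (R : realType) (n : nat).
Notation leb := (lebesgue_rV R n).

Definition obox (a b : 'I_n -> R) : set 'rV[R]_n :=
  [set x | forall i, `]a i, b i[%classic (x ord0 i)].

Definition oboxes : set (set 'rV[R]_n) := [set A | exists a b, A = obox a b].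

Let cube k : set 'rV[R]_n := obox (fun=> - k%:R) (fun=> k%:R).

Let cube_cover : \bigcup_k cube k = setT.
Proof.
apply/seteqP; split=> // x _.
pose M := \sum_i `|x ord0 i|.
exists (Num.truncn M).+1 => // i /=; rewrite in_itv/= -ltr_norml.
apply: le_lt_trans (truncnS_gt M).
by rewrite /M (bigD1 i)//= lerDl sumr_ge0//.
Qed.

Lemma measurable_obox a b : measurable (obox a b).
Proof.
rewrite (_ : obox a b = \bigcap_(i in [set: 'I_n])
    ((fun x : 'rV[R]_n => x ord0 i) @^-1` `]a i, b i[)).
  apply: fin_bigcap_measurable => // i _.
  by rewrite -[X in measurable X]setTI; exact: measurable_coord.
by apply/seteqP; split=> [x Ax i _|x Ax i]; [exact: Ax|exact: (Ax i I)].
Qed.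

Lemma setI_closed_oboxes : setI_closed oboxes.
Proof.
move=> _ _ [a [b ->]] [a' [b' ->]].
exists (fun i => Num.max (a i) (a' i)), (fun i => Num.min (b i) (b' i)).
apply/seteqP; split=> [x [H H'] i|x H].
  have := H i; have := H' i; rewrite /= !in_itv/= gt_max lt_min.
  by move=> /andP[-> ->] /andP[-> ->].
by split=> i; have := H i; rewrite /= !in_itv/= gt_max lt_min => /andP[/andP[? ?] /andP[? ?]]; apply/andP.
Qed.

Lemma measurable_oboxesE : (@measurable _ 'rV[R]_n) = <<s oboxes >>.
Proof.
apply/seteqP; split; last first.
  apply: smallest_sub; first exact: sigma_algebra_measurable.
  by move=> _ [a [b ->]]; exact: measurable_obox.
apply: smallest_sub; first exact: smallest_sigma_algebra.
rewrite -bigcup_seq => A [i _] [B mB <-] /=.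
have : measurable_fun setT (fun x : g_sigma_algebraType oboxes => (x : 'rV[R]_n) ord0 i).
  apply: (measurability _ (RGenOpens.measurableE R)).
  move=> _ [_ [a [b ->] <-]].
  (* The other coordinates are confined to growing intervals, so that a cylinder becomes a countable
     union of bounded boxes. *)
  rewrite (_ : _ `&` _ = \bigcup_k (obox (fun j => if j == i then a else - k%:R)
       (fun j => if j == i then b else k%:R) : set (g_sigma_algebraType oboxes))).
    by apply: bigcupT_measurable => k; apply: sub_sigma_algebra; do 2 eexists.
  apply/seteqP; split=> [x [_ /= xab]|x [k _ /(_ i) /=]]; last by rewrite eqxx.
  have : (\bigcup_k cube k) x by rewrite cube_cover.
  move=> [k _ kx]; exists k => // j.
  by case: eqP => [->|_]; [exact: xab|exact: kx].
by move=> /(_ measurableT B mB).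
Qed.

Lemma obox_sub_box a b : obox a b `<=` box (\sum_i (`|a i| + `|b i|)).
Proof.
move=> x H i; have := H i; rewrite /= in_itv/= => /andP[ax xb].
have : `|x ord0 i| <= `|a i| + `|b i|.
  rewrite ler_norml; apply/andP; split.
    by have := ler_normr (- a i) (`|a i|); have := lerNnormlW (lexx `|a i|); have := normr_ge0 (b i); lra.
  by have := ler_norm (b i); have := normr_ge0 (a i); lra.
move=> /le_trans; apply; rewrite [leRHS](bigD1 i)//= lerDl sumr_ge0//.
Qed.

Lemma locally_integrable_obox (h : 'rV[R]_n -> R) a b : locally_integrable_rV h ->
  leb.-integrable (obox a b) (EFin \o h).
Proof.
move=> [mh hK]; apply: integrableS (hK _ (@compact_box _ _ _)).
- by apply: compact_measurable_rV; exact: compact_box.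
- exact: measurable_obox.
- exact: obox_sub_box.
Qed.

(** The positive and negative parts of [h] are densities of two measures that agree on open boxes,
    hence on all measurable sets, since open boxes are stable under intersection and generate. So
    [h] has zero integral over every measurable part of a cube, and vanishes almost everywhere on
    each of the countably many cubes. *)
Lemma ae0_integral_obox (h : 'rV[R]_n -> R) : locally_integrable_rV h ->
  (forall a b, (\int[leb]_(x in obox a b) (h x)%:E = 0)%E) ->
  ae_eq leb setT (EFin \o h) (cst 0%E).
Proof.
move=> lh h0; have [mh hK] := lh.
have mh' : measurable_fun setT (EFin \o h) by exact/measurable_EFinP.
pose m1 := density leb (measurable_funepos mh') (funepos_ge0 _).
pose m2 := density leb (measurable_funeneg mh') (funeneg_ge0 _).
have E a b : m1 (obox a b) = m2 (obox a b).
  have i := locally_integrable_obox a b lh; have := h0 a b; rewrite integralE.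
  have P : m1 (obox a b) \is a fin_num := integrable_pos_fin_num (measurable_obox a b) i.
  have Q : m2 (obox a b) \is a fin_num := integrable_neg_fin_num (measurable_obox a b) i.
  move=> H; have {H} : (m1 (obox a b) - m2 (obox a b) = 0)%E := H.
  by rewrite -(fineK P) -(fineK Q) -EFinB => -[/eqP]; rewrite subr_eq0 => /eqP ->.
have m1m2 A : measurable A -> m1 A = m2 A.
  apply: (measure_unique oboxes cube); first exact: measurable_oboxesE.
  - exact: setI_closed_oboxes.
  - by move=> k; exists (fun=> - k%:R), (fun=> k%:R).
  - exact: cube_cover.
  - by move=> _ [a [b ->]]; exact: E.
  - move=> k; rewrite ltey_eq; apply/orP; left.
    by apply: integrable_pos_fin_num; [exact: measurable_obox|exact: locally_integrable_obox].
have aeM k : ae_eq leb (cube k) (EFin \o h) (cst 0%E).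
  apply: integral_ae_eq; [exact: measurable_obox|exact: locally_integrable_obox|exact: measurable_cst|].
  move=> A Ak mA; rewrite integral0 integralE.
  have iA : leb.-integrable A (EFin \o h).
    apply: (integrableS _ mA Ak); first exact: measurable_obox.
    exact: locally_integrable_obox.
  rewrite -[X in (X - _)%E]/(m1 A) -[X in (_ - X)%E]/(m2 A) -m1m2// subee//.
  exact: integrable_pos_fin_num.
have H : leb.-negligible (\bigcup_k (~` [set x | cube k x -> (EFin \o h) x = cst 0%E x])).
  by apply: negligible_bigcup => k; exact: aeM.
apply: negligibleS H => x /= nx.
have : (\bigcup_k cube k) x by rewrite cube_cover.
by move=> [k _ kx]; exists k => //= /(_ kx) hx; apply: nx.
Qed.

End boxes.

(** * Calculus of smooth functions *)

Section smooth_calculus.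
Context (R : realType) (n : nat).
Implicit Types (f g : 'rV[R]_n -> R) (x : 'rV[R]_n) (i j : 'I_n).
Notation dir i := (delta_mx (ord0 : 'I_1) i : 'rV[R]_n).

Lemma smooth_diff f : smooth f -> forall x, differentiable f x.
Proof. by move=> sf x; exact: (sf [::]). Qed.

Lemma smooth_partial i f : smooth f -> smooth (partial i f).
Proof. by move=> sf s x; have := sf (rcons s i) x; rewrite foldr_rcons. Qed.

(** Smoothness by coinduction: a class of differentiable functions stable under partial derivatives
    consists of smooth functions. It spares any formula for iterated derivatives. *)
Lemma smooth_coind (C : ('rV[R]_n -> R) -> Prop) :
  (forall f, C f -> forall x, differentiable f x) ->
  (forall i f, C f -> C (partial i f)) -> forall f, C f -> smooth f.
Proof.
move=> Cd Cp f Cf s; elim/last_ind: s f Cf => [|s i IH] f Cf x; first exact: Cd.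
by rewrite foldr_rcons; apply: IH; exact: Cp.
Qed.

Lemma smooth_continuous f : smooth f -> continuous f.
Proof. by move=> sf x; apply: differentiable_continuous; exact: smooth_diff. Qed.

Lemma smooth_derivable f x v : smooth f -> derivable f x v.
Proof. by move=> sf; apply: diff_derivable; exact: smooth_diff. Qed.

Lemma partialD i f g x : differentiable f x -> differentiable g x ->
  partial i (fun x => f x + g x) x = partial i f x + partial i g x.
Proof. by move=> df dg; rewrite /partial deriveD//; exact: diff_derivable. Qed.

Lemma partialM i f g x : differentiable f x -> differentiable g x ->
  partial i (fun x => f x * g x) x = partial i f x * g x + f x * partial i g x.
Proof.
move=> df dg; rewrite /partial deriveM; try exact: diff_derivable.
by rewrite addrC [g x *: _]mulrC.
Qed.

Lemma partial_cst i (c : R) x : partial i (fun=> c) x = 0.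
Proof. by rewrite /partial derive_cst. Qed.

Lemma partial_coord i j x : partial i (fun x => x ord0 j) x = (i == j)%:R.
Proof.
rewrite /partial /derive; apply: cvg_lim => //.
apply: cvg_near_cst; near=> h.
have h0 : h != 0 by near: h; exact: nbhs_dnbhs_neq.
by rewrite /= !mxE addrK -[_ *: _]/(_ * _) mulrA mulVf// mul1r eq_sym.
Unshelve. all: by end_near. Qed.

(** The derivative of a product is a sum of products, so a class fit for [smooth_coind] must be
    closed under both operations. *)
Inductive smooth_alg : ('rV[R]_n -> R) -> Prop :=
| smooth_alg_gen f : smooth f -> smooth_alg f
| smooth_alg_add f g : smooth_alg f -> smooth_alg g -> smooth_alg (fun x => f x + g x)
| smooth_alg_mul f g : smooth_alg f -> smooth_alg g -> smooth_alg (fun x => f x * g x).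

Lemma smooth_alg_diff f : smooth_alg f -> forall x, differentiable f x.
Proof.
elim=> {f} [f sf|f g _ df _ dg|f g _ df _ dg] x; first exact: smooth_diff.
- exact: differentiableD.
- exact: differentiableM.
Qed.

Lemma smooth_algP f : smooth_alg f -> smooth f.
Proof.
apply: smooth_coind => {f}; first exact: smooth_alg_diff.
move=> i f; elim=> {f} [f sf|f g af pf ag pg|f g af pf ag pg].
- by apply: smooth_alg_gen; exact: smooth_partial.
- rewrite (_ : partial i _ = fun x => partial i f x + partial i g x).
    exact: smooth_alg_add.
  by apply/funext => x; rewrite partialD//; exact: smooth_alg_diff.
- rewrite (_ : partial i _ = fun x => partial i f x * g x + f x * partial i g x).
    by apply: smooth_alg_add; exact: smooth_alg_mul.
  by apply/funext => x; rewrite partialM//; exact: smooth_alg_diff.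
Qed.

Lemma smoothD f g : smooth f -> smooth g -> smooth (fun x => f x + g x).
Proof. by move=> sf sg; apply: smooth_algP; apply: smooth_alg_add; exact: smooth_alg_gen. Qed.

Lemma smoothM f g : smooth f -> smooth g -> smooth (fun x => f x * g x).
Proof. by move=> sf sg; apply: smooth_algP; apply: smooth_alg_mul; exact: smooth_alg_gen. Qed.

Lemma smooth_cst (c : R) : smooth (fun _ : 'rV[R]_n => c).
Proof.
apply: (@smooth_coind (fun f => exists c, f = fun=> c)); last by exists c.
  by move=> _ [{}c ->] x; exact: differentiable_cst.
by move=> i _ [{}c ->]; exists 0; apply/funext => x; exact: partial_cst.
Qed.

Lemma smooth_coord i : smooth (fun x => x ord0 i).
Proof.
move=> s; elim/last_ind: s => [|s j _] x; first exact: differentiable_coord.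
rewrite foldr_rcons (_ : partial j _ = fun=> (j == i)%:R); first exact: smooth_cst.
by apply/funext => y; exact: partial_coord.
Qed.

Lemma smoothN f : smooth f -> smooth (fun x => - f x).
Proof.
move=> sf; rewrite (_ : (fun x => _) = fun x => -1 * f x).
  by apply: smoothM => //; exact: smooth_cst.
by apply/funext => x; rewrite mulN1r.
Qed.

Lemma smoothB f g : smooth f -> smooth g -> smooth (fun x => f x - g x).
Proof. by move=> sf sg; apply: smoothD => //; exact: smoothN. Qed.

Lemma smooth_sum (I : Type) (r : seq I) (P : pred I) (F : I -> 'rV[R]_n -> R) :
  (forall k, smooth (F k)) -> smooth (fun x => \sum_(k <- r | P k) F k x).
Proof.
move=> sF; elim: r => [|k r IH].
  by under eq_fun do rewrite big_nil; exact: smooth_cst.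
under eq_fun do rewrite big_cons; case: (P k) => //.
exact: smoothD.
Qed.

Lemma smooth_prod (I : Type) (r : seq I) (P : pred I) (F : I -> 'rV[R]_n -> R) :
  (forall k, smooth (F k)) -> smooth (fun x => \prod_(k <- r | P k) F k x).
Proof.
move=> sF; elim: r => [|k r IH].
  by under eq_fun do rewrite big_nil; exact: smooth_cst.
under eq_fun do rewrite big_cons; case: (P k) => //.
exact: smoothM.
Qed.

Lemma partial_sum i (I : Type) (r : seq I) (F : I -> 'rV[R]_n -> R) x :
  (forall k, smooth (F k)) ->
  partial i (fun x => \sum_(k <- r) F k x) x = \sum_(k <- r) partial i (F k) x.
Proof.
move=> sF; elim: r => [|k r IH].
  by rewrite big_nil; under eq_fun do rewrite big_nil; exact: partial_cst.
rewrite big_cons; under eq_fun do rewrite big_cons.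
by rewrite partialD ?IH//; apply: smooth_diff => //; exact: smooth_sum.
Qed.

Lemma partialZ i (c : R) f x : differentiable f x ->
  partial i (fun x => c * f x) x = c * partial i f x.
Proof.
by move=> df; rewrite partialM//; rewrite ?partial_cst ?mul0r ?add0r//.
Qed.

Lemma partialB i f g x : differentiable f x -> differentiable g x ->
  partial i (fun x => f x - g x) x = partial i f x - partial i g x.
Proof. by move=> df dg; rewrite /partial deriveB//; exact: diff_derivable. Qed.

Lemma differentiable_comp1 (h : R -> R) f x (l : R) : differentiable f x ->
  is_derive (f x) 1 h l -> differentiable (h \o f) x.
Proof.
move=> df [dh _]; apply: differentiable_comp => //.
exact/derivable1_diffP.
Qed.

Lemma partial_comp1 i (h : R -> R) f x (l : R) : differentiable f x ->
  is_derive (f x) 1 h l -> partial i (h \o f) x = l * partial i f x.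
Proof.
move=> df [dh dl]; have dh' := (derivable1_diffP h (f x)).1 dh.
rewrite /partial deriveE; last exact: differentiable_comp.
rewrite diff_comp//= -(deriveE _ df) -/(partial i f x).
have H (u : R) : 'd h (f x) u = u *: 'd h (f x) 1.
  by rewrite -linearZ/= -[u *: 1]/(u * 1) mulr1.
by rewrite H -(deriveE _ dh') dl [LHS]mulrC.
Qed.

Lemma smooth_sqnorm : smooth (@sqnorm R n).
Proof.
by apply: smooth_sum => i; rewrite /= (_ : (fun x => _) = fun x => x ord0 i * x ord0 i) //;
  apply: smoothM; exact: smooth_coord.
Qed.

Lemma smooth_omega : smooth (@omega R n).
Proof. by apply: smoothD; [exact: smooth_cst|exact: smooth_sqnorm]. Qed.

Lemma omega_ge1 x : 1 <= omega x.
Proof. by rewrite /omega lerDl sumr_ge0// => i _; rewrite sqr_ge0. Qed.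

Lemma omega_gt0 x : 0 < omega x.
Proof. exact: lt_le_trans (omega_ge1 x). Qed.

Lemma partial_omega i x : partial i (@omega R n) x = 2 * x ord0 i.
Proof.
rewrite /omega partialD; [|exact: differentiable_cst|by apply: smooth_diff; exact: smooth_sqnorm].
rewrite partial_cst add0r /sqnorm partial_sum; last first.
  by move=> k; apply: smoothM; exact: smooth_coord.
rewrite (bigD1 i)//= big1 ?addr0 => [|k ki]; rewrite partialM;
  try exact: differentiable_coord.
- by rewrite partial_coord eqxx /=; ring.
- by rewrite partial_coord eq_sym (negbTE ki) mulr0 mul0r addr0.
Qed.

Lemma differentiable_omega_powR (s : R) x : differentiable (fun x => omega x `^ s) x.
Proof.
apply: (@differentiable_comp1 (fun t => t `^ s)); first exact: (smooth_diff smooth_omega).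
by apply: is_derive1_powR; exact: omega_gt0.
Qed.

Lemma partial_omega_powR i (s : R) x :
  partial i (fun x => omega x `^ s) x = 2 * s * x ord0 i * omega x `^ (s - 1).
Proof.
rewrite (@partial_comp1 i (fun t => t `^ s) _ _ _ _ (is_derive1_powR s (omega_gt0 x))).
  by rewrite partial_omega; ring.
exact: (smooth_diff smooth_omega).
Qed.

Lemma smooth_omega_powR (s : R) : smooth (fun x => omega x `^ s).
Proof.
(* The class with a smooth factor and an arbitrary exponent is stable: a derivative lowers the
   exponent by 1 and changes the factor. *)
suff H : forall f, (exists a (s : R), smooth a /\ f = fun x => a x * omega x `^ s) -> smooth f.
  apply: H; exists (fun=> 1), s; split; first exact: smooth_cst.
  by apply/funext => x; rewrite mul1r.
apply: smooth_coind => {s} [f [a [s [sa ->]]] x|i f [a [s [sa ->]]]].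
  by apply: differentiableM; [exact: smooth_diff|exact: differentiable_omega_powR].
exists (fun x => partial i a x * omega x + a x * (2 * s * x ord0 i)), (s - 1); split.
  apply: smoothD; apply: smoothM => //; first exact: smooth_partial.
    exact: smooth_omega.
  by apply: smoothM; [exact: smooth_cst|exact: smooth_coord].
apply/funext => x; rewrite partialM; [|exact: smooth_diff|exact: differentiable_omega_powR].
rewrite partial_omega_powR.
have -> : omega x `^ s = omega x `^ (s - 1) * omega x.
  rewrite -{1}[s](subrK 1) [LHS]powRD; last by rewrite (gt_eqF (omega_gt0 x)) implybT.
  by rewrite powRr1// ltW// omega_gt0.
by ring.
Qed.

Lemma test_functionE f : test_function f <-> smooth f /\ bsupp f.
Proof. by split=> -[sf /bsuppP cf]; split. Qed.

End smooth_calculus.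

(** * Symmetry of mixed second derivatives *)

Section symmetry_of_partials.
Context (R : realType) (n : nat).
Implicit Types (f g : 'rV[R]_n -> R) (x y : 'rV[R]_n) (i j : 'I_n).
Notation dir i := (delta_mx (ord0 : 'I_1) i : 'rV[R]_n).

Lemma is_derive_line g x i (t : R) : derivable g (t *: dir i + x) (dir i) ->
  is_derive t 1 (fun t => g (t *: dir i + x)) (partial i g (t *: dir i + x)).
Proof.
move=> dg; have E : (fun h : R => h^-1 *: (g ((h *: 1 + t) *: dir i + x) - g (t *: dir i + x))) =
    (fun h => h^-1 *: (g (h *: dir i + (t *: dir i + x)) - g (t *: dir i + x))).
  by apply/funext => h; rewrite [h *: 1]mulr1 scalerDl addrA.
apply: DeriveDef; first by rewrite /derivable E.
by rewrite /derive E.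
Qed.

Lemma MVT_partial g x i (h : R) : 0 < h -> (forall y, derivable g y (dir i)) ->
  exists2 c, 0 < c < h & g (h *: dir i + x) - g x = h * partial i g (c *: dir i + x).
Proof.
move=> h0 dg.
have D (t : R) := @is_derive_line g x i t (dg _).
have C : {within `[0, h], continuous (fun t : R => g (t *: dir i + x))}.
  apply: continuous_subspaceT => t; apply: differentiable_continuous.
  by apply/derivable1_diffP; case: (D t).
have [c] := MVT h0 (fun t _ => D t) C.
rewrite in_itv/= => ch; rewrite scale0r add0r subr0 mulrC => H; by exists c.
Qed.

Lemma translateE f v i y :
  (fun h : R => h^-1 *: (f (v + (h *: dir i + y)) - f (v + y))) =
  (fun h => h^-1 *: (f (h *: dir i + (v + y)) - f (v + y))).
Proof. by apply/funext => k; rewrite addrCA. Qed.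

Lemma partial_translate f v i y : partial i (fun x => f (v + x)) y = partial i f (v + y).
Proof. by rewrite /partial /derive translateE. Qed.

Lemma derivable_translate f v i y : derivable f (v + y) (dir i) ->
  derivable (fun x => f (v + x)) y (dir i).
Proof. by rewrite /derivable translateE. Qed.

(** The mean value theorem is applied along direction [i] to the increment of [f] in direction [j],
    then along [j] to [partial i f]. *)
Lemma second_difference f x i j (h : R) : 0 < h -> smooth f ->
  exists a b, [/\ 0 < a < h, 0 < b < h &
    f (h *: dir j + (h *: dir i + x)) - f (h *: dir i + x) - (f (h *: dir j + x) - f x) =
    h * (h * partial j (partial i f) (b *: dir j + (a *: dir i + x)))].
Proof.
move=> h0 sf.
pose g y := f (h *: dir j + y) - f y.
have d1 k y : derivable (fun y => f (h *: dir j + y)) y (dir k).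
  by apply: derivable_translate; exact: smooth_derivable.
have dg y : derivable g y (dir i).
  by apply: derivableB; [exact: d1|exact: smooth_derivable].
have [a ah ga] := @MVT_partial g x i h h0 dg.
have gE y : partial i g y = partial i f (h *: dir j + y) - partial i f y.
  rewrite [LHS]/partial deriveB; [|exact: d1|exact: smooth_derivable].
  exact: (congr1 (fun u => u - partial i f y) (partial_translate f (h *: dir j) i y)).
have dif y : derivable (partial i f) y (dir j).
  by apply: smooth_derivable; exact: smooth_partial.
have [b bh fb] := @MVT_partial (partial i f) (a *: dir i + x) j h h0 dif.
by exists a, b; split => //; rewrite -fb -gE -ga.
Qed.

Let subr_swap (a b u v : R) : a - b - (u - v) = a - u - (b - v).
Proof. ring. Qed.

(** The second difference is symmetric in [i] and [j], so the two mixed derivatives take a common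
    value at two points near [x]; both are continuous. *)
Lemma partialC f i j x : smooth f -> partial i (partial j f) x = partial j (partial i f) x.
Proof.
move=> sf; apply/eqP; rewrite -subr_eq0 -normr_le0; apply/ler_addgt0Pr => e e0.
rewrite add0r.
have e2 : 0 < e / 2 by lra.
have cont k l : continuous (partial k (partial l f)).
  by apply: smooth_continuous; do 2 apply: smooth_partial.
have [d1 /= d10 d1P] := (@nbhs_ballP _ _ x _).1 (@cvgr_dist_lt _ _ _ _ _ _ _ (cont i j x) _ e2).
have [d2 /= d20 d2P] := (@nbhs_ballP _ _ x _).1 (@cvgr_dist_lt _ _ _ _ _ _ _ (cont j i x) _ e2).
(* The intermediate points differ from [x] by less than [2 * h] in each coordinate. *)
pose h := Num.min d1 d2 / 2.
have h0 : 0 < h by rewrite divr_gt0// lt_min d10.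
have [h1 h2] : 2 * h <= d1 /\ 2 * h <= d2.
  by rewrite /h mulrC divfK// !ge_min !lexx orbT.
clearbody h.
have [a [b [ah bh E1]]] := @second_difference f x i j h h0 sf.
have [b' [a' [bh' ah' E2]]] := @second_difference f x j i h h0 sf.
have near_x d k l (s t : R) : 2 * h <= d -> 0 < s < h -> 0 < t < h ->
    ball x d (s *: dir k + (t *: dir l + x)).
  move=> hd /andP[s0 sh] /andP[t0 th]; have d0 : 0 < d by apply: lt_le_trans hd; rewrite mulr_gt0.
  apply: ball_rV => // m.
  rewrite !mxE/= addrA distrC addrK (le_lt_trans (ler_normD _ _))//.
  have H (r : R) (c : bool) : 0 < r -> r < h -> `|r * c%:R| < h.
    by case: c => r0 rh; rewrite ?mulr1 ?mulr0 ?normr0 ?gtr0_norm.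
  by apply: lt_le_trans hd; rewrite mulr_natl mulr2n ltrD// H.
have {}E1 : partial j (partial i f) (b *: dir j + (a *: dir i + x)) =
    partial i (partial j f) (a' *: dir i + (b' *: dir j + x)).
  have hn0 : h != 0 by rewrite gt_eqF.
  apply: (mulfI hn0); apply: (mulfI hn0).
  apply: etrans (esym E1) _; apply: etrans _ E2.
  have := congr1 f (addrCA (h *: dir j) (h *: dir i) x).
  move: (f (h *: dir j + (h *: dir i + x))) => a0 ->; exact: subr_swap.
have := d1P _ (near_x _ i j _ _ h1 ah' bh').
have := d2P _ (near_x _ j i _ _ h2 bh ah).
rewrite -E1; move: (partial j (partial i f) (b *: _ + _)) => u A B.
apply: le_trans (ler_distD u _ _) _; rewrite (splitr e).
by apply: lerD; apply: ltW; [exact: B|rewrite distrC; exact: A].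
Qed.

End symmetry_of_partials.

(** * Bump functions and the du Bois-Reymond lemma *)

Section flat_exponential.
Context (R : realType).
Implicit Types (t : R) (k : nat).

(* [t^-k exp (- 1 / t)], extended by 0; the derivative of the [k]-th function is
   a combination of the next two. *)
Definition flat_exp k t : R := if 0 < t then t^-1 ^+ k * expR (- t^-1) else 0.

Lemma flat_exp_ge0 k t : 0 <= flat_exp k t.
Proof.
rewrite /flat_exp; case: ifPn => // t0.
by rewrite mulr_ge0 ?expR_ge0// exprn_ge0// invr_ge0 ltW.
Qed.

(** From [exp y >= y^(k+2) / (k+2)!] at [y = 1/t]. Being quadratic, the bound makes the derivative
    at 0 exist and vanish, for every [k]. *)
Lemma flat_exp_le k t : flat_exp k t <= k.+2`!%:R * t ^+ 2.
Proof.
rewrite /flat_exp; case: ifPn => t0; last by rewrite mulr_ge0 ?sqr_ge0.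
have y0 : 0 < t^-1 by rewrite invr_gt0.
have := @expR_ge1Dxn R t^-1 k.+1 (ltW y0).
have f0 : 0 < k.+2`!%:R :> R by rewrite ltr0n fact_gt0.
rewrite expRN => H.
rewrite ler_pdivrMr ?expR_gt0//.
have {}H : t^-1 ^+ k.+2 <= k.+2`!%:R * expR t^-1.
  by rewrite mulrC -ler_pdivrMr//; lra.
rewrite mulrAC -ler_pdivrMr ?exprn_gt0//; apply: le_trans H.
by rewrite -exprVn -exprD addn2.
Qed.

Lemma is_derive_flat_exp k t :
  is_derive t 1 (flat_exp k) (flat_exp k.+2 t - k%:R * flat_exp k.+1 t).
Proof.
have [t0|t0|->] := ltgtP t 0.
- have -> : flat_exp k.+2 t - k%:R * flat_exp k.+1 t = 0.
    by rewrite /flat_exp ltNge (ltW t0)/= mulr0 subrr.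
  apply: (near_eq_is_derive (f := cst (0 : R))).
  near=> s; rewrite /flat_exp ltNge (_ : s <= 0)//.
  have : s \in `]-oo, 0[ by near: s; apply: near_in_itvNyo; rewrite in_itv.
  by rewrite in_itv/= => /ltW.
- have t00 : t != 0 by rewrite gt_eqF.
  apply: (near_eq_is_derive (f := (fun u => u ^+ k * expR (- u)) \o (fun s => s^-1))).
    near=> s; rewrite /flat_exp (_ : 0 < s)//.
    have : s \in `]0, +oo[ by near: s; apply: near_in_itvoy; rewrite in_itv/= t0.
    by rewrite in_itv/= andbT.
  have dV : is_derive t 1 (fun s : R => s^-1) (- t ^- 2).
    by apply: (is_derive_eq (@is_deriveV R id t 1 1 t00 (is_derive_id t 1))); rewrite [_ *: _]mulr1.
  have dE (u : R) : is_derive u 1 (fun u => u ^+ k * expR (- u))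
      (k%:R * u ^+ k.-1 * expR (- u) - u ^+ k * expR (- u)).
    have d1 : is_derive u 1 (fun u : R => u ^+ k) (k%:R * u ^+ k.-1).
      rewrite (_ : (fun u : R => u ^+ k) = (id : R -> R) ^+ k); last first.
        by apply/funext => v; rewrite exprfctE.
      by apply: (is_derive_eq (@is_deriveX R _ id k u 1 1 (is_derive_id u 1))); rewrite [_ *: _]mulr1.
    have d2 : is_derive u 1 (fun u : R => expR (- u)) (- expR (- u)).
      by apply: (is_derive_eq (@is_derive1_comp R expR -%R u _ _ (is_derive_expR _) (is_deriveNid u 1))); rewrite mulrN1.
    apply: (is_derive_eq (is_deriveM d1 d2)).
    by rewrite -![_ *: _]/(_ * _); ring.
  apply: (is_derive_eq (is_derive1_comp (dE t^-1) dV)).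
  rewrite /flat_exp t0 -exprVn !exprS; case: k {dE} => [|k] /=; first by rewrite expr0; ring.
  by rewrite exprS -natr1; ring.
- have -> : flat_exp k.+2 0 - k%:R * flat_exp k.+1 0 = 0.
    by rewrite /flat_exp ltxx mulr0 subrr.
  suff H : h^-1 *: (flat_exp k (h *: 1 + 0) - flat_exp k 0) @[h --> 0^'] --> (0 : R).
    by apply: DeriveDef; [exact: (cvgP (0 : R))|exact: cvg_lim].
  pose C : R := k.+2`!%:R; have C0 : 0 < C by rewrite ltr0n fact_gt0.
  apply/cvgrPdist_le => e e0; near=> h.
  have h0 : h != 0 by near: h; exact: nbhs_dnbhs_neq.
  have hC : `|h| < e / C by near: h; apply: dnbhs0_lt; rewrite divr_gt0.
  rewrite [flat_exp k 0]/flat_exp ltxx subr0 addr0 [h *: 1]mulr1 sub0r normrN.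
  rewrite -[_ *: _]/(_ * _) normrM normfV mulrC ler_pdivrMr ?normr_gt0//.
  rewrite ger0_norm ?flat_exp_ge0// (le_trans (flat_exp_le k h))// -/C.
  rewrite -real_normK ?num_real// expr2 mulrA ler_wpM2r//.
  by move: hC; rewrite ltr_pdivlMr// => /ltW; rewrite mulrC.
Unshelve. all: by end_near. Qed.

(* [exp (-1/(m (t - a)) - 1/(m (b - t)))] on [(a, b)]. *)
Definition bump (a b m t : R) : R := flat_exp 0 (m * t - m * a) * flat_exp 0 (m * b - m * t).

Lemma flat_exp0E t : flat_exp 0 t = if 0 < t then expR (- t^-1) else 0.
Proof. by rewrite /flat_exp; case: ifP; rewrite ?expr0 ?mul1r. Qed.

Lemma bump_ge0 a b m t : 0 <= bump a b m t.
Proof. by rewrite mulr_ge0 ?flat_exp_ge0. Qed.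

Lemma flat_exp0_le1 t : flat_exp 0 t <= 1.
Proof.
rewrite flat_exp0E; case: ifPn => // t0.
by rewrite expR_le1 oppr_le0 invr_ge0 ltW.
Qed.

Lemma bump_le1 a b m t : bump a b m t <= 1.
Proof. by rewrite mulr_ile1 ?flat_exp_ge0 ?flat_exp0_le1. Qed.

Lemma bump_neq0 a b m t : 0 < m -> bump a b m t != 0 -> a < t < b.
Proof.
move=> m0; rewrite mulf_eq0 negb_or /flat_exp -!mulrBr !pmulr_rgt0// !subr_gt0.
by case: ifP => at_; case: ifP => tb_; rewrite ?eqxx ?andbF.
Qed.

Lemma flat_exp0_cvg1 (s : R) : 0 < s ->
  flat_exp 0 (k.+1%:R * s) @[k --> \oo] --> (1 : R).
Proof.
move=> s0; rewrite -[X in _ --> X]expR0 -[in X in _ --> X]oppr0.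
rewrite (_ : (fun k => _) = (fun k => expR (- (s^-1 * k.+1%:R^-1)))); last first.
  by apply/funext => k; rewrite flat_exp0E pmulr_rgt0// s0 invfM mulrC.
apply: (continuous_cvg _ (@continuous_expR R _)); apply: cvgN.
rewrite -[in X in _ --> X](mulr0 s^-1); apply: cvgMr.
exact: cvg_harmonic.
Qed.

(** Raising [m] sharpens the bump: it tends to the indicator of the open interval while staying
    below 1, as dominated convergence requires. *)
Lemma bump_cvg1 a b t : a < t < b -> bump a b k.+1%:R t @[k --> \oo] --> (1 : R).
Proof.
move=> /andP[at_ tb]; rewrite -[in X in _ --> X](mulr1 1); rewrite /bump.
under eq_fun do rewrite -!mulrBr.
by apply: cvgM; apply: flat_exp0_cvg1; rewrite subr_gt0.
Qed.

End flat_exponential.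

Section smooth_bump.
Context (R : realType) (n : nat).
Implicit Types i : 'I_n.

(** Linear combinations suffice for stability under [partial], because the derivative of
    [flat_exp k] combines [flat_exp k.+2] and [flat_exp k.+1]. *)
Inductive flat_class : ('rV[R]_n -> R) -> Prop :=
| flat_class_exp k i (a b : R) : flat_class (fun x => flat_exp k (a * x ord0 i + b))
| flat_class_add f g : flat_class f -> flat_class g -> flat_class (fun x => f x + g x)
| flat_class_scale (c : R) f : flat_class f -> flat_class (fun x => c * f x).

Let affine i (a b : R) : smooth (fun x : 'rV[R]_n => a * x ord0 i + b).
Proof.
apply: smoothD; last exact: smooth_cst.
by apply: smoothM; [exact: smooth_cst|exact: smooth_coord].
Qed.

Lemma flat_class_diff f : flat_class f -> forall x, differentiable f x.
Proof.
elim=> {f} [k i a b|f g _ df _ dg|c f _ df] x.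
- apply: (@differentiable_comp1 _ _ (flat_exp k)); last exact: is_derive_flat_exp.
  exact: (smooth_diff (affine i a b)).
- exact: differentiableD.
- by apply: differentiableM => //; exact: differentiable_cst.
Qed.

Lemma smooth_flat_exp k i (a b : R) : smooth (fun x : 'rV[R]_n => flat_exp k (a * x ord0 i + b)).
Proof.
apply: (smooth_coind flat_class_diff); last exact: flat_class_exp.
move=> j f; elim=> {k i a b f} [k i a b|f g cf pf cg pg|c f cf pf].
- rewrite (_ : partial j _ = fun x => (a * (j == i)%:R) *
     (flat_exp k.+2 (a * x ord0 i + b) + - k%:R * flat_exp k.+1 (a * x ord0 i + b))).
    by apply: flat_class_scale; apply: flat_class_add;
      [exact: flat_class_exp|apply: flat_class_scale; exact: flat_class_exp].
  apply/funext => x.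
  rewrite (partial_comp1 _ (smooth_diff (affine i a b) x) (is_derive_flat_exp k _)).
  rewrite partialD; [|by apply: smooth_diff; apply: smoothM; [exact: smooth_cst|exact: smooth_coord]|
    exact: differentiable_cst].
  rewrite partial_cst partialZ; last exact: differentiable_coord.
  by rewrite partial_coord; ring.
- rewrite (_ : partial j _ = fun x => partial j f x + partial j g x).
    exact: flat_class_add.
  by apply/funext => x; rewrite partialD//; exact: flat_class_diff.
- rewrite (_ : partial j _ = fun x => c * partial j f x).
    exact: flat_class_scale.
  by apply/funext => x; rewrite partialZ//; exact: flat_class_diff.
Qed.

Lemma smooth_bump i (a b m : R) : smooth (fun x : 'rV[R]_n => bump a b m (x ord0 i)).
Proof.
apply: smoothM; first exact: smooth_flat_exp.
rewrite (_ : (fun x => _) = fun x : 'rV[R]_n => flat_exp 0 (- m * x ord0 i + m * b)).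
  exact: smooth_flat_exp.
by apply/funext => x; rewrite mulNr addrC.
Qed.

End smooth_bump.

(** * Test functions separate locally integrable functions *)

Section test_integrals.
Context (R : realType) (n : nat).
Notation leb := (lebesgue_rV R n).
Implicit Types (h f phi : 'rV[R]_n -> R).

Lemma integrable_mul_bsupp h phi : locally_integrable_rV h ->
  continuous phi -> bsupp phi -> leb.-integrable setT (EFin \o (fun x => h x * phi x)).
Proof.
move=> [mh hK] cphi [M phiM]; have [C C0 CP] := continuous_bounded_box M cphi.
have mB : measurable (@box R n M) by apply: compact_measurable_rV; exact: compact_box.
have iB : leb.-integrable setT ((fun x => C%:E * `|(h x)%:E|)%E \_ (box M)).
  apply/(integrable_mkcond _ mB); apply: integrableZl => //.
  by apply: integrable_abse; apply: hK; exact: compact_box.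
apply: (le_integrable _ _ _ iB) => //.
- apply/measurable_EFinP; apply: measurable_funM => //.
  exact: continuous_measurable_rV.
- move=> x _ /=; rewrite patchE.
  have [phi0|/phiM xM] := eqVneq (phi x) 0.
    by rewrite phi0 mulr0 normr0; apply: abse_ge0.
  rewrite (mem_set xM) /= lee_fin [leRHS]ger0_norm ?mulr_ge0// normrM mulrC.
  by rewrite ler_wpM2r// CP.
Qed.

Lemma test_function_cont phi : test_function phi -> continuous phi.
Proof. by move=> [/smooth_continuous]. Qed.

Lemma test_function_bsupp phi : test_function phi -> bsupp phi.
Proof. by move=> /test_functionE[]. Qed.

Definition prod_bump (a b : 'I_n -> R) (m : R) (x : 'rV[R]_n) : R :=
  \prod_i bump (a i) (b i) m (x ord0 i).

Lemma prod_bump_ge0 a b m x : 0 <= prod_bump a b m x.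
Proof. by apply: prodr_ge0 => i _; exact: bump_ge0. Qed.

Lemma prod_bump_le1 a b m x : prod_bump a b m x <= 1.
Proof. by rewrite /prod_bump prodr_ile1// => i _; rewrite bump_ge0 bump_le1. Qed.

Lemma prod_bump_obox a b m x : 0 < m -> prod_bump a b m x != 0 -> obox a b x.
Proof.
move=> m0 /prodf_neq0 H i; rewrite /= in_itv/=.
by apply: (bump_neq0 m0); exact: H.
Qed.

Lemma prod_bump_cvg1 a b x : obox a b x ->
  prod_bump a b k.+1%:R x @[k --> \oo] --> (1 : R).
Proof.
move=> xab; rewrite /prod_bump; elim: (index_enum _) => [|i r IH].
  by under eq_fun do rewrite big_nil; exact: cvg_cst.
have xi : a i < x ord0 i < b i by have := xab i; rewrite /= in_itv.
have -> : (fun k : nat => \prod_(j <- i :: r) bump (a j) (b j) k.+1%:R (x ord0 j)) =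
    (fun k => bump (a i) (b i) k.+1%:R (x ord0 i) *
      \prod_(j <- r) bump (a j) (b j) k.+1%:R (x ord0 j)).
  by apply/funext => k; rewrite big_cons.
by rewrite -[X in _ --> X](mulr1 1); apply: cvgM => //; exact: bump_cvg1.
Qed.

Lemma test_function_prod_bump a b m : 0 < m -> test_function (prod_bump a b m).
Proof.
move=> m0; apply/test_functionE; split.
  by apply: smooth_prod => i; exact: smooth_bump.
exists (\sum_i (`|a i| + `|b i|)) => x /(prod_bump_obox m0).
exact: obox_sub_box.
Qed.

Lemma locally_integrableB h f : locally_integrable_rV h -> locally_integrable_rV f ->
  locally_integrable_rV (fun x => h x - f x).
Proof.
move=> [mh ih] [mf i_f]; split; first exact: measurable_funB.
move=> K cK; have mK := compact_measurable_rV cK.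
by apply: (integrableB mK (ih K cK) (i_f K cK)).
Qed.

Lemma locally_integrable_continuous f : continuous f -> locally_integrable_rV f.
Proof.
move=> cf; split; first exact: continuous_measurable_rV.
move=> K cK; have mK := compact_measurable_rV cK.
have [M KM] := compact_bounded_box cK.
have [C C0 CP] := continuous_bounded_box M cf.
apply: (@le_integrable _ _ _ _ _ mK _ (EFin \o cst C)).
- by apply/measurable_EFinP; apply: measurable_funTS; exact: continuous_measurable_rV.
- by move=> x Kx; rewrite lee_fin /= (ger0_norm C0); apply: CP; exact: KM.
- apply/integrableP; split; first by apply/measurable_EFinP; exact: measurable_cst.
  rewrite (_ : (fun x => _) = cst `|C%:E|%E)// integral_cst// lte_mul_pinfty ?abse_ge0//.
  apply: le_lt_trans (@lebesgue_box_lty R n M); apply: le_measure; rewrite ?inE//.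
  by apply: compact_measurable_rV; exact: compact_box.
Qed.

(** Products of bumps tend to the indicator of an open box, so by dominated convergence the
    integrals of [h] over open boxes vanish too. *)
Lemma ae0_prod_bump h : locally_integrable_rV h ->
  (forall a b k, \int[leb]_x (h x * prod_bump a b k.+1%:R x) = 0) ->
  ae_eq leb setT (EFin \o h) (cst 0%E).
Proof.
move=> lh h0; apply: ae0_integral_obox => // a b.
have ih := locally_integrable_obox a b lh.
have mB := measurable_obox a b.
have tb k := @test_function_prod_bump a b k.+1%:R (ltr0Sn R k).
have ik k := integrable_mul_bsupp lh (test_function_cont (tb k)) (test_function_bsupp (tb k)).
pose F k x := (h x * prod_bump a b k.+1%:R x)%:E.
have F0 k : (\int[leb]_(x in obox a b) F k x = 0)%E.
  rewrite integral_mkcond (_ : _ \_ _ = F k).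
    have := h0 a b k; rewrite /Rintegral => H.
    by rewrite -[LHS]fineK; [congr (_%:E); exact: H|exact: integrable_fin_num (ik k)].
  apply/funext => x; rewrite patchE; case: ifPn => // /negP xB.
  rewrite /F; have [->|/(prod_bump_obox (ltr0Sn R k)) xab] :=
    eqVneq (prod_bump a b k.+1%:R x) 0; first by rewrite mulr0.
  by exfalso; apply: xB; rewrite inE.
have [] := @dominated_convergence _ _ _ leb (obox a b) mB F (EFin \o h) (fun x => `|(h x)%:E|%E).
- by move=> k; apply: measurable_funTS; exact: measurable_int (ik k).
- exact: measurable_int ih.
- apply: aeW => x xab; apply: cvg_EFin; first by near=> k.
  rewrite -[in X in _ --> X](mulr1 (h x)); apply: cvgMr.
  exact: prod_bump_cvg1.
- exact: integrable_abse.
- apply: aeW => x k xab; rewrite /F lee_fin normrM ler_piMr//.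
  by rewrite ger0_norm ?prod_bump_ge0// prod_bump_le1.
move=> _ _ H; have := cvg_lim (@ereal_hausdorff R) H => <-.
rewrite (_ : [sequence _]_n = cst 0%E); first by rewrite lim_cst.
by apply/funext => k /=; rewrite F0.
Unshelve. all: by end_near. Qed.

(** The du Bois-Reymond lemma; it makes a weak Hessian unique up to null sets, so that the choice
    made by [Hess] is harmless. *)
Lemma ae_eq_test h f : locally_integrable_rV h -> locally_integrable_rV f ->
  (forall phi, test_function phi ->
    \int[leb]_x (h x * phi x) = \int[leb]_x (f x * phi x)) ->
  {ae leb, forall x, h x = f x}.
Proof.
move=> lh lf hf.
have : ae_eq leb setT (EFin \o (fun x => h x - f x)) (cst 0%E).
  apply: ae0_prod_bump; first exact: locally_integrableB.
  move=> a b k; have tb := @test_function_prod_bump a b k.+1%:R (ltr0Sn R k).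
  under eq_Rintegral do rewrite mulrBl.
  rewrite RintegralB//.
  - by rewrite hf// subrr.
  - by apply: integrable_mul_bsupp => //; [exact: test_function_cont|exact: test_function_bsupp].
  - by apply: integrable_mul_bsupp => //; [exact: test_function_cont|exact: test_function_bsupp].
apply: filterS => x /(_ I) /= [/eqP]; by rewrite subr_eq0 => /eqP.
Qed.

End test_integrals.

(** * One-variable factors and primitives of factors of zero mean *)

Section one_dimensional_factors.
Context (R : realType) (n : nat).
Implicit Types g : R -> R.
Notation mu := (@lebesgue_measure R).

(** Smoothness is only defined on row vectors, so that of a one-variable function is expressed
    through its composites with the coordinates. *)
Definition test_factor g :=
  [/\ continuous g, exists M, forall t, g t != 0 -> `|t| <= M &
    forall i : 'I_n, smooth (fun x : 'rV[R]_n => g (x ord0 i))].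

Lemma integrable_test_factor g : test_factor g -> mu.-integrable setT (EFin \o g).
Proof.
move=> [cg [M gM] _].
have H : mu.-integrable `[- M, M] (EFin \o g).
  apply: continuous_compact_integrable; first exact: segment_compact.
  exact: continuous_subspaceT.
have E := @integrable_mkcond _ _ _ mu _ (EFin \o g) (measurable_itv `[- M, M]).
have := E.1 H; congr (mu.-integrable setT _); apply/funext => t; rewrite patchE.
case: ifPn => // /negP tM; apply/esym; congr EFin; apply/eqP/negPn/negP => /gM gt.
by apply: tM; rewrite inE/= in_itv/= -ler_norml.
Qed.

Lemma test_factorD g1 g2 : test_factor g1 -> test_factor g2 ->
  test_factor (fun t => g1 t + g2 t).
Proof.
move=> [c1 [M1 s1] d1] [c2 [M2 s2] d2]; split.
- by move=> t; apply: cvgD; [exact: c1|exact: c2].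
- exists (Num.max M1 M2) => t; have [g0|/s1 + _] := eqVneq (g1 t) 0.
    by rewrite g0 add0r => /s2; rewrite le_max orbC => ->.
  by rewrite le_max => ->.
- by move=> i; apply: smoothD; [exact: d1|exact: d2].
Qed.

Lemma test_factorZ (c : R) g : test_factor g -> test_factor (fun t => c * g t).
Proof.
move=> [cg [M gM] sg]; split.
- by move=> t; apply: cvgMr; exact: cg.
- by exists M => t; rewrite mulf_eq0 negb_or => /andP[_ /gM].
- by move=> i; apply: smoothM => //; exact: smooth_cst.
Qed.

Lemma test_factor_bump (a b m : R) : 0 < m -> test_factor (bump a b m).
Proof.
move=> m0; have cf k t : {for t, continuous (@flat_exp R k)}.
  apply: differentiable_continuous; apply/derivable1_diffP.
  by case: (is_derive_flat_exp k t).
split.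
- move=> t; apply: cvgM.
    apply: (@continuous_comp _ _ _ (fun t => m * t - m * a) (flat_exp 0)); last exact: cf.
    by apply: cvgB; [apply: cvgMr; exact: cvg_id|exact: cvg_cst].
  apply: (@continuous_comp _ _ _ (fun t => m * b - m * t) (flat_exp 0)); last exact: cf.
  by apply: cvgB; [exact: cvg_cst|apply: cvgMr; exact: cvg_id].
- exists (`|a| + `|b|) => t /(bump_neq0 m0) /andP[at_ tb].
  rewrite ler_norml; apply/andP; split.
    by have := lerNnormlW (lexx `|a|); have := normr_ge0 b; lra.
  by have := ler_norm b; have := normr_ge0 a; lra.
- by move=> i; exact: smooth_bump.
Qed.

(** The primitive that starts from minus infinity vanishes to the left of the support; to its right
    it equals the total integral, which is 0. Its derivatives of positive order come from those of
    [g]. *)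
Lemma test_factor_primitive g : test_factor g -> \int[mu]_t g t = 0 ->
  exists2 G, test_factor G & forall t : R, is_derive t 1 G (g t).
Proof.
move=> tg g0; have ig := integrable_test_factor tg.
have [cg [M gM] sg] := tg.
pose G (t : R) := \int[mu]_(s in `]-oo, t]) g s.
have dG (t : R) : is_derive t 1 G (g t).
  have [||||dG DG] := @continuous_FTC1 R g -oo%O t (t + 1).
  - by rewrite ltrDl.
  - by apply: integrableS ig.
  - by rewrite ?bnd_simp ?ltNyr.
  - exact: cg.
  by apply: DeriveDef; [exact: dG|rewrite -derive1E; exact: DG].
have cG : continuous G.
  by move=> t; apply: differentiable_continuous; apply/derivable1_diffP; case: (dG t).
exists G => //; split => //.
- exists (`|M|) => t; apply: contra_neqT; rewrite -ltNge => Mt.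
  have [t0|t0] := ltP t 0.
    rewrite /G /Rintegral integral0_eq// => s; rewrite /= in_itv/= => st.
    congr EFin; apply/eqP/negPn/negP => /gM; rewrite leNgt => /negP; apply.
    rewrite (ltr0_norm t0) in Mt; rewrite (ltr0_norm (le_lt_trans st t0)).
    by rewrite (le_lt_trans (ler_norm M))// (lt_le_trans Mt)// lerN2.
  rewrite -[RHS]g0 /G /Rintegral; congr fine.
  rewrite integral_mkcond; apply: eq_integral => s _; rewrite patchE.
  case: ifPn => // /negP; rewrite inE/= in_itv/= => /negP; rewrite -ltNge => ts.
  apply/esym; congr EFin; apply/eqP/negPn/negP => /gM; rewrite leNgt => /negP; apply.
  rewrite (ger0_norm t0) in Mt; rewrite (gtr0_norm (le_lt_trans t0 ts)).
  by rewrite (le_lt_trans (ler_norm M))// (lt_trans Mt).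
- move=> i s; elim/last_ind: s => [|s j _] x.
    exact: (differentiable_comp1 (differentiable_coord _ _ _) (dG _)).
  rewrite foldr_rcons (_ : partial j _ = fun x => (j == i)%:R * g (x ord0 i)).
    by apply: smoothM; [exact: smooth_cst|exact: sg].
  apply/funext => y; rewrite mulrC -(partial_coord j i y).
  exact: (partial_comp1 _ (differentiable_coord _ _ _) (dG _)).
Qed.

Lemma Rintegral_bump_gt0 : 0 < \int[mu]_t bump (-1) 1 1 t.
Proof.
have tb : test_factor (bump (-1) 1 (1 : R)) by exact: test_factor_bump.
have ib := integrable_test_factor tb.
(* On [[-1/2, 1/2]] both factors of the bump are flat exponentials at points at least [1/2], hence
   at least [exp (-2)]. *)
pose e : R := expR (- 4).
have e0 : 0 < e by exact: expR_gt0.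
have be t : `|t| <= 2^-1 -> e <= bump (-1) 1 1 t.
  rewrite ler_norml => /andP[t1 t2].
  have B (s : R) : 2^-1 <= s -> expR (- 2) <= flat_exp 0 s.
    move=> s2; have s0 : 0 < s by lra.
    rewrite flat_exp0E s0 ler_expR lerN2 -[leRHS]invrK lef_pV2 ?posrE//.
  have -> : e = expR (- 2) * expR (- 2) by rewrite -expRD; congr expR; lra.
  by rewrite /bump ler_pM ?expR_ge0//; apply: B; lra.
suff H : (e%:E <= \int[mu]_t (bump (-1) 1 1 t)%:E)%E.
  by rewrite /Rintegral -lte_fin fineK ?integrable_fin_num// (lt_le_trans _ H)// lte_fin.
have mI : measurable (`[- 2^-1, 2^-1]%classic : set R) by [].
have m1 : mu `[- 2^-1, 2^-1] = 1%E.
  rewrite lebesgue_measure_itv/= lte_fin ifT; last by lra.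
  by rewrite -EFinB; congr EFin; lra.
have -> : e%:E = (\int[mu]_(t in `[(- 2^-1)%R, (2^-1)%R]) e%:E)%E.
  by rewrite integral_cst//= m1 mule1.
rewrite integral_mkcond; apply: ge0_le_integral => //.
- by move=> t _; rewrite patchE; case: ifP => // _; rewrite lee_fin ltW.
- by apply/(measurable_restrictT _ _).1 => //; exact: measurable_cst.
- exact: measurable_int ib.
- move=> t _; rewrite patchE; case: ifPn => [|_]; last by rewrite lee_fin bump_ge0.
  by rewrite inE/= in_itv/= -ler_norml lee_fin; exact: be.
Qed.

End one_dimensional_factors.

(** * Functions with zero weak gradient are constant *)

Section weakly_constant.
Context (R : realType) (n : nat).
Notation leb := (lebesgue_rV R n).
Notation mu := (@lebesgue_measure R).
Implicit Types (g : 'I_n -> R -> R) (x : 'rV[R]_n).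

Definition tensor g x : R := \prod_i g i (x ord0 i).

Lemma test_function_tensor g : (forall i, test_factor n (g i)) -> test_function (tensor g).
Proof.
move=> tg; apply/test_functionE; split.
  by apply: smooth_prod => i; case: (tg i).
have /choice[M MP] : forall i, exists M : R, forall t, g i t != 0 -> `|t| <= M.
  by move=> i; case: (tg i).
exists (\sum_i `|M i|) => x /prodf_neq0 H i.
rewrite (le_trans (MP i _ (H i isT)))// (le_trans (ler_norm _))//.
by rewrite (bigD1 i)//= lerDl sumr_ge0.
Qed.

Definition upd g i (u : R -> R) : 'I_n -> R -> R := fun j => if j == i then u else g j.

Lemma tensor_upd g i u x :
  tensor (upd g i u) x = u (x ord0 i) * \prod_(j | j != i) g j (x ord0 j).
Proof.
rewrite /tensor (bigD1 i)//= {1}/upd eqxx; congr (_ * _).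
by apply: eq_bigr => j ji; rewrite /upd (negbTE ji).
Qed.

Lemma updE g i : upd g i (g i) = g.
Proof. by apply/funext => j; rewrite /upd; case: eqP => // ->. Qed.

Lemma test_factor_upd g i u : (forall j, test_factor n (g j)) -> test_factor n u ->
  forall j, test_factor n (upd g i u j).
Proof. by move=> tg tu j; rewrite /upd; case: eqP. Qed.

Lemma partial_tensor_upd g i u u' x : (forall j, test_factor n (g j)) ->
  is_derive (x ord0 i) 1 u (u' (x ord0 i)) ->
  partial i (tensor (upd g i u)) x = tensor (upd g i u') x.
Proof.
move=> tg du; rewrite (_ : tensor (upd g i u) =
   fun x => (u \o (fun x : 'rV[R]_n => x ord0 i)) x * \prod_(j | j != i) g j (x ord0 j)); last first.
  by apply/funext => y; rewrite tensor_upd.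
have dc : differentiable (fun x : 'rV[R]_n => x ord0 i) x by exact: differentiable_coord.
have sp : smooth (fun x : 'rV[R]_n => \prod_(j | j != i) g j (x ord0 j)).
  by apply: smooth_prod => j; case: (tg j).
rewrite partialM; last 2 first.
- exact: (differentiable_comp1 dc du).
- exact: smooth_diff.
rewrite (partial_comp1 _ dc du) partial_coord eqxx mulr1.
rewrite [X in _ + _ * X](_ : _ = 0) ?mulr0 ?addr0 ?tensor_upd//.
rewrite /partial /derive; apply: cvg_lim => //.
apply: cvg_near_cst; near=> k.
rewrite /= (_ : \prod_(j | j != i) g j ((k *: delta_mx ord0 i + x) ord0 j) =
  \prod_(j | j != i) g j (x ord0 j)) ?subrr ?scaler0//.
apply: eq_bigr => j ji; congr g; rewrite !mxE/= (negbTE ji).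
by rewrite mulr0 add0r.
Unshelve. all: by end_near. Qed.

Definition eta : R -> R := fun t => (\int[mu]_t bump (-1) 1 1 t)^-1 * bump (-1) 1 1 t.

Lemma test_factor_eta : test_factor n eta.
Proof. by apply: test_factorZ; exact: test_factor_bump. Qed.

Lemma Rintegral_eta : \int[mu]_t eta t = 1.
Proof.
rewrite /eta RintegralZl//; last first.
  by apply: (@integrable_test_factor R n); exact: test_factor_bump.
by rewrite mulVf// gt_eqF// (@Rintegral_bump_gt0 R n).
Qed.

Variable h : 'rV[R]_n -> R.
Hypothesis lh : locally_integrable_rV h.
Hypothesis h_grad0 : forall i phi, test_function phi ->
  \int[leb]_x (h x * partial i phi x) = 0.

Let ih phi : test_function phi -> leb.-integrable setT (EFin \o (fun x => h x * phi x)).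
Proof.
by move=> tphi; apply: integrable_mul_bsupp => //; [exact: test_function_cont|exact: test_function_bsupp].
Qed.

Let mean (u : R -> R) : R := \int[mu]_t u t.

(** The difference of the two [i]-th factors has zero mean, hence a primitive that is again a test
    factor. So the difference of the two tensor products is [partial i] of a test function, which
    [h] annihilates. *)
Let replace g i : (forall j, test_factor n (g j)) ->
  \int[leb]_x (h x * tensor g x) =
  \int[leb]_x (h x * tensor (upd g i (fun t => mean (g i) * eta t)) x).
Proof.
move=> tg; have tme : test_factor n (fun t => mean (g i) * eta t).
  by apply: test_factorZ; exact: test_factor_eta.
have tu := test_factor_upd i tg tme.
apply/eqP; rewrite -subr_eq0 -RintegralB//; last 2 first.
- by apply: ih; exact: test_function_tensor.
- by apply: ih; exact: test_function_tensor.
have tN : test_factor n (fun t => g i t + (-1) * (mean (g i) * eta t)).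
  by apply: test_factorD => //; exact: test_factorZ.
have [|G tG dG] := test_factor_primitive tN.
  rewrite RintegralD//; last 2 first.
  - exact: integrable_test_factor.
  - by apply: (@integrable_test_factor R n); exact: test_factorZ.
  rewrite RintegralZl//; last exact: (@integrable_test_factor R n).
  rewrite RintegralZl//; last by apply: (@integrable_test_factor R n); exact: test_factor_eta.
  by rewrite Rintegral_eta mulr1 mulN1r subrr.
rewrite -[X in _ == X](h_grad0 i (test_function_tensor (test_factor_upd i tg tG))).
apply/eqP; apply: eq_Rintegral => x _.
rewrite (@partial_tensor_upd g i G (fun t => g i t + (-1) * (mean (g i) * eta t)) x tg (dG _)).
by rewrite -{1}(updE g i) !tensor_upd; ring.
Qed.

(** Only the first [k] factors are replaced, so that the replacements can be made one coordinate at
    a time. *)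
Let replaced g (k : nat) : 'I_n -> R -> R :=
  fun j => if (j < k)%N then (fun t => mean (g j) * eta t) else g j.

Let test_replaced g k : (forall j, test_factor n (g j)) ->
  forall j, test_factor n (replaced g k j).
Proof.
move=> tg j; rewrite /replaced; case: ifP => // _.
by apply: test_factorZ; exact: test_factor_eta.
Qed.

Let replace_all g k : (forall j, test_factor n (g j)) -> (k <= n)%N ->
  \int[leb]_x (h x * tensor g x) = \int[leb]_x (h x * tensor (replaced g k) x).
Proof.
move=> tg; elim: k => [//|k IH] kn; rewrite IH ?(ltnW kn)//.
rewrite (replace (Ordinal kn)); last exact: test_replaced.
congr (Rintegral _ _ _); apply/funext => x; congr (_ * tensor _ x).
apply/funext => j; rewrite /upd /replaced /=; case: eqP => [->|/eqP jk].
  by rewrite ltnn ltnSn.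
rewrite ltnS [(j <= k)%N]leq_eqVlt (_ : (nat_of_ord j == k) = false)//.
exact: negbTE jk.
Qed.

Let kappa := \int[leb]_x (h x * tensor (fun=> eta) x).

Let Rintegral_tensor g : (forall j, test_factor n (g j)) ->
  \int[leb]_x (h x * tensor g x) = \prod_i mean (g i) * kappa.
Proof.
move=> tg; rewrite (replace_all tg (leqnn n)) /kappa -RintegralZl//; last first.
  by apply: ih; apply: test_function_tensor => i; exact: test_factor_eta.
apply: eq_Rintegral => x _; rewrite mulrCA; congr (_ * _).
by rewrite /tensor -big_split; apply: eq_bigr => i _; rewrite /replaced ltn_ord.
Qed.

(** After all factors are replaced by multiples of [eta], the pairing of [h] with a tensor product
    is [kappa] times the product of the means, that is, the pairing of the constant [kappa] with it.
    Products of bumps are tensor products, and they are enough to conclude. *)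
Lemma weak_gradient0_constant : exists c, {ae leb, forall x, h x = c}.
Proof.
exists kappa; have lk : locally_integrable_rV (fun _ : 'rV[R]_n => kappa).
  by apply: locally_integrable_continuous; apply: smooth_continuous; exact: smooth_cst.
have : ae_eq leb setT (EFin \o (fun x => h x - kappa)) (cst 0%E).
  apply: ae0_prod_bump; first exact: locally_integrableB.
  move=> a b k; have k0 := ltr0Sn R k.
  have tb i : test_factor n (bump (a i) (b i) k.+1%:R) by exact: test_factor_bump.
  have tt := test_function_tensor tb.
  have ik : leb.-integrable setT (EFin \o tensor (fun i => bump (a i) (b i) k.+1%:R)).
    by apply: continuous_bsupp_integrable; [exact: test_function_cont|exact: test_function_bsupp].
  under eq_Rintegral do rewrite mulrBl.
  rewrite RintegralB//; last 2 first.
  - exact: ih.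
  - by apply: integrable_mul_bsupp => //; [exact: test_function_cont|exact: test_function_bsupp].
  rewrite (Rintegral_tensor tb) RintegralZl// mulrC; apply/eqP; rewrite subr_eq0; apply/eqP.
  congr (_ * _); rewrite /Rintegral (@integral_prod_coord R n (fun i => bump (a i) (b i) k.+1%:R))//; last 2 first.
  - by move=> i; apply: continuous_measurable_fun; case: (tb i).
  - by move=> i t; exact: bump_ge0.
  rewrite (eq_bigr (fun i => (mean (bump (a i) (b i) k.+1%:R))%:E)) => [|i _].
    by rewrite -(big_morph EFin (@EFinM R) (erefl 1%:E)).
  by rewrite /mean /Rintegral fineK// integrable_fin_num//; exact: (@integrable_test_factor R n).
apply: filterS => x /(_ I) /= [/eqP]; by rewrite subr_eq0 => /eqP.
Qed.

End weakly_constant.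

(** * The Cauchy measure and the integrated Bochner identity *)

Section cauchy_density.
Context (R : realType) (n : nat) (beta : R).
Hypothesis nbeta : n%:R <= beta.
Notation leb := (lebesgue_rV R n).
Notation w := (fun x : 'rV[R]_n => omega x `^ (- beta)).
Notation mu := (cauchy_measure n beta).

Lemma omega_powR_gt0 (s : R) (x : 'rV[R]_n) : 0 < omega x `^ s.
Proof. by rewrite powR_gt0// omega_gt0. Qed.

Lemma measurable_omega_powR (s : R) : measurable_fun setT (fun x : 'rV[R]_n => omega x `^ s).
Proof.
by apply: continuous_measurable_rV; apply: smooth_continuous; exact: smooth_omega_powR.
Qed.

Let Z : \bar R := omega_measure beta (setT : set 'rV[R]_n).

Lemma integral_oneDsqrV_lty :
  (\int[@lebesgue_measure R]_t ((1 + t ^+ 2)^-1)%:E < +oo)%E.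
Proof.
have -> : (fun t : R => ((1 + t ^+ 2)^-1)%:E) = (fun t => ((oneDsqr t)^-1)%:E) by [].
rewrite (@ge0_symfun_integralT R (fun t => (oneDsqr t)^-1)).
- rewrite lte_mul_pinfty//; have := @integral0y_oneDsqr R.
  by rewrite -set_itvcy => ->; rewrite ltry.
- by move=> t; rewrite invr_ge0.
- by move=> t; exact: continuous_oneDsqrV.
- by move=> t /=; rewrite /oneDsqr sqrrN.
Qed.

Let measurable_oneDsqrV : measurable_fun setT (fun t : R => (1 + t ^+ 2)^-1).
Proof. by apply: continuous_measurable_fun => t; exact: continuous_oneDsqrV. Qed.

(** Since [omega >= 1], the exponent can be lowered to [n], and each of the [n] copies of [omega] is
    at least one factor [1 + x_i^2]. The bound is a product of integrable functions of one variable,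
    so the mass is finite. *)
Let w_le (x : 'rV[R]_n) : w x <= \prod_i (1 + x ord0 i ^+ 2)^-1.
Proof.
have w1 := omega_ge1 x; have w0 := omega_gt0 x.
have : w x <= omega x `^ (- n%:R) by rewrite ler_powR// lerN2.
move=> /le_trans; apply; rewrite powRN powR_mulrn ?(ltW w0)// prodfV.
have p0 : 0 < \prod_i (1 + x ord0 i ^+ 2).
  by apply: prodr_gt0 => i _; rewrite ltr_wpDr// sqr_ge0.
rewrite lef_pV2 ?posrE ?exprn_gt0//.
have -> : omega x ^+ n = \prod_(i < n) omega x by rewrite prodr_const card_ord.
apply: ler_prod => i _; rewrite addr_ge0 ?sqr_ge0//= lerD2l /sqnorm.
by rewrite (bigD1 i)//= lerDl sumr_ge0// => j _; exact: sqr_ge0.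
Qed.

Let Z_lty : (Z < +oo)%E.
Proof.
rewrite /Z /omega_measure.
apply: (@le_lt_trans _ _ (\int[leb]_x (\prod_i (1 + x ord0 i ^+ 2)^-1)%:E)%E).
  apply: ge0_le_integral => //.
  - by move=> x _; rewrite lee_fin ltW// omega_powR_gt0.
  - by apply/measurable_EFinP; exact: measurable_omega_powR.
  - apply/measurable_EFinP; apply: measurable_prod => i _.
    exact: (measurableT_comp measurable_oneDsqrV (@measurable_coord _ _ i)).
  - by move=> x _; rewrite lee_fin; exact: w_le.
rewrite (@integral_prod_coord R n (fun _ t => (1 + t ^+ 2)^-1)).
- rewrite ltey_eq; apply/orP; left.
  apply: (big_ind (fun x : \bar R => x \is a fin_num)) => // [a b|i _]; first exact: fin_numM.
  rewrite ge0_fin_numE ?integral_oneDsqrV_lty//.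
  by apply: integral_ge0 => t _; rewrite lee_fin invr_ge0 addr_ge0// sqr_ge0.
- by move=> i; exact: measurable_oneDsqrV.
- by move=> i t; rewrite invr_ge0 addr_ge0// sqr_ge0.
Qed.

Let Z_gt0 : (0 < Z)%E.
Proof.
rewrite lt0e measure_ge0 andbT; apply/eqP => Z0.
have : (\int[leb]_x `|(w x)%:E| = 0)%E.
  by rewrite -[RHS]Z0 /Z /omega_measure; apply: eq_integral => x _;
    rewrite gee0_abs// lee_fin ltW// omega_powR_gt0.
move=> /ae_eq_integral_abs [//||N [mN N0 NP]].
  by apply/measurable_EFinP; exact: measurable_omega_powR.
(* A zero mass would make the positive weight vanish almost everywhere, hence make null the unit
   cube, whose measure is 1. *)
pose U := [set x : 'rV[R]_n | forall i : 'I_n, `[0, 1]%classic (x ord0 i)].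
have : (leb U <= leb N)%E.
  apply: le_measure; rewrite ?inE//.
    rewrite (_ : U = \bigcap_(i in [set: 'I_n])
        ((fun x : 'rV[R]_n => x ord0 i) @^-1` `[0, 1])).
      apply: fin_bigcap_measurable => // i _.
      by rewrite -[X in measurable X]setTI; exact: measurable_coord.
    by apply/seteqP; split=> [x Ax i _|x Ax i]; [exact: Ax|exact: (Ax i I)].
  move=> x _; apply: NP => /= /(_ I) /eqP; apply/negP.
  by rewrite eqe gt_eqF// omega_powR_gt0.
rewrite N0 (@lebesgue_rV_box R n (fun=> `[0, 1]%classic)) ?big1//.
  by rewrite lee_fin ler10.
by move=> i _; rewrite lebesgue_measure_itv/= lte_fin ltr01 oppr0 adde0.
Qed.

Definition cauchy_Z : R := fine (omega_measure beta (setT : set 'rV[R]_n)).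

Lemma cauchy_Z_gt0 : 0 < cauchy_Z.
Proof. by rewrite fine_gt0// Z_gt0 Z_lty. Qed.

Lemma cauchy_measureE A : mu A = (omega_measure beta A * (cauchy_Z^-1)%:E)%E.
Proof.
rewrite /cauchy_measure/= /mnormalize ifF//; apply/negP => /orP[] /eqP.
  by move=> Z0; have := Z_gt0; rewrite /Z Z0 ltxx.
by move=> Z0; have := Z_lty; rewrite /Z Z0 ltxx.
Qed.

Definition cauchy_density (x : 'rV[R]_n) : R := cauchy_Z^-1 * w x.

Lemma cauchy_density_gt0 x : 0 < cauchy_density x.
Proof. by rewrite mulr_gt0 ?invr_gt0 ?cauchy_Z_gt0 ?omega_powR_gt0. Qed.

Lemma measurable_cauchy_density : measurable_fun setT cauchy_density.
Proof. by apply: measurable_funM => //; exact: measurable_omega_powR. Qed.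

Let mu_density A : measurable A -> mu A = (\int[leb]_(x in A) (cauchy_density x)%:E)%E.
Proof.
move=> mA; rewrite cauchy_measureE /omega_measure muleC.
rewrite -ge0_integralZl//.
- by apply/measurable_EFinP; apply: measurable_funTS; exact: measurable_omega_powR.
- by move=> x _; rewrite lee_fin ltW// omega_powR_gt0.
- by rewrite lee_fin invr_ge0 ltW// cauchy_Z_gt0.
Qed.

Import Radon_Nikodym_SigmaFinite.

Let mu_dom : mu `<< leb.
Proof.
apply/null_content_dominatesP => A mA A0; apply: (eq_trans (mu_density mA)).
by apply: null_set_integral => //; apply/measurable_EFinP; apply: measurable_funTS; exact: measurable_cauchy_density.
Qed.

(** Integrals against [mu] are carried to Lebesgue measure by the Radon-Nikodym derivative,
    identified here with the explicit density. *)
Let RN_ae : ae_eq leb setT (f mu leb) (EFin \o cauchy_density).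
Proof.
apply: integral_ae_eq => //.
- exact: f_integrable.
- by apply/measurable_EFinP; exact: measurable_cauchy_density.
- by move=> A _ mA; rewrite -f_integral//; exact: mu_density.
Qed.

Lemma ge0_integral_cauchy (g : 'rV[R]_n -> \bar R) : measurable_fun setT g ->
  (forall x, 0 <= g x)%E ->
  (\int[mu]_x g x = \int[leb]_x (g x * (cauchy_density x)%:E))%E.
Proof.
move=> mg g0; rewrite -(change_of_variables mu_dom)//.
apply: ae_eq_integral => //.
- by apply: emeasurable_funM => //; exact: measurable_int (f_integrable mu_dom).
- by apply: emeasurable_funM => //; apply/measurable_EFinP; exact: measurable_cauchy_density.
- by apply: filterS RN_ae => x H _; rewrite H.
Qed.

Lemma integrable_cauchy (g : 'rV[R]_n -> R) : measurable_fun setT g ->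
  mu.-integrable setT (EFin \o g) <->
  leb.-integrable setT (EFin \o (fun x => g x * cauchy_density x)).
Proof.
move=> mg.
have mgd : measurable_fun setT (fun x => g x * cauchy_density x).
  by apply: measurable_funM => //; exact: measurable_cauchy_density.
have E : (\int[mu]_x `|(EFin \o g) x| =
    \int[leb]_x `|(EFin \o (fun x => (g x * cauchy_density x)%R)) x|)%E.
  rewrite ge0_integral_cauchy//; last by apply: measurableT_comp => //; exact/measurable_EFinP.
  apply: eq_integral => x _ /=; rewrite -EFinM; congr EFin.
  by rewrite normrM (ger0_norm (ltW (cauchy_density_gt0 _))).
by split=> /integrableP[_ H]; apply/integrableP; (split; first exact/measurable_EFinP);
  [rewrite -E|rewrite E].
Qed.

Lemma Rintegral_cauchy (g : 'rV[R]_n -> R) : mu.-integrable setT (EFin \o g) ->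
  \int[mu]_x g x = \int[leb]_x (g x * cauchy_density x).
Proof.
move=> ig; have /measurable_EFinP mg := measurable_int _ ig.
have d0 x := ltW (cauchy_density_gt0 x).
rewrite /Rintegral; congr fine; rewrite [LHS]integralE [RHS]integralE; congr (_ - _)%E.
- rewrite ge0_integral_cauchy//; last exact/measurable_funepos/measurable_EFinP.
  apply: eq_integral => x _; rewrite !funeposE /= -EFin_max -EFinM -EFin_max; congr EFin.
  by rewrite maxr_pMl// mul0r.
- rewrite ge0_integral_cauchy//; last exact/measurable_funeneg/measurable_EFinP.
  apply: eq_integral => x _; rewrite !funenegE /= -EFin_max -EFinM -EFin_max; congr EFin.
  by rewrite maxr_pMl// mul0r mulNr.
Qed.

End cauchy_density.

Opaque partial.

Section sum_lemmas.
Context (R : realType).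

(** The algebra of the Bochner identity, isolated from the calculus. With [f_i] and [f_ij] the
    derivatives, the letters stand for [a i = f_i^2], [b i = (sum_j x_j f_ji) f_i],
    [d i = x_i sum_j f_j f_ij], [e i = x_i f_i], [k i = sum_j f_ij^2], [h i = f_ii], and [t i] for
    the terms of third order; [Rr] is the radial derivative and [Lap] the Laplacian. *)
Lemma sum_divergence_terms (I : Type) (r : seq I) (w al ga c Rr Lap : R)
    (a b d e k t h : I -> R) :
  \sum_(i <- r) (w * al * (a i + b i + Rr * h i) +
    ga * (2 * w * (d i - e i * Lap) + w ^+ 2 * (k i + t i - h i * Lap))
    - 2 * c * al * Rr * e i - 2 * c * ga * w * (d i - e i * Lap)) =
  w * al * (\sum_(i <- r) a i + \sum_(i <- r) b i + Rr * \sum_(i <- r) h i) +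
    ga * (2 * w * (\sum_(i <- r) d i - (\sum_(i <- r) e i) * Lap) +
      w ^+ 2 * (\sum_(i <- r) k i + \sum_(i <- r) t i - (\sum_(i <- r) h i) * Lap))
    - 2 * c * al * Rr * (\sum_(i <- r) e i)
    - 2 * c * ga * w * (\sum_(i <- r) d i - (\sum_(i <- r) e i) * Lap).
Proof. by elim: r => [|i r IH]; rewrite ?big_nil ?big_cons ?IH; ring. Qed.

Lemma divergence_term (w c d x fi s1 s2 s3 s4 r h L pL : R) :
  w * (- 2 * c * ((fi + s1) * fi + r * h) +
    - d * (2 * x * (s2 - fi * L) + w * (s3 + s4 - (h * L + fi * pL)))) -
  2 * c * (x * (- 2 * c * (r * fi) + - d * (w * (s2 - fi * L)))) =
  w * (- 2 * c) * (fi ^+ 2 + s1 * fi + r * h) +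
    - d * (2 * w * (x * s2 - x * fi * L) + w ^+ 2 * (s3 + (s4 - fi * pL) - h * L))
    - 2 * c * (- 2 * c) * r * (x * fi) - 2 * c * - d * w * (x * s2 - x * fi * L).
Proof. ring. Qed.

(** The sums [sb] and [sd] are the same cross term [X], whose total coefficient is
    [w (-2c + 2(c-1) c/(c-1)) = 0]. The 0 added to [sk] is the sum of the terms of third order. *)
Lemma divergence_total (w c L r G X K sa sb sh sd se sk Lf S T : R) :
  c - 1 != 0 -> sa = G -> sb = X -> sh = L -> sd = X -> se = r -> sk = K ->
  Lf = w * L - 2 * c * r -> S = w ^+ 2 * K -> T = w * L ->
  w * (- 2 * c) * (sa + sb + r * sh) +
    - (c / (c - 1)) * (2 * w * (sd - se * L) + w ^+ 2 * (sk + 0 - sh * L))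
    - 2 * c * (- 2 * c) * r * se - 2 * c * - (c / (c - 1)) * w * (sd - se * L) =
  Lf ^+ 2 - 2 * c * (w * G) - (c / (c - 1) * S - (c - 1)^-1 * T ^+ 2).
Proof. by move=> c1 -> -> -> -> -> -> -> -> ->; field. Qed.

End sum_lemmas.

Section bochner.
Context (R : realType) (n : nat) (beta : R).
Hypothesis nbeta : n%:R <= beta.
Notation leb := (lebesgue_rV R n).
Notation mu := (cauchy_measure n beta).
Notation c := (beta - 1).
Implicit Types (f g phi : 'rV[R]_n -> R) (i j : 'I_n) (x : 'rV[R]_n).

Lemma test_functionD f g : test_function f -> test_function g -> test_function (fun x => f x + g x).
Proof.
move=> /test_functionE[sf bf] /test_functionE[sg bg]; apply/test_functionE.
by split; [exact: smoothD|exact: bsuppD].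
Qed.

Lemma test_functionM f g : test_function f -> smooth g -> test_function (fun x => f x * g x).
Proof.
move=> /test_functionE[sf bf] sg; apply/test_functionE.
by split; [exact: smoothM|exact: bsuppM].
Qed.

Lemma test_functionMl f g : smooth f -> test_function g -> test_function (fun x => f x * g x).
Proof.
move=> sf /test_functionE[sg bg]; apply/test_functionE.
by split; [exact: smoothM|exact: bsuppMr].
Qed.

Lemma test_functionZ (a : R) f : test_function f -> test_function (fun x => a * f x).
Proof. by move=> tf; apply: test_functionMl => //; exact: smooth_cst. Qed.

Lemma test_functionN f : test_function f -> test_function (fun x => - f x).
Proof.
move=> tf; rewrite (_ : (fun x => _) = fun x => -1 * f x); first exact: test_functionZ.
by apply/funext => x; rewrite mulN1r.
Qed.

Lemma test_functionB f g : test_function f -> test_function g -> test_function (fun x => f x - g x).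
Proof. by move=> tf tg; apply: test_functionD => //; exact: test_functionN. Qed.

Lemma test_function0 : test_function (fun _ : 'rV[R]_n => 0).
Proof.
apply/test_functionE; split; first exact: smooth_cst.
by exists 0 => x; rewrite eqxx.
Qed.

Lemma test_function_sum (I : Type) (r : seq I) (F : I -> 'rV[R]_n -> R) :
  (forall k, test_function (F k)) -> test_function (fun x => \sum_(k <- r) F k x).
Proof.
move=> tF; elim: r => [|k r IH].
  by under eq_fun do rewrite big_nil; exact: test_function0.
by under eq_fun do rewrite big_cons; exact: test_functionD.
Qed.

Lemma test_function_partial i f : test_function f -> test_function (partial i f).
Proof.
move=> /test_functionE[sf bf]; apply/test_functionE.
by split; [exact: smooth_partial|exact: bsupp_partial].
Qed.

Lemma test_smooth f : test_function f -> smooth f. Proof. by case. Qed.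

Lemma test_laplacian f : test_function f -> test_function (laplacian f).
Proof. by move=> tf; apply: test_function_sum => i; do 2 apply: test_function_partial. Qed.

Lemma test_radial f : test_function f -> test_function (radial f).
Proof.
move=> tf; apply: test_function_sum => i.
by apply: test_functionMl; [exact: smooth_coord|exact: test_function_partial].
Qed.

Lemma test_cauchyL f : test_function f -> test_function (cauchyL beta f).
Proof.
move=> tf; apply: test_functionB.
  by apply: test_functionMl; [exact: smooth_omega|exact: test_laplacian].
by apply: test_functionZ; exact: test_radial.
Qed.

Lemma test_integrable_mu phi : test_function phi -> mu.-integrable setT (EFin \o phi).
Proof.
move=> tphi; apply/integrable_cauchy => //.
  by apply: continuous_measurable_rV; exact: test_function_cont.
have td : test_function (fun x => phi x * cauchy_density beta x).
  apply: test_functionM => //; apply: smoothM; first exact: smooth_cst.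
  exact: smooth_omega_powR.
by apply: continuous_bsupp_integrable; [exact: test_function_cont|exact: test_function_bsupp].
Qed.

Lemma Rintegral_partial i V : test_function V -> \int[leb]_x partial i V x = 0.
Proof.
move=> tV; have /test_functionE[sV bV] := tV.
rewrite /Rintegral integral_partial//; first exact: smooth_continuous.
  by move=> x; exact: smooth_derivable.
by apply: smooth_continuous; exact: smooth_partial.
Qed.

Definition wdiv i V x := omega x * partial i V x - 2 * c * (x ord0 i * V x).

Lemma test_wdiv i V : test_function V -> test_function (wdiv i V).
Proof.
move=> tV; apply: test_functionB.
  by apply: test_functionMl; [exact: smooth_omega|exact: test_function_partial].
by apply: test_functionZ; apply: test_functionMl => //; exact: smooth_coord.
Qed.

(* [wdiv i V] is the derivative of [omega `^ (1 - beta) * V] divided by the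
   density [omega `^ - beta]. *)
Lemma Rintegral_wdiv i V : test_function V -> \int[mu]_x wdiv i V x = 0.
Proof.
move=> tV; rewrite Rintegral_cauchy//; last by apply: test_integrable_mu; exact: test_wdiv.
pose Y x := (cauchy_Z n beta)^-1 * omega x `^ (1 - beta) * V x.
have sw : smooth (fun x : 'rV[R]_n => (cauchy_Z n beta)^-1 * omega x `^ (1 - beta)).
  by apply: smoothM; [exact: smooth_cst|exact: smooth_omega_powR].
have tY : test_function Y by apply: test_functionMl.
rewrite -[RHS](Rintegral_partial i tY); apply: eq_Rintegral => x _.
rewrite /Y partialM; last 2 first.
- exact: smooth_diff.
- by apply: smooth_diff; exact: test_smooth.
rewrite partialZ; last exact: differentiable_omega_powR.
rewrite partial_omega_powR /cauchy_density /wdiv.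
have -> : 1 - beta - 1 = - beta by ring.
have -> : omega x `^ (1 - beta) = omega x * omega x `^ (- beta).
  rewrite powRD; last by rewrite (gt_eqF (omega_gt0 x)) implybT.
  by rewrite powRr1// ltW// omega_gt0.
rewrite /=. ring.
Qed.

Lemma Rintegral_sum_wdiv (V : 'I_n -> 'rV[R]_n -> R) : (forall i, test_function (V i)) ->
  \int[mu]_x (\sum_i wdiv i (V i) x) = 0.
Proof.
move=> tV; elim: (index_enum _) => [|i r IH].
  by under eq_Rintegral do rewrite big_nil; rewrite Rintegral_cst//= mul0r.
under eq_Rintegral do rewrite big_cons.
rewrite RintegralD//; first by rewrite IH Rintegral_wdiv// addr0.
  by apply: test_integrable_mu; exact: test_wdiv.
by apply: test_integrable_mu; apply: test_function_sum => k; exact: test_wdiv.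
Qed.

Definition grad_dot f g x := \sum_i partial i f x * partial i g x.

Lemma test_grad_dot f g : test_function f -> smooth g -> test_function (grad_dot f g).
Proof.
move=> tf sg; apply: test_function_sum => i.
by apply: test_functionM; [exact: test_function_partial|exact: smooth_partial].
Qed.

(** The sum of the two integrands is the weighted divergence of the field [g partial i f]. *)
Lemma Rintegral_cauchyL f g : test_function f -> smooth g ->
  \int[mu]_x (g x * cauchyL beta f x) = - \int[mu]_x (omega x * grad_dot f g x).
Proof.
move=> tf sg; apply/eqP; rewrite -addr_eq0 -RintegralD//; last 2 first.
- by apply: test_integrable_mu; apply: test_functionMl => //; exact: test_cauchyL.
- by apply: test_integrable_mu; apply: test_functionMl; [exact: smooth_omega|exact: test_grad_dot].
have tV i : test_function (fun x => g x * partial i f x).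
  by apply: test_functionMl => //; exact: test_function_partial.
rewrite -[X in _ == X](Rintegral_sum_wdiv tV); apply/eqP; apply: eq_Rintegral => x _.
rewrite /cauchyL /laplacian /radial /grad_dot /wdiv.
rewrite mulrBr !mulr_sumr -sumrB -big_split; apply: eq_bigr => i _ /=.
rewrite partialM; last 2 first.
- exact: smooth_diff.
- by apply: smooth_diff; apply: smooth_partial; exact: test_smooth.
ring.
Qed.

Definition whess f i j x := omega x * partial j (partial i f) x.

Lemma test_whess f i j : test_function f -> test_function (whess f i j).
Proof.
move=> tf; apply: test_functionMl; first exact: smooth_omega.
by do 2 apply: test_function_partial.
Qed.

Definition hess_form f x := c / (c - 1) * (\sum_i \sum_j whess f i j x ^+ 2) -
  (c - 1)^-1 * (\sum_i whess f i i x) ^+ 2.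

(** The field combines [radial f * partial i f] and [omega (Hess f . grad f - Laplacian f . grad
    f)_i]. The coefficient [- 2 c] of the first is forced by the terms of [(L f)^2] that contain the
    radial derivative; that of the second, [- c / (c - 1)], is then the one that eliminates the
    cross term between position, Hessian and gradient. *)
Let bochner_pointwise f x : c - 1 != 0 -> test_function f ->
  \sum_i wdiv i (fun x => - 2 * c * (radial f x * partial i f x) +
    - (c / (c - 1)) * (omega x * (\sum_j partial j f x * partial j (partial i f) x -
        partial i f x * laplacian f x))) x =
  cauchyL beta f x ^+ 2 - 2 * c * (omega x * grad_dot f f x) - hess_form f x.
Proof.
move=> c1 tf; have sf := test_smooth tf.
have d1 i : smooth (partial i f) by exact: smooth_partial.
have d2 i j : smooth (partial j (partial i f)) by exact: smooth_partial.
have dL : smooth (laplacian f) by exact/test_smooth/test_laplacian.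
have dR : smooth (radial f) by exact/test_smooth/test_radial.
have dS i : smooth (fun x => \sum_j partial j f x * partial j (partial i f) x).
  by apply: smooth_sum => j; exact: smoothM.
have dC i : smooth (fun x : 'rV[R]_n => x ord0 i) by exact: smooth_coord.
pose H i j := partial j (partial i f) x.
have HC i j : H i j = H j i by rewrite /H partialC.
(* The third derivatives enter only through [t], whose sum over [i] vanishes once derivatives are
   permuted: this is why Hessian and Laplacian are subtracted in the field. *)
pose t i := \sum_j partial j f x * partial i (partial j (partial i f)) x -
  partial i f x * partial i (laplacian f) x.
have t0 : \sum_i t i = 0.
  rewrite /t sumrB exchange_big /=; apply/eqP; rewrite subr_eq0; apply/eqP.
  apply: eq_bigr => j _; rewrite -mulr_sumr; congr (_ * _).
  apply: esym; apply: etrans (partial_sum j (index_enum 'I_n) x _) _.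
    by move=> i; exact: (d2 i i).
  by apply: eq_bigr => i _; exact: (esym (partialC i j x (d1 i))).
pose al : R := - 2 * c; pose ga : R := - (c / (c - 1)).
transitivity (\sum_i (omega x * al * (partial i f x ^+ 2 +
      (\sum_j x ord0 j * H j i) * partial i f x + radial f x * H i i) +
    ga * (2 * omega x * (x ord0 i * (\sum_j partial j f x * partial j (partial i f) x)
        - x ord0 i * partial i f x * laplacian f x) +
      omega x ^+ 2 * (\sum_j H i j ^+ 2 + t i - H i i * laplacian f x))
    - 2 * c * al * radial f x * (x ord0 i * partial i f x)
    - 2 * c * ga * omega x * (x ord0 i * (\sum_j partial j f x * partial j (partial i f) x) -
      x ord0 i * partial i f x * laplacian f x))).
  apply: eq_bigr => i _; rewrite /wdiv.
  rewrite partialD; last 2 first.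
  - by apply: smooth_diff; apply: smoothM; [exact: smooth_cst|exact: smoothM].
  - apply: smooth_diff; apply: smoothM; [exact: smooth_cst|apply: smoothM; first exact: smooth_omega].
    by apply: smoothB => //; exact: smoothM.
  rewrite partialZ; last by apply: smooth_diff; exact: smoothM.
  rewrite partialM; [|exact: smooth_diff|exact: smooth_diff].
  rewrite partialZ; last first.
    by apply: smooth_diff; apply: smoothM; [exact: smooth_omega|apply: smoothB => //; exact: smoothM].
  rewrite partialM; [|exact: (smooth_diff (@smooth_omega R n))|
    by apply: smooth_diff; apply: smoothB => //; exact: smoothM].
  rewrite partial_omega.
  rewrite partialB; [|exact: smooth_diff|by apply: smooth_diff; exact: smoothM].
  rewrite partialM; [|exact: smooth_diff|exact: smooth_diff].
  have -> : partial i (radial f) x = partial i f x + \sum_j x ord0 j * H j i.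
    rewrite /radial partial_sum; last by move=> k; exact: smoothM.
    rewrite (eq_bigr (fun j => (i == j)%:R * partial j f x + x ord0 j * H j i)) => [|j _].
      rewrite big_split /= (bigD1 i)//= eqxx mul1r big1 ?addr0// => j ji.
      by rewrite eq_sym (negbTE ji) mul0r.
    by rewrite partialM ?partial_coord//; exact: smooth_diff.
  have -> : partial i (fun x => \sum_j partial j f x * partial j (partial i f) x) x =
      \sum_j H i j ^+ 2 + \sum_j partial j f x * partial i (partial j (partial i f)) x.
    rewrite partial_sum; last by move=> k; exact: smoothM.
    rewrite -big_split; apply: eq_bigr => j _ /=.
    rewrite partialM; [|exact: smooth_diff|exact: smooth_diff].
    by rewrite -[partial i (partial j f) x]/(H j i) -/(H i j) (HC j i) expr2.
  rewrite -[partial i (partial i f) x]/(H i i) /t.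
  rewrite /al /ga; exact: divergence_term.
rewrite sum_divergence_terms t0.
have eL : \sum_i H i i = laplacian f x by [].
have eR : \sum_i x ord0 i * partial i f x = radial f x by [].
have eG : \sum_i partial i f x ^+ 2 = grad_dot f f x by apply: eq_bigr => i _; rewrite expr2.
pose X := \sum_i (\sum_j x ord0 j * H j i) * partial i f x.
have eX : \sum_i x ord0 i * (\sum_j partial j f x * partial j (partial i f) x) = X.
  rewrite /X; under eq_bigr do rewrite mulr_sumr.
  rewrite exchange_big; apply: eq_bigr => j _ /=; rewrite mulr_suml.
  by apply: eq_bigr => i _; rewrite [partial j f x * _]mulrC mulrA.
have eH : \sum_i \sum_j whess f i j x ^+ 2 = omega x ^+ 2 * \sum_i \sum_j H i j ^+ 2.
  rewrite mulr_sumr; apply: eq_bigr => i _; rewrite mulr_sumr.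
  by apply: eq_bigr => j _; rewrite /whess exprMn.
have eT : \sum_i whess f i i x = omega x * laplacian f x by rewrite /laplacian mulr_sumr.
rewrite /al /ga /hess_form.
have Q := (divergence_total c1 eG (erefl X) eL eX eR erefl (erefl (cauchyL beta f x)) eH eT).
exact: Q.
Qed.

Lemma test_hess_form f : test_function f -> test_function (hess_form f).
Proof.
move=> tf; apply: test_functionB; apply: test_functionZ.
  apply: test_function_sum => i; apply: test_function_sum => j.
  rewrite (_ : (fun x => _) = fun x => whess f i j x * whess f i j x).
    by apply: test_functionM; [exact: test_whess|exact/test_smooth/test_whess].
  by apply/funext => x; rewrite expr2.
rewrite (_ : (fun x => _) = fun x => (\sum_i whess f i i x) * (\sum_i whess f i i x)).
  have tS : test_function (fun x => \sum_i whess f i i x).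
    by apply: test_function_sum => i; exact: test_whess.
  by apply: test_functionM => //; exact: test_smooth.
by apply/funext => x; rewrite expr2.
Qed.

Theorem bochner_identity f : c - 1 != 0 -> test_function f ->
  \int[mu]_x (cauchyL beta f x * cauchyL beta f x) +
    2 * c * \int[mu]_x (f x * cauchyL beta f x) = \int[mu]_x hess_form f x.
Proof.
move=> c1 tf; have sf := test_smooth tf.
have tL := test_cauchyL tf; have sL := test_smooth tL.
have tG : test_function (fun x => omega x * grad_dot f f x).
  by apply: test_functionMl; [exact: smooth_omega|exact: test_grad_dot].
rewrite (Rintegral_cauchyL tf sf) mulrN -RintegralZl//; last exact: test_integrable_mu.
apply/eqP; rewrite -subr_eq0 -RintegralB//; last 2 first.
- by apply: test_integrable_mu; exact: test_functionM.
- by apply: test_integrable_mu; exact: test_functionZ.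
rewrite -RintegralB//; last 2 first.
- by apply: test_integrable_mu; apply: test_functionB; [exact: test_functionM|exact: test_functionZ].
- by apply: test_integrable_mu; exact: test_hess_form.
rewrite -[X in _ == X](@Rintegral_sum_wdiv (fun i x => - 2 * c * (radial f x * partial i f x) +
    - (c / (c - 1)) * (omega x * (\sum_j partial j f x * partial j (partial i f) x -
        partial i f x * laplacian f x)))).
  by apply/eqP; apply: eq_Rintegral => x _; rewrite bochner_pointwise// expr2.
move=> i; apply: test_functionD; apply: test_functionZ.
  by apply: test_functionM; [exact: test_radial|exact: smooth_partial].
apply: test_functionMl; first exact: smooth_omega.
apply: test_functionB.
  apply: test_function_sum => j; apply: test_functionM; first exact: test_function_partial.
  by do 2 apply: smooth_partial.
by apply: test_functionM; [exact: test_function_partial|exact/test_smooth/test_laplacian].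
Qed.

End bochner.

(** * Strongly continuous semigroups on a semi-inner product space *)

(** Definiteness is absent on purpose: in the application a function that vanishes almost everywhere
    is orthogonal to everything without being 0. *)
Record semi_inner (R : realType) (E : lmodType R) (ip : E -> E -> R) : Prop :=
  SemiInner {
  ipC : forall f g, ip f g = ip g f;
  ipPl : forall a f g h, ip (a *: f + g) h = a * ip f h + ip g h;
  ip_ge0 : forall f, 0 <= ip f f }.

Section semi_inner_theory.
Context (R : realType) (E : lmodType R) (ip : E -> E -> R).
Hypothesis ipP : semi_inner ip.

Lemma ipDl f g h : ip (f + g) h = ip f h + ip g h.
Proof. by have := ipPl ipP 1 f g h; rewrite scale1r mul1r. Qed.

Lemma ip0l h : ip 0 h = 0.
Proof. by have := ipDl 0 0 h; rewrite addr0; lra. Qed.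

Lemma ipZl a f h : ip (a *: f) h = a * ip f h.
Proof. by have := ipPl ipP a f 0 h; rewrite addr0 ip0l addr0. Qed.

Lemma ipNl f h : ip (- f) h = - ip f h.
Proof. by rewrite -scaleN1r ipZl mulN1r. Qed.

Lemma ipBl f g h : ip (f - g) h = ip f h - ip g h.
Proof. by rewrite ipDl ipNl. Qed.

Lemma ipDr f g h : ip h (f + g) = ip h f + ip h g.
Proof. by rewrite !(ipC ipP h) ipDl. Qed.

Lemma ipZr a f h : ip h (a *: f) = a * ip h f.
Proof. by rewrite !(ipC ipP h) ipZl. Qed.

Lemma ipNr f h : ip h (- f) = - ip h f.
Proof. by rewrite !(ipC ipP h) ipNl. Qed.

Lemma ipBr f g h : ip h (f - g) = ip h f - ip h g.
Proof. by rewrite !(ipC ipP h) ipBl. Qed.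

Definition nrm f := Num.sqrt (ip f f).

Lemma nrm_ge0 f : 0 <= nrm f. Proof. exact: sqrtr_ge0. Qed.

Lemma sqr_nrm f : nrm f ^+ 2 = ip f f.
Proof. by rewrite sqr_sqrtr// ip_ge0. Qed.

Lemma ip_sqr_le f g : ip f g ^+ 2 <= ip f f * ip g g.
Proof.
have D (t : R) : 0 <= ip f f + 2 * t * ip f g + t ^+ 2 * ip g g.
  have := ip_ge0 ipP (t *: g + f).
  by rewrite !(ipDl, ipDr, ipZl, ipZr) (ipC ipP g f); lra.
have := ip_ge0 ipP g; rewrite le_eqVlt => /orP[/eqP g0|g0].
  rewrite -g0 mulr0; move: D; rewrite -g0 => D.
  have [->|fg0] := eqVneq (ip f g) 0; first by rewrite expr0n.
  (* For a null [g] the quadratic form [D] is affine in [t]; at this [t] it equals [- ip f f - 2],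
     which is negative. *)
  have := D (- (ip f f + 1) / ip f g); rewrite mulr0 addr0 -mulrA mulrVK ?unitfE//.
  by have := ip_ge0 ipP f; lra.
have := D (- ip f g / ip g g).
rewrite -(ler_pM2r g0) mul0r => H; rewrite -subr_ge0; apply: le_trans H _.
by rewrite le_eqVlt; apply/orP; left; apply/eqP; field; rewrite gt_eqF.
Qed.

Lemma ip_le f g : `|ip f g| <= nrm f * nrm g.
Proof.
rewrite -(@ler_pXn2r _ 2)// ?nnegrE ?mulr_ge0 ?nrm_ge0//.
by rewrite exprMn !sqr_nrm real_normK ?num_real// ip_sqr_le.
Qed.

Lemma nrmD f g : nrm (f + g) <= nrm f + nrm g.
Proof.
rewrite -(@ler_pXn2r _ 2)// ?nnegrE ?addr_ge0 ?nrm_ge0//.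
rewrite sqr_nrm !(ipDl, ipDr) (ipC ipP g f) sqrrD !sqr_nrm.
have := ler_norm (ip f g); have := ip_le f g; lra.
Qed.

Lemma nrmZ a f : nrm (a *: f) = `|a| * nrm f.
Proof.
apply/eqP; rewrite -(@eqrXn2 _ 2)// ?mulr_ge0 ?nrm_ge0//.
by rewrite exprMn !sqr_nrm ipZl ipZr mulrA -expr2 real_normK ?num_real.
Qed.

Lemma nrmN f : nrm (- f) = nrm f.
Proof. by rewrite -scaleN1r nrmZ normrN1 mul1r. Qed.

Lemma nrm0 : nrm 0 = 0.
Proof. by rewrite /nrm ip0l sqrtr0. Qed.

Lemma nrmB f g : nrm (f - g) = nrm (g - f).
Proof. by rewrite -opprB nrmN. Qed.

Lemma nrm_tri h f g : nrm (f - g) <= nrm (f - h) + nrm (h - g).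
Proof. by rewrite -{1}[f](subrK h) -addrA nrmD. Qed.

Lemma nrm_null_addl f g : nrm f = 0 -> nrm (f + g) = nrm g.
Proof.
move=> f0; apply/eqP; rewrite eq_le; apply/andP; split.
  by rewrite (le_trans (nrmD _ _))// f0 add0r.
by have := nrmD (- f) (f + g); rewrite addKr nrmN f0 add0r.
Qed.

Lemma nrm_null f g : nrm (f - g) = 0 -> nrm f = nrm g.
Proof. by move=> fg; rewrite -(nrm_null_addl g fg) subrK. Qed.

Lemma ip_null f g h : nrm (f - g) = 0 -> ip f h = ip g h.
Proof.
move=> fg; apply/eqP; rewrite -subr_eq0 -ipBl -normr_le0.
by rewrite (le_trans (ip_le _ _))// fg mul0r.
Qed.

Lemma nrm_le_gap f g : `|nrm f - nrm g| <= nrm (f - g).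
Proof.
have A := nrmD (f - g) g; have B := nrmD (g - f) f.
by rewrite !subrK in A B; rewrite (nrmB g f) in B; rewrite ler_norml; apply/andP; split; lra.
Qed.

End semi_inner_theory.

(** The semigroup laws hold up to elements of zero seminorm. The constant in [ssg_bounded] depends
    on [t] with no control as [t] tends to 0. *)
Record seminormed_semigroup (R : realType) (E : lmodType R) (N : E -> R)
    (P : R -> E -> E) : Prop := SeminormedSemigroup {
  ssg_linear : forall t a f g, 0 <= t ->
    N (P t (a *: f + g) - (a *: P t f + P t g)) = 0;
  ssg_bounded : forall t, 0 <= t -> exists C, forall f, N (P t f) <= C * N f;
  ssg_id : forall f, N (P 0 f - f) = 0;
  ssg_comp : forall s t f, 0 <= s -> 0 <= t -> N (P (s + t) f - P s (P t f)) = 0;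
  ssg_cvg : forall f e, 0 < e ->
    exists2 d, 0 < d & forall t, 0 < t -> t < d -> N (P t f - f) < e }.

Definition seminorm_complete (R : realType) (E : lmodType R) (N : E -> R) :=
  forall u : nat -> E,
    (forall e, 0 < e -> exists k, forall m n, (k <= m)%N -> (k <= n)%N ->
      N (u m - u n) < e) ->
    exists h, forall e, 0 < e -> exists k, forall n, (k <= n)%N -> N (u n - h) < e.

Section semigroup.
Context (R : realType) (E : lmodType R) (ip : E -> E -> R) (P : R -> E -> E).
Hypothesis ipP : semi_inner ip.
Local Notation N := (nrm ip).
Hypothesis sgP : seminormed_semigroup N P.
Hypothesis Ncomplete : seminorm_complete N.

Lemma sg_null t f : 0 <= t -> N f = 0 -> N (P t f) = 0.
Proof.
move=> t0 f0; have [C /(_ f)] := ssg_bounded sgP t0.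
by rewrite f0 mulr0 => H; apply/eqP; rewrite eq_le H nrm_ge0.
Qed.

Lemma sgZ t a f : 0 <= t -> N (P t (a *: f)) = `|a| * N (P t f).
Proof.
move=> t0; have := ssg_linear sgP a f 0 t0; rewrite addr0 => /(nrm_null ipP) ->.
by rewrite addrC nrm_null_addl// ?nrmZ// sg_null// nrm0.
Qed.

Lemma sgB t f g : 0 <= t -> N (P t f - P t g - P t (f - g)) = 0.
Proof.
move=> t0; have := ssg_linear sgP (-1) g f t0.
by rewrite nrmB// !scaleN1r [- g + f]addrC [- P t g + _]addrC.
Qed.

Lemma sgBN t f g : 0 <= t -> N (P t f - P t g) = N (P t (f - g)).
Proof. by move=> t0; apply: nrm_null => //; exact: sgB. Qed.

(** One step of the construction of nested balls: [y.1.1] is the new centre, [y.1.2] the new radius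
    and [y.2] a small time at which the operator has norm at least [k] on every point of the ball of
    twice the new radius. *)
Lemma gliding_hump_step (k : nat) (x : E) (r : R) :
  ~ (exists2 d : R, 0 < d & exists M : R, forall (t : R) f, 0 <= t -> t <= d ->
      N (P t f) <= M * N f) ->
  0 < r -> r <= 1 ->
  exists y : E * R * R,
    [/\ 0 <= y.2 <= k.+1%:R^-1, N (y.1.1 - x) <= r,
      0 < y.1.2, y.1.2 <= r / 2 &
      forall z, N (z - y.1.1) <= 2 * y.1.2 -> k%:R <= N (P y.2 z)].
Proof.
move=> unb r0 r1.
have [t [f [t0 tk tf]]] : exists t f, [/\ 0 <= t, t <= k.+1%:R^-1 &
    k.+1%:R / r * N f < N (P t f)].
  apply: contrapT => H; apply: unb; exists k.+1%:R^-1; first by rewrite invr_gt0.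
  exists (k.+1%:R / r) => t f t0 tk; rewrite leNgt; apply/negP => ?.
  by apply: H; exists t, f.
have [C0 C0P] := ssg_bounded sgP t0.
pose C := Num.max C0 0.
have CP g : N (P t g) <= C * N g.
  by rewrite (le_trans (C0P g))// ler_wpM2r ?nrm_ge0// le_max lexx.
have C_ge0 : 0 <= C by rewrite le_max lexx orbT.
have f0 : 0 < N f.
  rewrite lt_neqAle nrm_ge0 andbT; apply/eqP => /esym f0.
  by move: tf; rewrite f0 mulr0 sg_null// ltxx.
pose y := (r / N f) *: f.
have yN : N y = r by rewrite nrmZ// ger0_norm ?divr_ge0 ?nrm_ge0 ?ltW// divfK ?gt_eqF.
have yP : k.+1%:R < N (P t y).
  rewrite sgZ// ger0_norm ?divr_ge0 ?nrm_ge0 ?ltW//.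
  rewrite -(ltr_pM2l (divr_gt0 r0 f0)) in tf.
  apply: le_lt_trans tf; rewrite le_eqVlt; apply/orP; left; apply/eqP; field.
  by rewrite !gt_eqF.
(* The points [x + y] and [x - y] differ by [2 y], so the image of one of them is at least as large
   as that of [y]. *)
have [x' [x'x x'P]] : exists x', N (x' - x) = r /\ k.+1%:R <= N (P t x').
  have H : 2 * N (P t y) <= N (P t (x + y)) + N (P t (x - y)).
    have e : (x + y) - (x - y) = 2 *: y.
      by rewrite opprB addrC addrA subrK scaler_nat mulr2n.
    have := sgBN (x + y) (x - y) t0; rewrite e (sgZ 2 y t0) ger0_norm// => <-.
    by rewrite (le_trans (nrmD ipP _ _))// nrmN.
  have [?|?] := leP k.+1%:R (N (P t (x + y))).
    by exists (x + y); split=> //; rewrite addrC addKr.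
  exists (x - y); split; first by rewrite addrC addKr nrmN.
  apply/ltW; lra.
have C1 : 0 < C + 1 by lra.
(* Moving by twice this radius changes [P t x'] by at most [r <= 1], so the lower bound drops from
   [k + 1] to [k]. *)
exists (x', r / (2 * (C + 1)), t); split => //=.
- by rewrite t0 tk.
- by rewrite x'x.
- by rewrite divr_gt0// mulr_gt0.
- by rewrite ler_pM2l// lef_pV2 ?posrE ?mulr_gt0//; lra.
- move=> z zx'; have := nrm_le_gap ipP (P t x') (P t z).
  rewrite sgBN// ler_norml => /andP[_].
  have := CP (x' - z); rewrite nrmB//.
  have H : C * N (z - x') <= r.
    rewrite (le_trans (ler_wpM2l C_ge0 zx'))//.
    have -> : C * (2 * (r / (2 * (C + 1)))) = r * (C / (C + 1)) by field; rewrite gt_eqF.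
    by rewrite ler_piMr ?(ltW r0)// ler_pdivrMr//; lra.
  move: x'P; rewrite -natr1; lra.
Qed.

(* The gliding hump argument of the uniform boundedness theorem. *)
Lemma sg_bounded_near0 : exists2 d : R, 0 < d & exists M : R, forall (t : R) f,
  0 <= t -> t <= d -> N (P t f) <= M * N f.
Proof.
apply: contrapT => unb.
have /choice[step stepP] : forall z : nat * (E * R), exists y : E * R * R,
    0 < z.2.2 <= 1 ->
    [/\ 0 <= y.2 <= z.1.+1%:R^-1, N (y.1.1 - z.2.1) <= z.2.2,
      0 < y.1.2, y.1.2 <= z.2.2 / 2 &
      forall w, N (w - y.1.1) <= 2 * y.1.2 -> z.1%:R <= N (P y.2 w)].
  move=> [k [x r]]; have [/andP[r0 r1]|] := boolP (0 < r <= 1); last by exists (x, r, r).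
  by have [y] := @gliding_hump_step k x r unb r0 r1; exists y.
pose u := fix u k : E * R := if k is j.+1 then (step (j, u j)).1 else (0, 1).
have u01 k : 0 < (u k).2 <= 1.
  elim: k => [|k /[dup] ku /(stepP (k, u k)) /= [_ _ -> H _]]; first by rewrite /= lexx ltr01.
  by rewrite (le_trans H)//; lra.
have uP k := stepP (k, u k) (u01 k).
have uS k : (step (k, u k)).1 = u k.+1 by [].
(* Radii at least halve, so a displacement [r_k] is at most [2 r_k - 2 r_(k+1)] and telescopes. The
   limit of the centres thus lies within [2 r_k] of the [k]-th one. *)
have uD k m : N ((u (k + m)%N).1 - (u k).1) <= 2 * (u k).2 - 2 * (u (k + m)%N).2.
  elim: m => [|m IH]; first by rewrite addn0 !subrr nrm0.
  have [_ H1 _ H2 _] := uP (k + m)%N; rewrite uS -addnS /= in H1 H2.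
  by have := nrm_tri ipP (u (k + m)%N).1 (u (k + m.+1)%N).1 (u k).1; lra.
have uk k : (u k).2 <= k.+1%:R^-1.
  elim: k => [|k IH]; first by rewrite invr1; case/andP: (u01 0%N).
  have [_ _ _ H2 _] := uP k; rewrite uS /= in H2.
  rewrite (le_trans H2)// ler_pdivrMr//; apply: le_trans IH _.
  rewrite [k.+2%:R^-1 * 2]mulrC ler_pdivlMr// mulrC ler_pdivrMr// -!natr1.
  by have : 0 <= k%:R :> R by []; lra.
have arch (e : R) : 0 < e -> exists k, forall n, (k <= n)%N -> n.+1%:R^-1 < e.
  move=> e0; have [k _ H] := near_infty_natSinv_lt (PosNum e0).
  by exists k => n kn; apply: H.
have [h hP] : exists h, forall e, 0 < e -> exists k, forall n, (k <= n)%N ->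
    N ((u n).1 - h) < e.
  apply: (Ncomplete (u := fun n => (u n).1)) => e e0.
  have [k kP] : exists k, forall n, (k <= n)%N -> n.+1%:R^-1 < e / 4 by apply: arch; lra.
  have D n : (k <= n)%N -> N ((u n).1 - (u k).1) < e / 2.
    move=> kn; have := uD k (n - k)%N; rewrite subnKC// => H.
    by have := le_lt_trans (uk k) (kP k (leqnn k)); have /andP[? _] := u01 n; lra.
  exists k => m n km kn; have := nrm_tri ipP (u k).1 (u m).1 (u n).1.
  by have := D m km; have := D n kn; rewrite (nrmB ipP (u n).1); lra.
have hu k : N (h - (u k).1) <= 2 * (u k).2.
  apply/ler_addgt0Pr => e e0; have [j jP] := hP e e0.
  have := jP (k + j)%N (leq_addl _ _); have := uD k j.
  have := nrm_tri ipP (u (k + j)%N).1 h (u k).1; rewrite (nrmB ipP h (u (k + j)%N).1).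
  by have /andP[? _] := u01 (k + j)%N; lra.
(* At the limit point [h], continuity keeps [P t h] within 1 of [h] for [t < d], while the
   construction gives [N (P t h) >= m > N h + 1] for some such [t]. *)
have [d d0 dP] := ssg_cvg sgP h (@ltr01 R).
have [k kP] := arch _ d0.
pose m := (k + (Num.truncn (N h + 1)).+1)%N.
have [/andP[t0 tm] _ _ _ tP] := uP m.
have := tP h (hu m.+1); set t := (step (m, u m)).2; rewrite -/t /= in t0 tm *.
have mh : N h + 1 < m%:R.
  by rewrite /m natrD ltr_wpDl// truncnS_gt// addr_ge0// nrm_ge0.
have td : t < d by rewrite (le_lt_trans tm)// kP// leq_addr.
move: t0; rewrite le_eqVlt => /orP[/eqP<-|t0].
  by rewrite (nrm_null ipP (ssg_id sgP h)); lra.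
have := nrm_le_gap ipP (P t h) h; have := dP t t0 td.
rewrite ler_norml => ? /andP[_]; lra.
Qed.

(** The bound [M >= 1] valid up to time [d] is iterated by the semigroup law, about [T / d]
    times. *)
Lemma sg_locally_bounded (T : R) : exists2 M, 0 <= M &
  forall t f, 0 <= t -> t <= T -> N (P t f) <= M * N f.
Proof.
have [d d0 [M0 M0P]] := sg_bounded_near0.
pose M := Num.max M0 1.
have M1 : 1 <= M by rewrite le_max lexx orbT.
have MP t f : 0 <= t -> t <= d -> N (P t f) <= M * N f.
  by move=> *; rewrite (le_trans (M0P _ _ _ _))// ler_wpM2r ?nrm_ge0// le_max lexx.
have MX k t f : 0 <= t -> t <= d * k.+1%:R -> N (P t f) <= M ^+ k.+1 * N f.
  elim: k t => [|k IH] t t0; first by rewrite mulr1 expr1; exact: MP.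
  have [td _|td tk] := leP t d.
    rewrite (le_trans (MP _ _ t0 td))// ler_wpM2r ?nrm_ge0//.
    by rewrite exprS ler_pMr ?exprn_ege1//; lra.
  have td0 : 0 <= t - d by lra.
  have := ssg_comp sgP f (ltW d0) td0; rewrite subrKC => /(nrm_null ipP) ->.
  rewrite (le_trans (MP _ _ (ltW d0) (lexx d)))// exprS -mulrA ler_wpM2l//; first by lra.
  by apply: IH => //; move: tk; rewrite -natr1; lra.
exists (M ^+ (Num.truncn (T / d)).+1); first by rewrite exprn_ge0//; lra.
move=> t f t0 tT; apply: MX => //; apply: (le_trans tT).
by rewrite mulrC -ler_pdivrMr// ltW// truncnS_gt.
Qed.

End semigroup.

(** * Uniform one-sided derivatives of curves *)

Section curves.
Context (R : realType) (E : lmodType R) (ip : E -> E -> R).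
Hypothesis ipP : semi_inner ip.
Local Notation N := (nrm ip).
Implicit Types (U V : R -> E) (u v : R -> R) (T : R).

(* [U' s] is the derivative of [U] from the right at [s], uniformly in [s]. *)
Definition uderiv T U U' := forall e, 0 < e -> exists2 d, 0 < d &
  forall s t, 0 <= s -> s < t -> t <= T -> t - s < d ->
    N (U t - U s - (t - s) *: U' s) <= e * (t - s).

Definition ucont T U := forall e, 0 < e -> exists2 d, 0 < d &
  forall s t, 0 <= s -> s < t -> t <= T -> t - s < d -> N (U t - U s) <= e.

Definition ubnd T U := exists2 M, 0 < M & forall s, 0 <= s -> s <= T -> N (U s) <= M.

Definition uderivR T u u' := forall e, 0 < e -> exists2 d, 0 < d &
  forall s t, 0 <= s -> s < t -> t <= T -> t - s < d ->
    `|u t - u s - (t - s) * u' s| <= e * (t - s).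

Definition ucontR T u := forall e, 0 < e -> exists2 d, 0 < d &
  forall s t, 0 <= s -> s < t -> t <= T -> t - s < d -> `|u t - u s| <= e.

Lemma uderiv_ucont T U U' : uderiv T U U' -> ubnd T U' -> ucont T U.
Proof.
move=> dU [M M0 U'M] e e0; have [d d0 dP] := dU _ (@ltr01 R).
have M1 : 0 < 1 + M by lra.
exists (Num.min d (e / (1 + M))); first by rewrite lt_min d0 divr_gt0.
move=> s t s0 st tT; rewrite lt_min ltr_pdivlMr// => /andP[tsd tse].
have := dP s t s0 st tT tsd.
have := nrmD ipP (U t - U s - (t - s) *: U' s) ((t - s) *: U' s).
rewrite subrK nrmZ// (@ger0_norm _ (t - s)); last by lra.
have := U'M s s0 (le_trans (ltW st) tT); rewrite -(@ler_pM2l _ (t - s)); last by lra.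
lra.
Qed.

(** Reversing time turns right derivatives into left ones; continuity of [U'] makes up for
    evaluating it at the other end of the small interval. *)
Lemma uderiv_rev T U U' : uderiv T U U' -> ucont T U' ->
  uderiv T (fun t => U (T - t)) (fun t => - U' (T - t)).
Proof.
move=> dU cU e e0; have e2 : 0 < e / 2 by lra.
have [d d0 dP] := dU _ e2; have [d' d'0 d'P] := cU _ e2.
exists (Num.min d d'); first by rewrite lt_min d0.
move=> s t s0 st tT; rewrite lt_min => /andP[tsd tsd'].
have h : T - s - (T - t) = t - s by lra.
have := dP (T - t) (T - s); have := d'P (T - t) (T - s); rewrite h.
move=> /(_ ltac:(lra) ltac:(lra) ltac:(lra) tsd') H1.
move=> /(_ ltac:(lra) ltac:(lra) ltac:(lra) tsd) H2.
have -> : U (T - t) - U (T - s) - (t - s) *: - U' (T - s) =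
   - (U (T - s) - U (T - t) - (t - s) *: U' (T - t)) +
   (t - s) *: (U' (T - s) - U' (T - t)).
  rewrite scalerN scalerBr opprK opprB [- (_ - _)]opprB.
  by rewrite [RHS]addrC addrA subrK addrC.
have := nrmD ipP (- (U (T - s) - U (T - t) - (t - s) *: U' (T - t)))
  ((t - s) *: (U' (T - s) - U' (T - t))).
rewrite nrmN// nrmZ// (@ger0_norm _ (t - s)); last by lra.
rewrite -(@ler_pM2l _ (t - s)) in H1; last by lra.
lra.
Qed.

Lemma uderiv_ip T U U' V V' : uderiv T U U' -> uderiv T V V' ->
  ubnd T U -> ubnd T V -> ubnd T U' -> ubnd T V' ->
  uderivR T (fun t => ip (U t) (V t)) (fun t => ip (U' t) (V t) + ip (U t) (V' t)).
Proof.
move=> dU dV [A A0 UA] [B B0 VB] bU' bV' e e0.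
have cV := uderiv_ucont dV bV'; case: bU' => C C0 U'C.
pose e' := e / (A + B + C).
have ABC0 : 0 < A + B + C by lra.
have e'0 : 0 < e' by rewrite divr_gt0.
have [d1 d10 d1P] := dU _ e'0; have [d2 d20 d2P] := dV _ e'0.
have [d3 d30 d3P] := cV _ e'0.
exists (Num.min d1 (Num.min d2 d3)); first by rewrite !lt_min d10 d20 d30.
move=> s t s0 st tT; rewrite !lt_min => /and3P[ts1 ts2 ts3].
have sT : s <= T by lra.
have t0 : 0 <= t by lra.
have -> : ip (U t) (V t) - ip (U s) (V s) -
     (t - s) * (ip (U' s) (V s) + ip (U s) (V' s)) =
  ip (U t - U s - (t - s) *: U' s) (V t) + (t - s) * ip (U' s) (V t - V s)
  + ip (U s) (V t - V s - (t - s) *: V' s).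
  rewrite !(ipBl ipP, ipBr ipP, ipZl ipP, ipZr ipP); ring.
have -> : e * (t - s) = e' * (t - s) * B + (t - s) * (C * e') + A * (e' * (t - s)).
  by rewrite /e'; field; rewrite gt_eqF.
have ts0 : 0 <= t - s by lra.
rewrite (le_trans (ler_normD _ _))// lerD//.
  rewrite (le_trans (ler_normD _ _))// lerD//.
    rewrite (le_trans (ip_le ipP _ _))// ler_pM ?nrm_ge0//; last exact: VB.
    exact: d1P.
  rewrite normrM ger0_norm// ler_wpM2l//.
  by rewrite (le_trans (ip_le ipP _ _))// ler_pM ?nrm_ge0//; [exact: U'C|exact: d3P].
by rewrite (le_trans (ip_le ipP _ _))// ler_pM ?nrm_ge0//; [exact: UA|exact: d2P].
Qed.

Lemma ucont_ip T U V : ucont T U -> ucont T V -> ubnd T U -> ubnd T V ->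
  ucontR T (fun t => ip (U t) (V t)).
Proof.
move=> cU cV [A A0 UA] [B B0 VB] e e0; pose e' := e / (A + B).
have AB0 : 0 < A + B by lra.
have e'0 : 0 < e' by rewrite divr_gt0.
have [d2 d20 d2P] := cU _ e'0; have [d3 d30 d3P] := cV _ e'0.
exists (Num.min d2 d3); first by rewrite !lt_min d20 d30.
move=> s t s0 st tT; rewrite !lt_min => /andP[ts2 ts3].
have -> : ip (U t) (V t) - ip (U s) (V s) =
  ip (U t - U s) (V t) + ip (U s) (V t - V s).
  by rewrite !(ipBl ipP, ipBr ipP); ring.
have -> : e = e' * B + A * e' by rewrite /e'; field; rewrite gt_eqF.
rewrite (le_trans (ler_normD _ _))// lerD//.
  by rewrite (le_trans (ip_le ipP _ _))// ler_pM ?nrm_ge0//; [exact: d2P|apply: VB; lra].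
by rewrite (le_trans (ip_le ipP _ _))// ler_pM ?nrm_ge0//; [apply: UA; lra|exact: d3P].
Qed.

Lemma ucontRD T u v : ucontR T u -> ucontR T v -> ucontR T (fun t => u t + v t).
Proof.
move=> cu cv e e0; have e2 : 0 < e / 2 by lra.
have [d d0 dP] := cu _ e2; have [d' d'0 d'P] := cv _ e2.
exists (Num.min d d'); first by rewrite lt_min d0.
move=> s t s0 st tT; rewrite lt_min => /andP[tsd tsd'].
have -> : u t + v t - (u s + v s) = (u t - u s) + (v t - v s) by ring.
by rewrite (le_trans (ler_normD _ _))// (splitr e) lerD//; [exact: dP|exact: d'P].
Qed.

Lemma ucontRM T c u : ucontR T u -> ucontR T (fun t => c * u t).
Proof.
move=> cu e e0; have c1 : 0 < `|c| + 1 by rewrite ltr_wpDl.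
have [d d0 dP] := cu _ (divr_gt0 e0 c1).
exists d => // s t s0 st tT tsd; rewrite -mulrBr normrM.
have := dP s t s0 st tT tsd; rewrite ler_pdivlMr//; have := normr_ge0 (u t - u s); lra.
Qed.

Lemma uderivRD T u u' v v' : uderivR T u u' -> uderivR T v v' ->
  uderivR T (fun t => u t + v t) (fun t => u' t + v' t).
Proof.
move=> cu cv e e0; have e2 : 0 < e / 2 by lra.
have [d d0 dP] := cu _ e2; have [d' d'0 d'P] := cv _ e2.
exists (Num.min d d'); first by rewrite lt_min d0.
move=> s t s0 st tT; rewrite lt_min => /andP[tsd tsd'].
have -> : u t + v t - (u s + v s) - (t - s) * (u' s + v' s) =
  (u t - u s - (t - s) * u' s) + (v t - v s - (t - s) * v' s) by ring.
by rewrite (le_trans (ler_normD _ _))// (splitr e) [(e / 2 + e / 2) * _]mulrDl lerD//; [exact: dP|exact: d'P].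
Qed.

Lemma uderivRM T c u u' : uderivR T u u' -> uderivR T (fun t => c * u t) (fun t => c * u' t).
Proof.
move=> cu e e0; have c1 : 0 < `|c| + 1 by rewrite ltr_wpDl.
have [d d0 dP] := cu _ (divr_gt0 e0 c1).
exists d => // s t s0 st tT tsd.
have -> : c * u t - c * u s - (t - s) * (c * u' s) =
  c * (u t - u s - (t - s) * u' s) by ring.
rewrite normrM; have := dP s t s0 st tT tsd; set w := `|u t - _ - _|.
rewrite mulrAC ler_pdivlMr//; have : 0 <= w by rewrite /w.
lra.
Qed.

Lemma uderivR_id T : uderivR T id (cst 1).
Proof.
move=> e e0; exists 1 => // s t s0 st _ _.
by rewrite /= mulr1 subrr normr0 mulr_ge0// ?ltW// subr_gt0.
Qed.

(** Uniformity gives [u t - u s <= e (t - s)] on intervals shorter than [d]; steps of length [d / 2]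
    extend it to all intervals, and [e] is arbitrary. *)
Lemma uderivR_nonincreasing T u u' : uderivR T u u' ->
  (forall s, 0 <= s -> s <= T -> u' s <= 0) ->
  forall s t, 0 <= s -> s <= t -> t <= T -> u t <= u s.
Proof.
move=> du u'0.
suff H e : 0 < e -> forall s t, 0 <= s -> s <= t -> t <= T -> u t - u s <= e * (t - s).
  move=> s t s0 st tT; rewrite -subr_le0; apply/ler_addgt0Pr => e e0; rewrite add0r.
  have ts : 0 < t - s + 1 by lra.
  have := H _ (divr_gt0 e0 ts) s t s0 st tT; rewrite -mulrA => H'.
  by rewrite (le_trans H')// ler_piMr ?(ltW e0)// mulrC ler_pdivrMr//; lra.
move=> e0; have [d d0 dP] := du e e0.
have small s t : 0 <= s -> s <= t -> t <= T -> t - s < d -> u t - u s <= e * (t - s).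
  move=> s0; rewrite le_eqVlt => /orP[/eqP->|st tT tsd]; first by rewrite !subrr mulr0.
  have := dP s t s0 st tT tsd; rewrite ler_norml => /andP[_].
  have := u'0 s s0 (le_trans (ltW st) tT); rewrite -(@ler_pM2l _ (t - s)); lra.
suff H n s t : 0 <= s -> s <= t -> t <= T -> t - s < d / 2 * n.+1%:R -> u t - u s <= e * (t - s).
  move=> s t s0 st tT; apply: (H (Num.truncn ((t - s) / (d / 2)))) => //.
  by rewrite mulrC -ltr_pdivrMr ?truncnS_gt//; lra.
elim: n s t => [|n IH] s t s0 st tT; first by rewrite mulr1 => ?; apply: small => //; lra.
rewrite -[n.+2%:R]natr1 => tsn; have [tsd|dts] := ltP (t - s) d; first exact: small.
have := IH s (t - d / 2) s0 ltac:(lra) ltac:(lra) ltac:(lra).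
by have := small (t - d / 2) t ltac:(lra) ltac:(lra) ltac:(lra) ltac:(lra); lra.
Qed.

(** For a negative increment [h], the right derivative at [t + h] is used in place of the left
    derivative at [t]; they differ little by continuity of [u']. *)
Lemma uderivR_is_derive T u u' : uderivR T u u' -> ucontR T u' ->
  forall t, 0 < t -> t < T -> is_derive t 1 u (u' t).
Proof.
move=> du cu' t t0 tT.
suff H : h^-1 *: (u (h *: 1 + t) - u t) @[h --> 0^'] --> u' t.
  by apply: DeriveDef; [exact: (cvgP (u' t))|exact: cvg_lim].
apply/cvgrPdist_le => e e0; have e2 : 0 < e / 2 by lra.
have [d d0 dP] := du _ e2; have [d' d'0 d'P] := cu' _ e2.
near=> h.
have h0 : h != 0 by near: h; exact: nbhs_dnbhs_neq.
have hd : `|h| < Num.min (Num.min d d') (Num.min t (T - t)).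
  near: h; apply: dnbhs0_lt; rewrite !lt_min d0 d'0 t0/=; lra.
move: hd; rewrite !lt_min => /andP[/andP[hd hd'] /andP[ht hT]].
rewrite /= [h *: _]mulr1 [_ *: _]mulrC distrC.
have [hp|hn|] := ltgtP h 0; last by move=> h00; rewrite h00 eqxx in h0.
  rewrite ltr0_norm// in hd hd' ht hT.
  have ths : t - (h + t) = - h by lra.
  have := dP (h + t) t; have := d'P (h + t) t; rewrite ths.
  move=> /(_ ltac:(lra) ltac:(lra) ltac:(lra) hd') H1.
  move=> /(_ ltac:(lra) ltac:(lra) ltac:(lra) hd) H2.
  have -> : (u (h + t) - u t) / h - u' t =
      - ((u t - u (h + t) - - h * u' (h + t)) / h) - (u' t - u' (h + t)).
    by field.
  rewrite (le_trans (ler_normB _ _))// (splitr e) lerD// normrN normrM normfV.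
  by rewrite ler_pdivrMr ?normr_gt0// (ltr0_norm hp).
rewrite gtr0_norm// in hd hd' ht hT.
have ths : h + t - t = h by lra.
have := dP t (h + t); rewrite ths => /(_ ltac:(lra) ltac:(lra) ltac:(lra) hd) H2.
have -> : (u (h + t) - u t) / h - u' t = (u (h + t) - u t - h * u' t) / h by field.
rewrite normrM normfV ler_pdivrMr ?normr_gt0// (gtr0_norm hn) (le_trans H2)//.
by rewrite ler_pM2r//; lra.
Unshelve. all: by end_near. Qed.

Lemma ucontR_continuous u : (forall T, ucontR T u) ->
  {within `[0, +oo[, continuous u}.
Proof.
move=> cu; apply/continuous_within_itvcyP; split.
  move=> t; rewrite in_itv/= andbT => t0; apply/cvgrPdist_le => e e0.
  have [d d0 dP] := cu (t + 1) e e0; near=> s.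
  have /andP[s1 s2] : t - Num.min d t < s < t + Num.min d 1.
    have : s \in `](t - Num.min d t), (t + Num.min d 1)[.
      near: s; apply: near_in_itvoo; rewrite in_itv/= ltrBlDr !ltrDl.
      by rewrite !lt_min d0 t0 ltr01.
    by rewrite in_itv.
  have [d1 d2] : Num.min d t <= d /\ Num.min d t <= t by split; rewrite ge_min lexx ?orbT.
  have [d3 d4] : Num.min d 1 <= d /\ Num.min d 1 <= 1 by split; rewrite ge_min lexx ?orbT.
  have [st|ts|->] := ltgtP s t; last by rewrite subrr normr0 ltW.
    by apply: dP => //; lra.
  by rewrite distrC; apply: dP => //; lra.
apply/cvgrPdist_le => e e0; have [d d0 dP] := cu 1 e e0; near=> s.
have s0 : 0 < s by near: s; exact: nbhs_right_gt.
have sd : s < Num.min d 1 by near: s; apply: nbhs_right_lt; rewrite lt_min d0 ltr01.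
by move: sd; rewrite lt_min distrC => /andP[? ?]; apply: dP => //; lra.
Unshelve. all: by end_near. Qed.

End curves.

(** * Orbits of a semigroup with symmetric generator *)

Section symmetric_semigroup.
Context (R : realType) (E : lmodType R) (ip : E -> E -> R) (P : R -> E -> E).
Hypothesis ipP : semi_inner ip.
Local Notation N := (nrm ip).
Hypothesis sgP : seminormed_semigroup N P.
Hypothesis Ncomplete : seminorm_complete N.

Definition generator (f g : E) := forall e, 0 < e -> exists2 d, 0 < d &
  forall t, 0 < t -> t < d -> N (t^-1 *: (P t f - f) - g) < e.

Hypothesis gen_sym : forall f g f' g', generator f g -> generator f' g' ->
  ip g f' = ip f g'.

Let subBBK (V : zmodType) (a a' b x : V) : (a - b - x) - (a' - b - x) = a - a'.
Proof. by rewrite -[a - b - x]addrA -[a' - b - x]addrA [a' + _]addrC addrKA. Qed.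

Lemma sg3 t a x y z : 0 <= t ->
  N (P t (x - y - a *: z)) = N (P t x - P t y - a *: P t z).
Proof.
move=> t0; have := ssg_linear sgP (- a) z (x - y) t0.
rewrite !scaleNr [- (a *: z) + _]addrC => /(nrm_null ipP) ->.
rewrite [- _ + _]addrC; apply: (nrm_null ipP).
by rewrite [_ - _ - a *: _]addrC addrKA nrmB//; exact: sgB.
Qed.

Lemma orbit_ubnd T f : ubnd ip T (P^~ f).
Proof.
have [M M0 MP] := sg_locally_bounded ipP sgP Ncomplete T.
exists (M * N f + 1); first by rewrite ltr_wpDl// mulr_ge0// nrm_ge0.
by move=> s s0 sT; rewrite (le_trans (MP _ _ s0 sT))// lerDl.
Qed.

Lemma orbit_ucont T f : ucont ip T (P^~ f).
Proof.
have [M M0 MP] := sg_locally_bounded ipP sgP Ncomplete T.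
move=> e e0; have M1 : 0 < M + 1 by lra.
have [d d0 dP] := ssg_cvg sgP f (divr_gt0 e0 M1).
exists d => // s t s0 st tT tsd.
have ts0 : 0 < t - s by lra.
have := ssg_comp sgP f s0 (ltW ts0); rewrite subrKC => H.
have -> : N (P t f - P s f) = N (P s (P (t - s) f - f)).
  rewrite -sgBN//; apply: (nrm_null ipP).
  by rewrite opprB addrA subrK.
have := dP _ ts0 tsd; rewrite ltr_pdivlMr//.
have := MP s (P (t - s) f - f) s0 (le_trans (ltW st) tT).
have := nrm_ge0 ip (P (t - s) f - f); lra.
Qed.

Lemma generatorE f g t : 0 < t ->
  N (P t f - f - t *: g) = t * N (t^-1 *: (P t f - f) - g).
Proof.
move=> t0; have := nrmZ ipP t (t^-1 *: (P t f - f) - g).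
rewrite gtr0_norm// => <-.
by rewrite scalerBr scalerA mulfV ?gt_eqF// scale1r.
Qed.

Lemma orbit_uderiv T f g : generator f g -> uderiv ip T (P^~ f) (P^~ g).
Proof.
have [M M0 MP] := sg_locally_bounded ipP sgP Ncomplete T.
move=> fg e e0; have M1 : 0 < M + 1 by lra.
have [d d0 dP] := fg _ (divr_gt0 e0 M1).
exists d => // s t s0 st tT tsd.
have ts0 : 0 < t - s by lra.
have := ssg_comp sgP f s0 (ltW ts0); rewrite subrKC => H.
have -> : N (P t f - P s f - (t - s) *: P s g) =
    N (P s (P (t - s) f - f - (t - s) *: g)).
  rewrite sg3//; apply: (nrm_null ipP).
  by rewrite subBBK.
rewrite (le_trans (MP _ _ s0 (le_trans (ltW st) tT)))// generatorE//.
have := dP _ ts0 tsd; rewrite ltr_pdivlMr// mulrCA [e * _]mulrC ler_pM2l//.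
have := nrm_ge0 ip ((t - s)^-1 *: (P (t - s) f - f) - g); lra.
Qed.

(** The operator [P t] commutes with the difference quotients at 0, up to null elements, and is
    bounded. *)
Lemma generator_sg f g t : 0 <= t -> generator f g -> generator (P t f) (P t g).
Proof.
move=> t0 fg e e0; have [M MP] := ssg_bounded sgP t0.
have M1 : 0 < `|M| + 1 by rewrite ltr_wpDl.
have [d d0 dP] := fg _ (divr_gt0 e0 M1).
exists d => // h h0 hd.
rewrite -(ltr_pM2l h0) -generatorE//.
have H1 := ssg_comp sgP f (ltW h0) t0.
have H2 := ssg_comp sgP f t0 (ltW h0).
have -> : N (P h (P t f) - P t f - h *: P t g) = N (P t (P h f - f - h *: g)).
  rewrite sg3//; apply: (nrm_null ipP).
  rewrite subBBK.
  apply/eqP; rewrite eq_le nrm_ge0 andbT.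
  rewrite (le_trans (nrm_tri ipP (P (h + t) f) _ _))// nrmB// H1 add0r.
  by rewrite [h + t]addrC H2.
rewrite (le_lt_trans (MP _))// generatorE//.
have := dP _ h0 hd; rewrite ltr_pdivlMr// mulrCA ltr_pM2l//.
set x := N _; have : 0 <= x by exact: nrm_ge0.
by move=> x0 xe; rewrite (le_lt_trans _ xe)// mulrC; have := ler_norm M; nra.
Qed.

(** By symmetry of the generator, [r |-> <P r f, P (T - r) f'>] has zero derivative on [[0, T]]; its
    values at [r = s] and [r = T] are compared. *)
Lemma sg_symmetric f g f' g' s t : generator f g -> generator f' g' ->
  0 <= s -> 0 <= t -> ip (P s f) (P t f') = ip (P (s + t) f) f'.
Proof.
move=> fg fg' s0 t0; pose T := s + t.
have st0 : 0 <= T by rewrite addr_ge0.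
have d : uderivR T (fun r => ip (P r f) (P (T - r) f')) (fun=> 0).
  have : uderivR T (fun r => ip (P r f) (P (T - r) f'))
      (fun r => ip (P r g) (P (T - r) f') + ip (P r f) (- P (T - r) g')).
    apply: (uderiv_ip ipP).
    - exact: orbit_uderiv.
    - apply: (@uderiv_rev _ _ _ ipP T (P^~ f') (P^~ g')); [exact: orbit_uderiv|exact: orbit_ucont].
    - exact: orbit_ubnd.
    - have [M M0 MP] := orbit_ubnd T f'; exists M => // r r0 rT; apply: MP; lra.
    - exact: orbit_ubnd.
    - have [M M0 MP] := orbit_ubnd T g'; exists M => // r r0 rT.
      by rewrite nrmN//; apply: MP; lra.
  move=> H e e0; have [d d0 dP] := H e e0; exists d => // a b a0 ab bT abd.
  have := dP a b a0 ab bT abd; rewrite ipNr//.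
  rewrite (gen_sym (generator_sg a0 fg) (generator_sg _ fg')) ?subrr//; lra.
have D := uderivRM (-1) d.
apply/eqP; rewrite eq_le.
have eT : ip (P T f) f' = ip (P T f) (P (T - T) f').
  rewrite subrr ipC// [RHS]ipC//; apply: ip_null => //.
  by rewrite nrmB//; exact: (ssg_id sgP).
have es : t = T - s by rewrite /T addrC addKr.
have sT : s <= T by rewrite lerDl.
rewrite eT {1 2}es.
have := uderivR_nonincreasing d (fun _ _ _ => lexx 0) s0 sT (lexx T).
have := uderivR_nonincreasing D (fun _ _ _ => _) s0 sT (lexx T).
by rewrite mulr0 => /(_ ltac:(by [])) H1 H2; apply/andP; split; lra.
Qed.

End symmetric_semigroup.

Section decay.
Context (R : realType).
Implicit Types u v : R -> R.

(* [u + 2 t v] is nonincreasing on [[0, t]]. *)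
Lemma nonincreasing_primitive_decay u v t : 0 < t ->
  uderivR t u (fun s => - 2 * v s) -> 0 <= u t ->
  (forall s, 0 <= s -> s <= t -> v t <= v s) -> v t <= u 0 / (2 * t).
Proof.
move=> t0 du ut vt.
have := uderivR_nonincreasing (uderivRD du (uderivRM (2 * v t) (uderivR_id _)))
  _ (lexx 0) (ltW t0) (lexx t).
rewrite mulr0 addr0 => /(_ _) H; rewrite ler_pdivlMr ?mulr_gt0//.
suff: u t + 2 * v t * t <= u 0 by lra.
by apply: H => s s0 st /=; rewrite mulr1; have := vt s s0 st; lra.
Qed.

End decay.

(** * Long-time behaviour of orbits and the integrated energy identity *)

Section exponential_decay.
Context (R : realType) (E : lmodType R) (ip : E -> E -> R) (P : R -> E -> E).
Hypothesis ipP : semi_inner ip.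
Local Notation N := (nrm ip).
Hypothesis sgP : seminormed_semigroup N P.
Hypothesis Ncomplete : seminorm_complete N.
Local Notation gen := (generator ip P).
Hypothesis gen_sym : forall f g f' g', gen f g -> gen f' g' -> ip g f' = ip f g'.
Hypothesis gen_le0 : forall f g, gen f g -> ip f g <= 0.
Hypothesis gen_closed : forall (u v : nat -> E) f g,
  (forall k, gen (u k) (v k)) ->
  (forall e, 0 < e -> exists k, forall n, (k <= n)%N -> N (u n - f) < e) ->
  (forall e, 0 < e -> exists k, forall n, (k <= n)%N -> N (v n - g) < e) -> gen f g.
Variable one : E.
Hypothesis one1 : ip one one = 1.
Hypothesis gen_one : forall f g, gen f g -> ip g one = 0.
Hypothesis gen_ker : forall f, gen f 0 -> exists c, N (f - c *: one) = 0.
Variable c : R.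
Hypothesis c0 : 0 <= c.
Hypothesis gen_gap : forall f g, gen f g -> 0 <= ip g g + 2 * c * ip f g.

Section orbit.
Variables f g k : E.
Hypotheses (fg : gen f g) (gk : gen g k).

(** With [g] and [k] the images of [f] under the generator and its square, [q] is the energy of the
    orbit and [r] the squared norm of the generator along it. The element [k] is what makes [q] and
    [r] differentiable. *)
Let p t := ip (P t f) (P t f).
Let q t := - ip (P t f) (P t g).
Let r t := ip (P t g) (P t g).

Let p_deriv T : uderivR T p (fun t => - 2 * q t).
Proof.
have H : uderivR T p (fun t => ip (P t g) (P t f) + ip (P t f) (P t g)).
  by apply: (uderiv_ip ipP); (try exact: orbit_uderiv); exact: orbit_ubnd.
move=> e e0; have [d d0 dP] := H e e0; exists d => // s t s0 st tT tsd.
have -> : - 2 * q s = ip (P s g) (P s f) + ip (P s f) (P s g).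
  by rewrite (ipC ipP (P s g)) /q; ring.
exact: dP.
Qed.

Let q_deriv T : uderivR T q (fun t => - 2 * r t).
Proof.
have H : uderivR T (fun t => ip (P t f) (P t g))
    (fun t => ip (P t g) (P t g) + ip (P t f) (P t k)).
  by apply: (uderiv_ip ipP); (try exact: orbit_uderiv); exact: orbit_ubnd.
have := uderivRM (-1) H.
move=> H' e e0; have [d d0 dP] := H' e e0; exists d => // s t s0 st tT tsd.
have -> : - 2 * r s = -1 * (ip (P s g) (P s g) + ip (P s f) (P s k)).
  rewrite -(gen_sym (generator_sg ipP sgP s0 fg) (generator_sg ipP sgP s0 gk)) /r; ring.
by have := dP s t s0 st tT tsd; rewrite !mulN1r.
Qed.

Let r_deriv T : uderivR T r (fun t => 2 * ip (P t g) (P t k)).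
Proof.
have H : uderivR T r (fun t => ip (P t k) (P t g) + ip (P t g) (P t k)).
  by apply: (uderiv_ip ipP); (try exact: orbit_uderiv); exact: orbit_ubnd.
move=> e e0; have [d d0 dP] := H e e0; exists d => // s t s0 st tT tsd.
have -> : 2 * ip (P s g) (P s k) = ip (P s k) (P s g) + ip (P s g) (P s k).
  by rewrite (ipC ipP (P s k)); ring.
exact: dP.
Qed.

Let p0 t : 0 <= p t. Proof. exact: ip_ge0. Qed.
Let r0 t : 0 <= r t. Proof. exact: ip_ge0. Qed.
Let q0 t : 0 <= t -> 0 <= q t.
Proof. by move=> t0; rewrite oppr_ge0; apply: gen_le0; exact: generator_sg. Qed.

Let p_noninc s t : 0 <= s -> s <= t -> p t <= p s.
Proof.
move=> s0 st; apply: (uderivR_nonincreasing (p_deriv t) _ s0 st (lexx t)).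
by move=> a a0 _; rewrite mulNr oppr_le0 mulr_ge0// q0.
Qed.

Let q_noninc s t : 0 <= s -> s <= t -> q t <= q s.
Proof.
move=> s0 st; apply: (uderivR_nonincreasing (q_deriv t) _ s0 st (lexx t)).
by move=> a a0 _; rewrite mulNr oppr_le0 mulr_ge0.
Qed.

Let r_noninc s t : 0 <= s -> s <= t -> r t <= r s.
Proof.
move=> s0 st; apply: (uderivR_nonincreasing (r_deriv t) _ s0 st (lexx t)).
by move=> a a0 _; rewrite pmulr_rle0//; apply: gen_le0; exact: generator_sg.
Qed.

Let q_decay t : 0 < t -> q t <= p 0 / (2 * t).
Proof.
by move=> t0; apply: (nonincreasing_primitive_decay t0 (p_deriv t)) => // s *; exact: q_noninc.
Qed.

(** Thus the generator tends to 0 along the orbit, which puts any limit of the orbit in its kernel,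
    by closedness. *)
Let r_decay t : 0 < t -> r t <= q 0 / (2 * t).
Proof.
by move=> t0; apply: (nonincreasing_primitive_decay t0 (q_deriv t));
  [apply: q0; exact: ltW|move=> s *; exact: r_noninc].
Qed.

Let decay_lt (C e : R) : 0 < e -> exists K : nat, forall t : R, K%:R <= t -> 0 < t /\ C / (2 * t) < e.
Proof.
move=> e0; exists (Num.truncn (`|C| / (2 * e))).+1 => t tK.
have C0 : 0 <= `|C| / (2 * e) by rewrite divr_ge0// mulr_ge0// ltW.
have t0 : 0 < t by apply: lt_le_trans tK; rewrite ltr0n.
have := lt_le_trans (truncnS_gt (`|C| / (2 * e))) tK.
rewrite !ltr_pdivrMr ?mulr_gt0// => H; split=> //.
by rewrite (le_lt_trans (ler_norm C))//; lra.
Qed.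

Let p_lim : exists2 l : R, 0 <= l & (forall t : R, 0 <= t -> l <= p t) /\
  forall e : R, 0 < e -> exists K : nat, forall t : R, K%:R <= t -> p t < l + e.
Proof.
pose A := [set p t | t in [set t | 0 <= t]].
have A0 : has_inf A.
  by split; [exists (p 0); exists 0 => //=|exists 0 => _ [t _ <-]].
exists (inf A); first by apply: lb_le_inf => [|_ [t _ <-]//]; case: A0.
split=> [t t0|e e0]; first by apply: ge_inf; [case: A0|exists t].
have [_ [s s0 <-] pse] := inf_adherent e0 A0.
exists (Num.truncn s).+1 => t st; apply: le_lt_trans pse; apply: p_noninc => //.
by apply: le_trans st; rewrite ltW// truncnS_gt.
Qed.

(** The derivative of [<P s f, one>] is [<P s g, one>], and the range of the generator is orthogonal
    to [one]. This identifies the constant to which the orbit converges. *)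
Let mean_cst n : ip (P n%:R f) one = ip f one.
Proof.
have one_bnd : ubnd ip n%:R (fun=> one).
  by exists (N one + 1) => *; rewrite ?lerDl// ltr_wpDl// nrm_ge0.
have z_bnd : ubnd ip n%:R (fun=> 0 : E).
  by exists 1 => // *; rewrite nrm0.
have one_der : uderiv ip n%:R (fun=> one) (fun=> 0).
  by move=> e e0; exists 1 => // s t s0 st _ _; rewrite subrr scaler0 subrr nrm0// mulr_ge0//; lra.
have D := uderiv_ip ipP (@orbit_uderiv _ _ _ _ ipP sgP Ncomplete n%:R _ _ fg) one_der
  (orbit_ubnd ipP sgP Ncomplete _ _) one_bnd (orbit_ubnd ipP sgP Ncomplete _ _) z_bnd.
have g1 s : 0 <= s -> ip (P s g) one = 0.
  by move=> s0; apply: (gen_one (f := P s f)); exact: generator_sg.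
have H1 : ip (P n%:R f) one <= ip (P 0 f) one.
  apply: (uderivR_nonincreasing D _ (lexx 0) _ (lexx _)) => // s s0 _.
  by rewrite g1// (ipC ipP) ip0l// addr0.
have H2 : - 1 * ip (P n%:R f) one <= - 1 * ip (P 0 f) one.
  apply: (uderivR_nonincreasing (uderivRM (-1) D) _ (lexx 0) _ (lexx _)) => // s s0 _.
  by rewrite g1// (ipC ipP) ip0l// addr0 mulr0.
rewrite -(ip_null ipP one (ssg_id sgP f)); apply/eqP; rewrite eq_le; apply/andP; split; lra.
Qed.

Let p_cvg (e : R) : 0 < e -> exists K : nat, forall t : R, K%:R <= t ->
  `|p t - ip f one ^+ 2| < e.
Proof.
have [l l0 [lp pl]] := p_lim.
have [h hP] : exists h, forall e, 0 < e -> exists n0, forall n, (n0 <= n)%N -> N (P n%:R f - h) < e.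
  apply: (Ncomplete (u := fun n => P n%:R f)) => e' e'0.
  have e2 : 0 < e' ^+ 2 / 2 by rewrite divr_gt0// exprn_gt0.
  have [K KP] := pl _ e2; exists K => m n Km Kn.
  rewrite -(@ltr_pXn2r _ 2)// ?nnegrE ?nrm_ge0 ?(ltW e'0)//.
  rewrite sqr_nrm// !(ipBl ipP, ipBr ipP) (ipC ipP (P n%:R f) (P m%:R f)).
  (* By symmetry the squared distance is [p m + p n - 2 p ((m + n) / 2)], and all three values lie
     in [[l, l + e'^2 / 2)] or above [l], whence a Cauchy sequence. *)
  pose s : R := (m%:R + n%:R) / 2.
  have s0 : 0 <= s by rewrite divr_ge0// addr_ge0.
  have -> : ip (P m%:R f) (P n%:R f) = p s.
    rewrite (sg_symmetric ipP sgP Ncomplete gen_sym fg fg)// /p.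
    by rewrite (sg_symmetric ipP sgP Ncomplete gen_sym fg fg)// -splitr.
  have := lp s s0; have := KP m%:R; have := KP n%:R; rewrite !ler_nat.
  rewrite -/(p m%:R) -/(p n%:R) => /(_ Kn) ? /(_ Km) ?; lra.
have h0 : gen h 0.
  apply: (gen_closed (u := fun n => P n%:R f) (v := fun n => P n%:R g)) => //.
    by move=> n; exact: generator_sg.
  move=> e' e'0; have [K KP] := decay_lt (q 0) (exprn_gt0 2 e'0).
  exists K => n Kn; rewrite subr0.
  rewrite -(@ltr_pXn2r _ 2)// ?nnegrE ?nrm_ge0 ?(ltW e'0)// sqr_nrm//.
  have [n0 +] := KP n%:R ltac:(by rewrite ler_nat).
  by apply: le_lt_trans; exact: r_decay.
have [a ha] := gen_ker h0.
have ha' : N h = `|a|.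
  by rewrite (nrm_null ipP ha) nrmZ// /nrm one1 sqrtr1 mulr1.
have fa : ip f one = a.
  have -> : a = ip h one by rewrite (ip_null ipP _ ha) ipZl// one1 mulr1.
  apply/eqP; rewrite -subr_eq0 -normr_le0; apply/ler_addgt0Pr => e' e'0; rewrite add0r.
  have [K /(_ K (leqnn K)) KP] := hP e' e'0.
  rewrite -(mean_cst K) -ipBl// (le_trans (ip_le ipP _ _))//.
  by rewrite {2}/nrm one1 sqrtr1 mulr1 ltW.
have la : l = a ^+ 2.
  apply/eqP; rewrite -subr_eq0 -normr_le0; apply/ler_addgt0Pr => e' e'0; rewrite add0r.
  have e2 : 0 < e' / 2 by lra.
  (* Chosen for [y^2 - b^2 = (y - b)(y + b)] with [b] the absolute value of [a]: when [y] and [b]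
     differ by less than 1, the second factor is at most [2 b + 1]. *)
  have e3 : 0 < Num.min 1 (e' / 2 / (2 * `|a| + 1)).
    by rewrite lt_min ltr01 divr_gt0// ltr_wpDl// mulr_ge0.
  have [K1 KP1] := pl _ e2; have [K2 KP2] := hP _ e3.
  pose K := maxn K1 K2; have pK : p K%:R = N (P K%:R f) ^+ 2 by rewrite sqr_nrm.
  have := KP1 K%:R; rewrite ler_nat => /(_ (leq_maxl _ _)).
  have := lp K%:R (ler0n _ _); rewrite pK => ly yl.
  have := le_lt_trans (nrm_le_gap ipP (P K%:R f) h) (KP2 K (leq_maxr _ _)).
  rewrite ha' lt_min ltr_pdivlMr ?ltr_wpDl// ?mulr_ge0// => /andP[H1 H2].
  have := nrm_ge0 ip (P K%:R f); set y := N (P K%:R f) in ly yl H1 H2 * => y0.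
  have -> : a ^+ 2 = `|a| ^+ 2 by rewrite real_normK ?num_real.
  have := normr_ge0 a; set b := `|a| in H1 H2 * => b0.
  have H : `|y ^+ 2 - b ^+ 2| <= e' / 2.
    have -> : y ^+ 2 - b ^+ 2 = (y - b) * (y + b) by ring.
    rewrite normrM (@ger0_norm _ (y + b)) ?addr_ge0//.
    apply: le_trans (ltW H2); rewrite ler_wpM2l//.
    by have := ler_norm (y - b); lra.
  by move: H; rewrite !ler_norml => /andP[? ?]; apply/andP; split; lra.
rewrite fa -la => e0; have [K KP] := pl e e0; exists K => t Kt.
have t0 : 0 <= t by apply: le_trans Kt.
by rewrite ger0_norm ?subr_ge0 ?lp//; have := KP t Kt; lra.
Qed.

(** The integrand is the derivative of [c p - q / 2] and is nonnegative by [gen_gap], so the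
    fundamental theorem holds on the whole half-line; at infinity [q] vanishes and [p] tends to the
    square of the mean. *)
Theorem semigroup_energy_identity :
  (\int[lebesgue_measure]_(t in `[0%R, +oo[)
    (ip (P t g) (P t g) + 2 * c * ip (P t f) (P t g))%:E =
  (- ip f g / 2 - c * (ip f f - ip f one ^+ 2))%:E)%E.
Proof.
pose Fi t := c * p t + - 2^-1 * q t.
have Fi_deriv T : uderivR T Fi (fun t => r t + 2 * c * - q t).
  have H := uderivRD (uderivRM c (@p_deriv T)) (uderivRM (- 2^-1) (@q_deriv T)).
  move=> e e0; have [d d0 dP] := H e e0; exists d => // s t s0 st tT tsd.
  have -> : r s + 2 * c * - q s = c * (- 2 * q s) + - 2^-1 * (- 2 * r s) by field.
  exact: dP.
have f_cont T : ucontR T (fun t => r t + 2 * c * - q t).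
  apply: ucontRD; first by apply: (ucont_ip ipP); (try exact: orbit_ucont); exact: orbit_ubnd.
  apply: ucontRM; rewrite /q; under eq_fun do rewrite opprK.
  by apply: (ucont_ip ipP); (try exact: orbit_ucont); exact: orbit_ubnd.
have Fi_is_derive (t : R) : 0 < t -> is_derive t 1 Fi (r t + 2 * c * - q t).
  by move=> t0; apply: (uderivR_is_derive (Fi_deriv (t + 1)) (f_cont (t + 1))) => //; rewrite ltrDl.
have Fi_cont : {within `[0, +oo[, continuous Fi}.
  apply: ucontR_continuous => T; apply: ucontRD; apply: ucontRM.
    by apply: (ucont_ip ipP); (try exact: orbit_ucont); exact: orbit_ubnd.
  have := ucontRM (-1) (ucont_ip ipP (@orbit_ucont _ _ _ _ ipP sgP Ncomplete T f)
    (@orbit_ucont _ _ _ _ ipP sgP Ncomplete T g) (orbit_ubnd ipP sgP Ncomplete _ _)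
    (orbit_ubnd ipP sgP Ncomplete _ _)).
  by congr ucontR; apply/funext => t; rewrite mulN1r.
rewrite (@ge0_continuous_FTC2y _ _ Fi 0 (c * ip f one ^+ 2)).
- rewrite -EFinB; congr EFin; rewrite /Fi /p /q.
  have E1 h : ip (P 0 f) h = ip f h := ip_null ipP h (ssg_id sgP f).
  have E2 h : ip h (P 0 f) = ip h f by rewrite (ipC ipP) E1 (ipC ipP).
  have E3 h : ip h (P 0 g) = ip h g.
    by rewrite (ipC ipP) (ip_null ipP h (ssg_id sgP g)) (ipC ipP).
  by rewrite !E1 E2 E3; lra.
- by move=> t t0; apply: gen_gap; exact: generator_sg.
- rewrite (_ : (fun t => _) = (fun t => r t + 2 * c * - q t)).
    exact: ucontR_continuous.
  by apply/funext => t; rewrite /q opprK.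
- rewrite -[c * _]addr0 -[in X in _ --> X](mulr0 (- 2^-1)).
  apply: cvgD; apply: cvgMr.
    apply/cvgrPdist_lt => e e0; have [K KP] := p_cvg e0.
    by near=> t; rewrite distrC; apply: KP; near: t; exact: nbhs_pinfty_ge.
  apply/cvgrPdist_lt => e e0; have [K KP] := decay_lt (p 0) e0.
  near=> t; have Kt : K%:R <= t by near: t; exact: nbhs_pinfty_ge.
  have [t0 te] := KP t Kt.
  by rewrite sub0r normrN ger0_norm ?q0 ?ltW// (le_lt_trans (q_decay t0)).
- by move=> t /Fi_is_derive [].
- by move/continuous_within_itvcyP : Fi_cont => [].
- move=> t; rewrite in_itv/= andbT => /Fi_is_derive H.
  by rewrite derive1E derive_val /q opprK.
Unshelve. all: by end_near. Qed.

End orbit.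
End exponential_decay.

(** * Square integrable functions *)

Section L2_space.
Context d (T : measurableType d) (R : realType) (mu : {measure set T -> \bar R}).
Notation L2 := (LfunType mu (lee1n 2 : (1 <= 2%:E)%E)).
Implicit Types f g : T -> R.

Lemma L2normE f : L2norm mu f = ((\int[mu]_x (f x ^+ 2)%:E) `^ 2^-1)%E.
Proof.
rewrite /L2norm unlock; congr (_ `^ _)%E; apply: eq_integral => x _ /=.
by rewrite ?poweR_EFin powR_mulrn// real_normK ?num_real.
Qed.

Lemma Lfun2P f : f \in Lfun mu 2%:E <->
  measurable_fun setT f /\ mu.-integrable setT (EFin \o (fun x => f x ^+ 2)).
Proof.
split=> [lf|[mf /integrableP[_ fy]]].
  split; last exact: Lfun2_integrable_sqr.
  by move: lf; rewrite inE => /andP[]; rewrite inE.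
rewrite inE; apply/andP; split; rewrite inE//=.
rewrite /finite_norm -[X in (X < _)%E]/(L2norm mu f) L2normE poweR_lty//.
apply: le_lt_trans fy; rewrite le_eqVlt; apply/orP; left; apply/eqP.
by apply: eq_integral => x _; rewrite /= ger0_norm// sqr_ge0.
Qed.

Lemma Lfun2_integrableM f g : f \in Lfun mu 2%:E -> g \in Lfun mu 2%:E ->
  mu.-integrable setT (EFin \o (fun x => f x * g x)).
Proof. by move=> lf lg; apply/Lfun1_integrable; exact: Lfun2_mul_Lfun1. Qed.

Definition ipL2 (f g : T -> R) : R := \int[mu]_x (f x * g x).

Lemma L2norm_Lfun f : f \in Lfun mu 2%:E -> L2norm mu f = (Num.sqrt (ipL2 f f))%:E.
Proof.
move=> lf; rewrite L2normE /ipL2.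
have -> : (\int[mu]_x (f x ^+ 2)%:E = (\int[mu]_x (f x * f x))%:E)%E.
  rewrite /Rintegral fineK; first by apply: eq_integral => x _; rewrite expr2.
  exact: (integrable_fin_num _ (Lfun2_integrableM lf lf)).
rewrite poweR_EFin powR12_sqrt//.
by apply: Rintegral_ge0 => x _; rewrite -expr2 sqr_ge0.
Qed.

Definition L2_of f (lf : f \in Lfun mu 2%:E) : L2 := Lfun_Sub _ lf.

Lemma semi_inner_L2 : semi_inner (fun f g : L2 => ipL2 f g).
Proof.
split=> [f g|a f g h|f].
- by apply: eq_Rintegral => x _; rewrite mulrC.
- rewrite /ipL2 -RintegralZl//; last exact: (Lfun2_integrableM (LfunP f) (LfunP h)).
  rewrite -RintegralD//.
  + by apply: eq_Rintegral => x _; rewrite mulrDl mulrA.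
  + have := Lfun2_integrableM (LfunP f) (LfunP h) => /(integrableZl measurableT a).
    by [].
  + exact: (Lfun2_integrableM (LfunP g) (LfunP h)).
- by apply: Rintegral_ge0 => x _; rewrite -expr2 sqr_ge0.
Qed.

Lemma nrm_L2 (f : L2) : (nrm (fun f g : L2 => ipL2 f g) f)%:E = L2norm mu f.
Proof. by rewrite L2norm_Lfun//; exact: LfunP. Qed.

Let ipP := semi_inner_L2.
Notation N := (nrm (fun f g : L2 => ipL2 f g)).

Let limn_einf_le (u : (\bar R)^nat) (C : \bar R) :
  (forall k, (u k <= C)%E) -> (limn_einf u <= C)%E.
Proof.
move=> uC; rewrite limn_einf_lim; apply: lime_le; first exact: is_cvg_einfs.
near=> k; apply: le_trans (uC k); apply: ereal_inf_lbound; exists k => //=.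
Unshelve. all: by end_near. Qed.

Lemma L2_sqr (f : L2) : (\int[mu]_x (f x ^+ 2)%:E = (N f ^+ 2)%:E)%E.
Proof.
rewrite sqr_nrm// /ipL2 /Rintegral fineK; last first.
  exact: (integrable_fin_num _ (Lfun2_integrableM (LfunP f) (LfunP f))).
by apply: eq_integral => x _; rewrite expr2.
Qed.

(* A fast Cauchy sequence converges almost everywhere, because the sum of
   [2 ^ j * (v j.+1 - v j) ^ 2] is integrable. *)
Lemma fast_cauchy_cvg_ae (v : nat -> L2) :
  (forall j, N (v j.+1 - v j) <= 2^-1 ^+ j.+1) ->
  {ae mu, forall x, cvgn (fun j => v j x)}.
Proof.
move=> vv.
pose a j x : R := v j.+1 x - v j x.
pose F j x : \bar R := (2 ^+ j * a j x ^+ 2)%:E.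
have ma j : measurable_fun setT (a j).
  by apply: measurable_funB; [have /Lfun2P[] := LfunP (v j.+1)|have /Lfun2P[] := LfunP (v j)].
have mF j : measurable_fun setT (F j).
  by apply/measurable_EFinP; apply: measurable_funM => //; exact: measurable_funX.
have ma2 j : measurable_fun setT (fun x => (a j x ^+ 2)%:E).
  by apply/measurable_EFinP; exact: measurable_funX.
have F0 j x : (0 <= F j x)%E.
  by rewrite /F lee_fin; exact: mulr_ge0 (exprn_ge0 _ (ler0n _ _)) (sqr_ge0 _).
(* The weight [2 ^ j] only costs part of the decay [4 ^ - (j + 1)] of the squared norms, and the
   remaining bound is summable. *)
have iF j : (\int[mu]_x F j x <= (1 / (2 ^ j.+1)%:R)%:E)%E.
  rewrite /F; under eq_integral do rewrite EFinM.
  rewrite ge0_integralZl//; last by move=> x _; rewrite lee_fin sqr_ge0.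
  rewrite (L2_sqr (v j.+1 - v j)) -EFinM lee_fin.
  have n0 := nrm_ge0 (fun f g : L2 => ipL2 f g) (v j.+1 - v j).
  have h0 : 0 <= (2^-1 : R) ^+ j.+1 by rewrite exprn_ge0.
  have H : N (v j.+1 - v j) ^+ 2 <= (2^-1 ^+ j.+1) ^+ 2.
    by rewrite ler_pXn2r// nnegrE.
  apply: (le_trans (ler_wpM2l (exprn_ge0 j (ler0n R 2)) H)).
  rewrite div1r natrX -[in X in _ <= X]exprVn expr2 mulrA ler_piMl//.
  have -> : (2 : R) ^+ j * 2^-1 ^+ j.+1 = 2^-1.
    by rewrite exprS mulrCA -exprMn divff ?pnatr_eq0// expr1n mulr1.
  by rewrite invf_le1// ler1n.
have iS : (\int[mu]_x (\sum_(j <oo) F j x) < +oo)%E.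
  rewrite integral_nneseries//.
  apply: (@le_lt_trans _ _ (\sum_(j <oo) (1 / (2 ^ j.+1)%:R : R)%:E)%E).
    by apply: lee_nneseries => [j _ _|j _]; [exact: integral_ge0|exact: iF].
  by apply: (le_lt_trans (epsilon_trick0 xpredT (@ler01 R))); rewrite ltry.
have SI : mu.-integrable setT (fun x => \sum_(j <oo) F j x)%E.
  apply/integrableP; split.
    by apply: ge0_emeasurable_sum => // j x _ _.
  apply: le_lt_trans iS; rewrite le_eqVlt; apply/orP; left; apply/eqP.
  by apply: eq_integral => x _; rewrite gee0_abs// nneseries_ge0.
apply: filterS (integrable_ae measurableT SI) => x /(_ I) Sfin.
have Sx J : \sum_(0 <= j < J) 2 ^+ j * a j x ^+ 2 <= fine (\sum_(j <oo) F j x)%E.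
  rewrite -lee_fin fineK; last exact: Sfin.
  rewrite -sumEFin.
  exact: (@nneseries_lim_ge _ (fun j => F j x) xpredT 0 J (fun j _ _ => F0 j x)).
have acvg : cvgn [normed series (fun j => a j x)].
  apply: nondecreasing_is_cvgn.
    apply: nondecreasing_series => j _ _; exact: normr_ge0.
  (* By the arithmetic-geometric inequality, the [j]-th increment is at most [2 ^ - j + F j x] in
     absolute value, and the geometric series sums to at most 2. *)
  exists (2 + fine (\sum_(j <oo) F j x)%E) => _ [J _ <-].
  apply: (@le_trans _ _ (\sum_(0 <= j < J) (2^-1 ^+ j + 2 ^+ j * a j x ^+ 2))).
    apply: ler_sum => j _.
    have p0 : 0 < (2 : R) ^+ j by rewrite exprn_gt0.
    rewrite exprVn -[a j x ^+ 2]real_normK ?num_real//.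
    have y0 := normr_ge0 (a j x); set y := `|a j x| in y0 *.
    have H : 2 * y <= (2 ^+ j)^-1 + 2 ^+ j * y ^+ 2.
      rewrite -subr_ge0 (_ : _ - _ = (2 ^+ j)^-1 * (1 - 2 ^+ j * y) ^+ 2).
        by rewrite mulr_ge0 ?sqr_ge0// invr_ge0 ltW.
      by field; rewrite gt_eqF.
    by apply: le_trans H; apply: (ler_peMl y0); rewrite ler1n.
  rewrite big_split /= lerD//.
  have -> : \sum_(0 <= j < J) (2^-1 : R) ^+ j = 2 - 2 * 2^-1 ^+ J.
    elim: J => [|J IH]; first by rewrite big_geq// expr0; lra.
    by rewrite big_nat_recr//= IH exprS; lra.
  by rewrite gerBl mulr_ge0// exprn_ge0.
have := normed_cvg acvg.
have -> : series (fun j => a j x) = fun J => v J x - v 0%N x.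
  apply/funext => J; rewrite seriesEnat/=; exact: (telescope_sumr (fun j => v j x) (leq0n J)).
move=> H; have : cvgn (fun J => (v J x - v 0%N x) + v 0%N x).
  by apply: is_cvgD => //; exact: is_cvg_cst.
by under eq_fun do rewrite subrK.
Qed.

Lemma fast_cauchy_le (v : nat -> L2) :
  (forall j, N (v j.+1 - v j) <= 2^-1 ^+ j.+1) ->
  forall m j, N (v m - v (m + j)%N) <= 2^-1 ^+ m.
Proof.
move=> vv m j.
suff H : N (v m - v (m + j)%N) <= 2^-1 ^+ m - 2^-1 ^+ (m + j).
  by apply: le_trans H _; rewrite gerBl exprn_ge0.
elim: j => [|j IH]; first by rewrite addn0 !subrr nrm0.
apply: le_trans (nrm_tri ipP (v (m + j)%N) _ _) _.
have := vv (m + j)%N; rewrite (nrmB ipP (v _.+1)) addnS exprS.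
move: IH; move: (N _) (N _) (_ ^+ _) (_ ^+ _) => a b x y; lra.
Qed.

(** Fatou's lemma bounds the distance from [v m] to the pointwise limit by the limit inferior of its
    distances to the later terms. *)
Lemma fast_cauchy_cvg (v : nat -> L2) :
  (forall j, N (v j.+1 - v j) <= 2^-1 ^+ j.+1) ->
  exists h : L2, forall m, N (v m - h) <= 2^-1 ^+ m.
Proof.
move=> vv.
have mv j : measurable_fun setT (v j) by have /Lfun2P[] := LfunP (v j).
(* The upper limit is measurable everywhere; it agrees with the limit almost everywhere, and [fine]
   makes it real on the remaining null set. *)
pose h x := fine (limn_esup (fun j => (v j x)%:E)).
have mh : measurable_fun setT h.
  apply: (@measurableT_comp _ _ _ _ _ _ fine) => //.
  apply: measurable_fun_limn_esup => j.
  by apply/measurable_EFinP.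
have vh : {ae mu, forall x, v j x @[j --> \oo] --> h x}.
  apply: filterS (fast_cauchy_cvg_ae vv) => x cx.
  have H : (v j x)%:E @[j --> \oo] --> (limn (fun j => v j x))%:E.
    by apply: cvg_EFin => //; exact: nearW.
  rewrite /h (is_cvg_limn_esupE _); last by apply/cvg_ex; eexists; exact: H.
  by rewrite (cvg_lim _ H).
have D m : (\int[mu]_x ((v m x - h x) ^+ 2)%:E <= ((2^-1 ^+ m) ^+ 2)%:E)%E.
  pose g j x : \bar R := ((v m x - v (m + j)%N x) ^+ 2)%:E.
  have mg j : measurable_fun setT (g j).
    apply/measurable_EFinP; apply: measurable_funX; exact: measurable_funB.
  have -> : (\int[mu]_x ((v m x - h x) ^+ 2)%:E = \int[mu]_x (limn_einf (g^~ x)))%E.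
    apply: ae_eq_integral => //.
    - apply/measurable_EFinP; apply: measurable_funX; exact: measurable_funB.
    - apply: measurableT_comp => //; apply: measurable_fun_limn_esup => j.
      exact: measurableT_comp.
    - apply: filterS vh => x cx _.
      have cxm : v (m + j)%N x @[j --> \oo] --> h x.
        have : v (j + m)%N x @[j --> \oo] --> h x by rewrite (cvg_shiftn m (fun j => v j x)).
        by under eq_fun do rewrite addnC.
      have H : g j x @[j --> \oo] --> ((v m x - h x) ^+ 2)%:E.
        apply: cvg_EFin; first exact: nearW.
        rewrite /g /comp/=; apply: (@cvg_comp _ _ _ _ (fun y : R => y ^+ 2)).
          by apply: cvgB; [exact: cvg_cst|exact: cxm].
        exact: exprn_continuous.
      rewrite (is_cvg_limn_einfE _); last by apply/cvg_ex; eexists; exact: H.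
      by rewrite (cvg_lim _ H).
  apply: le_trans (fatou mu measurableT mg _) _.
    by move=> j x _; rewrite lee_fin sqr_ge0.
  apply: limn_einf_le => j; rewrite (L2_sqr (v m - v (m + j)%N)) lee_fin.
  by rewrite ler_pXn2r// ?nnegrE ?nrm_ge0 ?exprn_ge0//; exact: fast_cauchy_le.
have lvh : (fun x => v 0%N x - h x) \in Lfun mu 2%:E.
  apply/Lfun2P; split; first exact: measurable_funB.
  apply/integrableP; split.
    apply/measurable_EFinP; apply: measurable_funX; exact: measurable_funB.
  apply: le_lt_trans (ltry ((2^-1 ^+ 0) ^+ 2)); apply: le_trans (D 0%N).
  rewrite le_eqVlt; apply/orP; left; apply/eqP.
  by apply: eq_integral => x _; rewrite /= ger0_norm// sqr_ge0.
(* Fatou shows that [v 0 - h] is square integrable; [h] is then recovered as an element of the space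
   by subtracting it from [v 0]. *)
exists (v 0%N - L2_of lvh) => m.
rewrite -(@ler_pXn2r _ 2)// ?nnegrE ?nrm_ge0 ?exprn_ge0//.
rewrite -lee_fin -L2_sqr; apply: le_trans (D m).
rewrite le_eqVlt; apply/orP; left; apply/eqP.
apply: eq_integral => x _; congr ((_ ^+ 2)%:E).
change (v m x - (v 0%N x - (v 0%N x - h x)) = v m x - h x).
by rewrite subKr.
Qed.

Lemma L2_complete : seminorm_complete N.
Proof.
move=> u uC.
have /choice[K KP] j : exists k, forall m n, (k <= m)%N -> (k <= n)%N ->
    N (u m - u n) < 2^-1 ^+ j.+1 by apply: uC; rewrite exprn_gt0.
pose M := fix M j := if j is i.+1 then maxn (M i) (K i.+1) else K 0%N.
have KM j : (K j <= M j)%N by case: j => //= j; exact: leq_maxr.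
have [|h hP] := @fast_cauchy_cvg (fun j => u (M j)).
  move=> j; apply: ltW; apply: (KP j (M j.+1) (M j) _ (KM j)).
  exact: leq_trans (KM j) (leq_maxl _ _).
exists h => e e0.
have [k kP] : exists k, 2^-1 ^+ k < e / 2.
  have e2 : 0 < e / 2 by lra.
  have : (2^-1 : R) ^+ n @[n --> \oo] --> 0.
    by apply: cvg_expr; rewrite ger0_norm ?invr_ge0// invf_lt1// ltr1n.
  move=> /cvgrPdist_lt /(_ _ e2)[k _ /(_ k (leqnn k))] /=.
  by rewrite sub0r normrN ger0_norm ?exprn_ge0//; exists k.
exists (M k) => n Mn; apply: le_lt_trans (nrm_tri ipP (u (M k)) _ _) _.
have := hP k; have := KP k n (M k) (leq_trans (KM k) Mn) (KM k).
rewrite exprS; move: kP.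
move: (N _) (N _) (_ ^+ _) => a b x; lra.
Qed.

End L2_space.

(** * Closure of the operator on test functions *)

Section closure.
Context (R : realType) (E : lmodType R) (ip : E -> E -> R).
Hypothesis ipP : semi_inner ip.
Local Notation N := (nrm ip).

Definition nrm_cvg (u : nat -> E) (f : E) := N (u k - f) @[k --> \oo] --> 0.

Lemma nrm_cvgP u f : nrm_cvg u f <->
  forall e, 0 < e -> exists k, forall n, (k <= n)%N -> N (u n - f) < e.
Proof.
split=> [/cvgrPdist_lt H e /H[k _ kP]|H].
  by exists k => n /kP /=; rewrite sub0r normrN ger0_norm// nrm_ge0.
apply/cvgrPdist_lt => e /H[k kP]; exists k => // n /= /kP.
by rewrite sub0r normrN ger0_norm// nrm_ge0.
Qed.

Lemma ip_cvg u v f g : nrm_cvg u f -> nrm_cvg v g ->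
  ip (u k) (v k) @[k --> \oo] --> ip f g.
Proof.
move=> uf vg.
pose b k := N (u k - f) * N (v k - g) + N (u k - f) * N g + N f * N (v k - g).
have b0 : b k @[k --> \oo] --> 0.
  rewrite [X in _ --> X](_ : 0 = 0 * 0 + 0 * N g + N f * 0); last by lra.
  apply: cvgD; first (apply: cvgD; first exact: cvgM).
    by apply: cvgM => //; exact: cvg_cst.
  by apply: cvgM => //; exact: cvg_cst.
rewrite -[X in _ --> X](addr0 (ip f g)).
have -> : (fun k => ip (u k) (v k)) = fun k => ip f g + (ip (u k) (v k) - ip f g).
  by apply/funext => k; rewrite subrKC.
apply: cvgD; first exact: cvg_cst.
apply: (@squeeze_cvgr _ _ _ _ (fun k => - b k) b) => //; last first.
  by rewrite -oppr0; exact: cvgN.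
apply: nearW => k; rewrite -ler_norml.
have -> : ip (u k) (v k) - ip f g =
    ip (u k - f) (v k - g) + ip (u k - f) g + ip f (v k - g).
  by rewrite !(ipBl ipP, ipBr ipP); lra.
apply: le_trans (ler_normD _ _) _; apply: lerD; last exact: ip_le.
by apply: le_trans (ler_normD _ _) _; apply: lerD; exact: ip_le.
Qed.

Lemma nrm_cvg_cst f : nrm_cvg (fun=> f) f.
Proof. by rewrite /nrm_cvg subrr nrm0//; exact: cvg_cst. Qed.

Lemma nrm_cvg_cauchy u f : nrm_cvg u f -> forall e, 0 < e ->
  exists k, forall m n, (k <= m)%N -> (k <= n)%N -> N (u m - u n) < e.
Proof.
move=> /nrm_cvgP H e e0; have [|k kP] := H (e / 2); first lra.
exists k => m n km kn; apply: le_lt_trans (nrm_tri ipP f _ _) _.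
by rewrite (nrmB ipP f); have := kP m km; have := kP n kn; lra.
Qed.

Definition graph_closure (A : E -> E -> Prop) (f g : E) := exists u v : nat -> E,
  [/\ forall k, A (u k) (v k), nrm_cvg u f & nrm_cvg v g].

(** Diagonal choice: the [k]-th pair is approximated within [1/(k+1)] by a pair of [A]. *)
Lemma graph_closure_closed A (u v : nat -> E) f g :
  (forall k, graph_closure A (u k) (v k)) -> nrm_cvg u f -> nrm_cvg v g ->
  graph_closure A f g.
Proof.
move=> uvA uf vg.
have /choice[w wP] k : exists w : E * E, [/\ A w.1 w.2, N (w.1 - u k) < k.+1%:R^-1 &
    N (w.2 - v k) < k.+1%:R^-1].
  have [u' [v' [A' /nrm_cvgP uu /nrm_cvgP vv]]] := uvA k.
  have k0 : 0 < (k.+1%:R^-1 : R) by rewrite invr_gt0.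
  have [a aP] := uu _ k0; have [b bP] := vv _ k0.
  exists (u' (maxn a b), v' (maxn a b)); split => //=.
    by apply: aP; exact: leq_maxl.
  by apply: bP; exact: leq_maxr.
exists (fun k => (w k).1), (fun k => (w k).2).
have H (z z' : nat -> E) h : (forall k, N (z k - z' k) < k.+1%:R^-1) ->
    nrm_cvg z' h -> nrm_cvg z h.
  move=> zz zh; apply: (@squeeze_cvgr _ _ _ _ (cst 0) (fun k => harmonic k + N (z' k - h))).
  - apply: nearW => k; rewrite nrm_ge0 /=; apply: le_trans (nrm_tri ipP (z' k) _ _) _.
    by rewrite lerD2r ltW.
  - exact: cvg_cst.
  - by rewrite -[X in _ --> X](addr0 0); apply: cvgD => //; exact: cvg_harmonic.
split.
- by move=> k; have [] := wP k.
- by apply: (H _ u) => // k; have [] := wP k.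
- by apply: (H _ v) => // k; have [] := wP k.
Qed.

End closure.

Lemma right_cvg0P (R : realType) (h : R -> R) : (forall t, 0 <= h t) ->
  h t @[t --> 0^'+] --> 0 <->
  forall e, 0 < e -> exists2 d, 0 < d & forall t, 0 < t -> t < d -> h t < e.
Proof.
move=> h0; split=> [/cvgrPdist_lt H e /H[d /= d0 dP]|H].
  exists d => // t t0 td; have /= := dP t; rewrite sub0r normrN gtr0_norm//.
  by rewrite sub0r normrN (ger0_norm (h0 t)) => ->.
apply/cvgrPdist_lt => e /H[d d0 dP]; exists d => // t /=.
rewrite sub0r normrN => td t0; rewrite sub0r normrN (ger0_norm (h0 t)).
by apply: dP => //; rewrite -(gtr0_norm t0).
Qed.

(** * From functions and almost everywhere equality to the seminormed space *)

Section L2_bridge.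
Context d (T : measurableType d) (R : realType) (mu : {measure set T -> \bar R}).
Notation L2 := (LfunType mu (lee1n 2 : (1 <= 2%:E)%E)).
Local Notation ip := (fun f g : L2 => ipL2 mu f g).
Local Notation N := (nrm ip).
Let ipP := semi_inner_L2 mu.

(* [toL2 f] is the junk value [0] when [f] is not square integrable. *)
Definition toL2 (f : T -> R) : L2 := insubd (0 : L2) f.

Lemma toL2E f : f \in Lfun mu 2%:E -> toL2 f = f :> (T -> R).
Proof. by move=> lf; rewrite /toL2 val_insubd lf. Qed.

Lemma nrm_ae0 (f g : L2) : f = g %[ae mu] -> N (f - g) = 0.
Proof.
move=> fg; rewrite /nrm /ipL2.
suff -> : \int[mu]_x ((f - g) x * (f - g) x) = 0 by rewrite sqrtr0.
rewrite /Rintegral -[RHS]/(fine 0%E) -(integral0 mu setT); congr fine.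
apply: ae_eq_integral => //.
- have /Lfun2P[mf _] := LfunP (f - g).
  by apply/measurable_EFinP; exact: measurable_funM.
- apply: filterS fg => x fgx _ /=.
  change (((f x - g x) * (f x - g x))%:E = 0%E).
  by rewrite (fgx I) subrr mul0r.
Qed.

Lemma L2_cvgP I (F : set_system I) {FF : Filter F} (u : I -> L2) (f : L2) :
  L2_cvg mu F u f <-> N (u i - f) @[i --> F] --> 0.
Proof.
rewrite /L2_cvg.
have -> : (fun i => L2norm mu (u i \- f)) = (fun i => (N (u i - f))%:E).
  by apply/funext => i; rewrite nrm_L2.
split=> [H|H]; last by apply: cvg_EFin => //; exact: nearW.
by have /fine_cvgP[_] := H.
Qed.

Lemma op_closureP (D : set (T -> R)) (A : (T -> R) -> T -> R) :
  (forall f, D f -> f \in Lfun mu 2%:E /\ A f \in Lfun mu 2%:E) ->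
  forall f g, op_closure mu D A f g <->
  [/\ f \in Lfun mu 2%:E, g \in Lfun mu 2%:E &
  graph_closure ip (fun u v : L2 => D u /\ v = A u :> (T -> R)) (toL2 f) (toL2 g)].
Proof.
move=> DL f g; split=> [[lf lg [f_ [Df ff gg]]]|[lf lg [u [v [uv uf vg]]]]].
  split=> //; exists (fun k => toL2 (f_ k)), (fun k => toL2 (A (f_ k))); split.
  - by move=> k; have [l1 l2] := DL _ (Df k); rewrite !toL2E.
  - apply/(L2_cvgP (fun k => toL2 (f_ k))).
    rewrite (_ : (fun k => _) = f_)//; last first.
      by apply/funext => k; have [l1 l2] := DL _ (Df k); rewrite toL2E.
    by rewrite toL2E.
  - apply/(L2_cvgP (fun k => toL2 (A (f_ k)))).
    rewrite (_ : (fun k => _) = fun k => A (f_ k))//; last first.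
      by apply/funext => k; have [l1 l2] := DL _ (Df k); rewrite toL2E.
    by rewrite toL2E.
split=> //; exists (fun k => u k : T -> R); split.
- by move=> k; have [] := uv k.
- by move/L2_cvgP: uf; rewrite toL2E.
- move/L2_cvgP: vg; rewrite toL2E//.
  by rewrite (_ : (fun k => (v k : T -> R)) = fun k => A (u k))//; apply/funext => k; have [] := uv k.
Qed.

Section semigroup.
Variables (A : (T -> R) -> (T -> R) -> Prop) (P : R -> (T -> R) -> T -> R).
Hypothesis sgP : generated_semigroup mu A P.

Definition sgL2 (t : R) (f : L2) : L2 := toL2 (P t f).

Lemma sgL2E t f : 0 <= t -> sgL2 t f = P t f :> (T -> R).
Proof. by move=> t0; apply: toL2E; apply: (sg_L2 sgP) => //; exact: LfunP. Qed.

Lemma seminormed_sgL2 : seminormed_semigroup N sgL2.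
Proof.
split.
- move=> t a f g t0; apply: nrm_ae0.
  have := sg_linear sgP a t0 (LfunP f) (LfunP g); apply: filterS => x H _.
  by rewrite sgL2E// -[RHS]/(a * sgL2 t f x + sgL2 t g x) !sgL2E//; exact: H.
- move=> t t0; have [C CP] := sg_bounded sgP t0; exists C => f.
  have := CP _ (LfunP f).
  by rewrite -sgL2E// -!nrm_L2 -EFinM lee_fin.
- move=> f; apply: nrm_ae0; have := sg_id sgP (LfunP f).
  by apply: filterS => x H _; rewrite sgL2E//; exact: H.
- move=> s t f s0 t0; apply: nrm_ae0; have := sg_comp sgP s0 t0 (LfunP f).
  by apply: filterS => x H _; rewrite !sgL2E ?addr_ge0//; exact: H.
- move=> f; apply/(right_cvg0P (fun t => nrm_ge0 _ _)); apply/L2_cvgP.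
  have := sg_cvg sgP (LfunP f); apply: cvg_trans; apply: near_eq_cvg.
  near=> t; rewrite sgL2E//.
Unshelve. all: by end_near. Qed.

Lemma generator_sgL2 (f g : L2) : generator ip sgL2 f g <-> A f g.
Proof.
have E : L2_cvg mu 0^'+ (fun t => t^-1 *: (sgL2 t f - f) : T -> R) g <->
    L2_cvg mu 0^'+ (fun t => t^-1 \*o (P t f \- f)) g.
  rewrite /L2_cvg.
  have H : \forall t \near 0^'+, L2norm mu ((t^-1 *: (sgL2 t f - f) : T -> R) \- g) =
      L2norm mu ((t^-1 \*o (P t f \- f)) \- g).
    near=> t; congr L2norm; apply/funext => x.
    by rewrite -[LHS]/(t^-1 * (sgL2 t f x - f x) - g x) sgL2E.
  by split; apply: cvg_trans; apply: near_eq_cvg => //; apply: filterS H => t ->.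
apply: iff_trans (sg_generator sgP _ _); split=> [H|[lf lg H]].
  split; [exact: LfunP|exact: LfunP|].
  by apply/E/L2_cvgP; apply/right_cvg0P => // t; exact: nrm_ge0.
by apply/(right_cvg0P (fun t => nrm_ge0 _ _)); apply/L2_cvgP/E.
Unshelve. all: by end_near. Qed.

End semigroup.
End L2_bridge.

(** * Lebesgue pairings as inner products for the Cauchy measure *)

Section cauchy_L2.
Context (R : realType) (n : nat) (beta : R).
Hypothesis nbeta : n%:R <= beta.
Notation leb := (lebesgue_rV R n).
Notation mu := (cauchy_measure n beta).
Implicit Types (f g h phi : 'rV[R]_n -> R).

Lemma ae_leb_mu (Q : 'rV[R]_n -> Prop) : {ae leb, forall x, Q x} -> {ae mu, forall x, Q x}.
Proof.
move=> [A [mA A0 QA]]; exists A; split=> //.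
apply/eqP; rewrite eq_le measure_ge0 andbT.
change (mu A <= 0)%E; rewrite cauchy_measureE// /omega_measure null_set_integral ?mul0e//.
by apply/measurable_EFinP; apply: measurable_funTS; exact: measurable_omega_powR.
Qed.

Lemma test_Lfun2 f : test_function f -> f \in Lfun mu 2%:E.
Proof.
move=> tf; apply/Lfun2P; split.
  by apply: continuous_measurable_rV; exact: test_function_cont.
rewrite (_ : (fun x => f x ^+ 2) = fun x => f x * f x).
  by apply: test_integrable_mu => //; apply: test_functionM => //; exact: test_smooth.
by apply/funext => x; rewrite expr2.
Qed.

Lemma Lfun2_integrable g : g \in Lfun mu 2%:E -> mu.-integrable setT (EFin \o g).
Proof.
move=> lg.
have l1 : (cst 1 : 'rV[R]_n -> R) \in Lfun mu 2%:E by exact: Lfun_cst.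
have := Lfun2_integrableM lg l1.
by congr (_.-integrable _ _); apply/funext => x /=; rewrite mulr1.
Qed.

Lemma cauchy_densityV (x : 'rV[R]_n) : (cauchy_density beta x)^-1 = cauchy_Z n beta * omega x `^ beta.
Proof. by rewrite /cauchy_density invfM invrK powRN invrK. Qed.

(** On a compact set [h] divided by the Cauchy density is bounded, and [g] times that density is
    Lebesgue integrable. *)
Lemma L2_locally_integrable g h : g \in Lfun mu 2%:E -> continuous h ->
  locally_integrable_rV (fun x => h x * g x).
Proof.
move=> lg ch; have /Lfun2P[mg _] := lg.
have mhg : measurable_fun setT (fun x => h x * g x).
  by apply: measurable_funM => //; exact: continuous_measurable_rV.
split=> // K cK; have mK := compact_measurable_rV cK.
have [M KM] := compact_bounded_box cK.
have cH : continuous (fun x => h x * (cauchy_Z n beta * omega x `^ beta)).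
  move=> x; apply: (@continuousM _ _ h); first exact: ch.
  apply: (@continuousM _ _ (fun=> cauchy_Z n beta)); first exact: cst_continuous.
  exact: (smooth_continuous (@smooth_omega_powR R n beta)).
have [C C0 CP] := continuous_bounded_box M cH.
have ig := (integrable_cauchy nbeta mg).1 (Lfun2_integrable lg).
apply: (@le_integrable _ _ _ _ _ mK _ (EFin \o (fun x => C * (g x * cauchy_density beta x)))).
- by apply/measurable_EFinP; exact: measurable_funTS.
- move=> x /KM /CP; rewrite -cauchy_densityV => H /=; rewrite lee_fin.
  rewrite (_ : h x * g x = h x * (cauchy_density beta x)^-1 * (g x * cauchy_density beta x)).
    by rewrite normrM [in X in _ <= X]normrM (ger0_norm C0) ler_wpM2r.
  have d0 := cauchy_density_gt0 nbeta x.
  by field; rewrite gt_eqF.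
- apply: (integrableS measurableT) => //.
  exact: (integrableZl measurableT C ig).
Qed.

(** The quotient of [phi] by the Cauchy density, again a test function. Pairing with [phi] for
    Lebesgue measure becomes a continuous linear form on the square integrable functions for
    [mu]. *)
Definition cauchy_dual phi (x : 'rV[R]_n) := phi x * (cauchy_Z n beta * omega x `^ beta).

Lemma test_cauchy_dual phi : test_function phi -> test_function (cauchy_dual phi).
Proof.
move=> tphi; apply: test_functionM => //.
by apply: smoothM; [exact: smooth_cst|exact: smooth_omega_powR].
Qed.

Lemma Rintegral_leb_dual g phi : g \in Lfun mu 2%:E -> test_function phi ->
  \int[leb]_x (g x * phi x) = ipL2 mu g (cauchy_dual phi).
Proof.
move=> lg tphi; have lp := test_Lfun2 (test_cauchy_dual tphi).
rewrite /ipL2 (Rintegral_cauchy nbeta (Lfun2_integrableM lg lp)).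
apply: eq_Rintegral => x _; rewrite /cauchy_dual -cauchy_densityV.
have d0 := cauchy_density_gt0 nbeta x.
by field; rewrite gt_eqF.
Qed.

End cauchy_L2.

Lemma sum_mul_sqr_le (R : realType) n (a b : 'I_n -> R) :
  (\sum_i a i * b i) ^+ 2 <= (\sum_i a i ^+ 2) * (\sum_i b i ^+ 2).
Proof.
pose dot (u v : 'rV[R]_n) := \sum_i u ord0 i * v ord0 i.
have dotP : semi_inner dot.
  split=> [f g|e f g h|f].
  - by apply: eq_bigr => i _; rewrite mulrC.
  - rewrite /dot mulr_sumr -big_split; apply: eq_bigr => i _ /=.
    by rewrite !mxE mulrDl mulrA.
  - by apply: sumr_ge0 => i _; rewrite -expr2 sqr_ge0.
have := ip_sqr_le dotP (\row_i a i) (\row_i b i).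
rewrite /dot; under eq_bigr do rewrite !mxE.
by congr (_ ^+ 2 <= _ * _); apply: eq_bigr => i _; rewrite !mxE expr2.
Qed.

Lemma sum_sqr_le (R : realType) n (b : 'I_n -> R) :
  (\sum_i b i) ^+ 2 <= n%:R * (\sum_i b i ^+ 2).
Proof.
have := sum_mul_sqr_le (fun=> 1) b.
rewrite (eq_bigr b); last by move=> i _; rewrite mul1r.
rewrite [in X in _ <= X * _ -> _](eq_bigr (fun=> 1)); last by move=> i _; rewrite expr1n.
by rewrite sumr_const card_ord.
Qed.

Lemma entry_sqr_le (R : realType) n (a : 'I_n -> 'I_n -> R) i j :
  a i j ^+ 2 <= \sum_k \sum_l a k l ^+ 2.
Proof.
rewrite (bigD1 i) //= (bigD1 j) //= -addrA lerDl addr_ge0//.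
  by apply: sumr_ge0 => k _; rewrite sqr_ge0.
by apply: sumr_ge0 => k _; apply: sumr_ge0 => l _; rewrite sqr_ge0.
Qed.

(** * Estimates on test functions *)

Section core.
Context (R : realType) (n : nat) (beta : R).
Hypothesis n2 : (2 <= n)%N.
Hypothesis nb : n%:R + 1 <= beta.
Notation leb := (lebesgue_rV R n).
Notation mu := (cauchy_measure n beta).
Notation c := (beta - 1).
Implicit Types (f g h phi : 'rV[R]_n -> R).
Local Notation ip := (ipL2 mu).

Let nbeta : n%:R <= beta. Proof. by apply: le_trans nb; rewrite lerDl. Qed.

Lemma c_ge : n%:R <= c. Proof. by rewrite lerBrDr. Qed.

Lemma c1_ge1 : 1 <= c - 1.
Proof.
have n2R : (2 : R) <= n%:R by rewrite ler_nat.
by have := le_trans n2R c_ge; lra.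
Qed.

Let itest f : test_function f -> mu.-integrable setT (EFin \o f).
Proof. exact: test_integrable_mu. Qed.

Lemma test_sqr f : test_function f -> test_function (fun x => f x ^+ 2).
Proof.
move=> tf; rewrite (_ : (fun x => _) = fun x => f x * f x).
  by apply: test_functionM => //; exact: test_smooth.
by apply/funext => x; rewrite expr2.
Qed.

Lemma ipL2_sqr f : ip f f = \int[mu]_x (f x ^+ 2).
Proof. by apply: eq_Rintegral => x _; rewrite expr2. Qed.

Lemma test_omega_grad f : test_function f -> test_function (fun x => omega x * grad_dot f f x).
Proof.
move=> tf; apply: test_functionMl; first exact: smooth_omega.
by apply: test_grad_dot => //; exact: test_smooth.
Qed.

Lemma energyE f : test_function f ->
  \int[mu]_x (omega x * grad_dot f f x) = - ip f (cauchyL beta f).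
Proof. by move=> tf; rewrite /ipL2 (Rintegral_cauchyL nbeta tf (test_smooth tf)) opprK. Qed.

Lemma grad_dotC f g x : grad_dot f g x = grad_dot g f x.
Proof. by apply: eq_bigr => i _; exact: mulrC. Qed.

Lemma ip_cauchyL_sym f g : test_function f -> test_function g ->
  ip f (cauchyL beta g) = ip g (cauchyL beta f).
Proof.
move=> tf tg; rewrite /ipL2 (Rintegral_cauchyL nbeta tf (test_smooth tg)).
transitivity (- \int[mu]_x (omega x * grad_dot g f x)).
  exact: (Rintegral_cauchyL nbeta tg (test_smooth tf)).
apply: (congr1 -%R); apply: eq_Rintegral => x _; rewrite (grad_dotC g f x).
exact: erefl.
Qed.

Let grad_ge0 f x : 0 <= grad_dot f f x.
Proof. by apply: sumr_ge0 => i _; rewrite -expr2 sqr_ge0. Qed.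

Lemma partial_sqr_le i f : test_function f ->
  ip (partial i f) (partial i f) <= - ip f (cauchyL beta f).
Proof.
move=> tf; rewrite -energyE//; apply: le_Rintegral => //.
- apply: itest; apply: test_functionM; first exact: test_function_partial.
  by apply: test_smooth; exact: test_function_partial.
- by apply: itest; exact: test_omega_grad.
move=> x _; apply: (@le_trans _ _ (grad_dot f f x)).
  rewrite /grad_dot (bigD1 i) //=.
  by rewrite lerDl; apply: sumr_ge0 => j _; rewrite -expr2 sqr_ge0.
by rewrite ler_peMl ?omega_ge1.
Qed.

Lemma radial_sqr_le f x : radial f x ^+ 2 <= omega x * grad_dot f f x.
Proof.
apply: le_trans (sum_mul_sqr_le _ _) _.
rewrite (_ : \sum_i partial i f x ^+ 2 = grad_dot f f x).
  by apply: ler_wpM2r; [exact: grad_ge0|rewrite /omega /sqnorm lerDr].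
by apply: eq_bigr => i _; rewrite expr2.
Qed.

Lemma trace_whess f x :
  \sum_i whess f i i x = cauchyL beta f x + 2 * c * radial f x.
Proof. by rewrite /cauchyL subrK /laplacian mulr_sumr. Qed.

Lemma trace_sqr_le f x : (\sum_i whess f i i x) ^+ 2 <=
  n%:R * \sum_i \sum_j whess f i j x ^+ 2.
Proof.
apply: le_trans (sum_sqr_le (fun i => whess f i i x)) _.
apply: ler_wpM2l; first exact: ler0n.
apply: ler_sum => i _; rewrite (bigD1 i) //=.
by rewrite lerDl; apply: sumr_ge0 => j _; rewrite sqr_ge0.
Qed.

Lemma hess_form_ge0 f x : 0 <= hess_form beta f x.
Proof.
rewrite /hess_form; have := trace_sqr_le f x.
have S0 : 0 <= \sum_i \sum_j whess f i j x ^+ 2.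
  by apply: sumr_ge0 => i _; apply: sumr_ge0 => j _; rewrite sqr_ge0.
have c1 := c1_ge1; have cn := c_ge.
move: S0; set S := (\sum_i _); set T := (_ ^+ 2) => S0 TS.
have v0 : 0 <= (c - 1)^-1 by rewrite invr_ge0; lra.
rewrite [c / _]mulrC -mulrA -mulrBr mulr_ge0// subr_ge0 (le_trans TS)//.
exact: ler_wpM2r.
Qed.

Lemma gap_core f : test_function f ->
  0 <= ip (cauchyL beta f) (cauchyL beta f) + 2 * c * ip f (cauchyL beta f).
Proof.
move=> tf; rewrite /ipL2 bochner_identity//; last by have := c1_ge1; lra.
by apply: Rintegral_ge0 => x _; exact: hess_form_ge0.
Qed.

(** Write [c / (c - 1) = 1 + v] with [0 <= v <= 1], [S] for the sum of squares and
    [T = L f + 2 c radial f] for the trace. Then [S <= Q + v T^2 <= Q + 2 (L f)^2 + 8 c^2 (radial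
    f)^2], and the radial derivative is controlled by [omega |df|^2]. *)
Let whess_sqr_pointwise i j f x : whess f i j x ^+ 2 <=
  hess_form beta f x + (2 * cauchyL beta f x ^+ 2 + 8 * c ^+ 2 * (omega x * grad_dot f f x)).
Proof.
have r0 := radial_sqr_le f x; have tr := trace_whess f x.
have wS : whess f i j x ^+ 2 <= \sum_i \sum_j whess f i j x ^+ 2.
  exact: (entry_sqr_le (fun i j => whess f i j x)).
rewrite /hess_form tr; have c1 := c1_ge1.
have w0 := sqr_ge0 (whess f i j x).
move: r0 wS w0; move: (radial f x) (cauchyL beta f x) (\sum_i \sum_j _) => r L S.
move: (omega x * _) (whess f i j x ^+ 2) => G W rG WS W0.
have v0 : 0 <= (c - 1)^-1 by rewrite invr_ge0; lra.
have v1 : (c - 1)^-1 <= 1 by rewrite invf_le1; lra.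
have cv : c / (c - 1) = 1 + (c - 1)^-1 by field; rewrite gt_eqF//; lra.
rewrite cv; move: v0 v1; set v := (c - 1)^-1; clearbody v; clear cv => v0 v1.
have T0 := sqr_ge0 (L + 2 * c * r).
have A : v * (L + 2 * c * r) ^+ 2 <= (L + 2 * c * r) ^+ 2 by rewrite ler_piMl.
have B : 0 <= v * S by rewrite mulr_ge0// (le_trans W0).
have C := sqr_ge0 (L - 2 * c * r).
have D : c ^+ 2 * r ^+ 2 <= c ^+ 2 * G := ler_wpM2l (sqr_ge0 c) rG.
clear tr v0 v1 T0 c1 rG W0.
move: A B C D WS; lra.
Qed.

(** The constant 3 is the 2 of the pointwise bound plus the 1 of the integrated Bochner identity,
    whose energy term is nonpositive and is dropped. *)
Lemma whess_sqr_le i j f : test_function f ->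
  ip (whess f i j) (whess f i j) <=
  3 * ip (cauchyL beta f) (cauchyL beta f) + 8 * c ^+ 2 * - ip f (cauchyL beta f).
Proof.
move=> tf; have tL : test_function (cauchyL beta f) by apply: test_cauchyL.
have iH := itest (test_hess_form beta tf).
have i2 := itest (test_functionZ 2 (test_sqr tL)).
have iG := itest (test_functionZ (8 * c ^+ 2) (test_omega_grad tf)).
have i3 := itest (test_functionD (test_functionZ 2 (test_sqr tL))
  (test_functionZ (8 * c ^+ 2) (test_omega_grad tf))).
have H : ip (whess f i j) (whess f i j) <= \int[mu]_x (hess_form beta f x +
    (2 * cauchyL beta f x ^+ 2 + 8 * c ^+ 2 * (omega x * grad_dot f f x))).
  rewrite ipL2_sqr; apply: (le_Rintegral measurableT _ _ (fun x _ => whess_sqr_pointwise i j f x)).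
  - exact: itest (test_sqr (test_whess i j tf)).
  - exact: itest (test_functionD (test_hess_form beta tf) (test_functionD
      (test_functionZ 2 (test_sqr tL)) (test_functionZ (8 * c ^+ 2) (test_omega_grad tf)))).
have iG0 := itest (test_omega_grad tf).
have iL0 := itest (test_sqr tL).
have e1 := RintegralZl 2 measurableT iL0.
have e2 := RintegralZl (8 * c ^+ 2) measurableT iG0.
have e3 := RintegralD measurableT iH i3.
have e4 := RintegralD measurableT i2 iG.
rewrite e3 e4 e1 e2 in H.
rewrite -bochner_identity// in H; last by have := c1_ge1; lra.
rewrite energyE// -ipL2_sqr in H.
have E0 : 0 <= - ip f (cauchyL beta f).
  rewrite -energyE//; apply: Rintegral_ge0 => x _.
  by rewrite mulr_ge0 ?grad_ge0// (le_trans ler01)// omega_ge1.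
have c0 : 0 <= c by have := c1_ge1; lra.
have M := mulr_ge0 c0 E0.
move: H M; rewrite /ipL2 mulrN -mulrA; lra.
Qed.

Lemma partial_subr i f g : smooth f -> smooth g ->
  partial i (fun x => f x - g x) = fun x => partial i f x - partial i g x.
Proof. by move=> sf sg; apply/funext => x; apply: partialB; exact: smooth_diff. Qed.

Let partial2_subr i j f g : smooth f -> smooth g ->
  partial j (partial i (fun x => f x - g x)) =
  fun x => partial j (partial i f) x - partial j (partial i g) x.
Proof.
move=> sf sg; rewrite (partial_subr i sf sg).
exact: (partial_subr j (smooth_partial i sf) (smooth_partial i sg)).
Qed.

Lemma cauchyLB f g : test_function f -> test_function g ->
  cauchyL beta (fun x => f x - g x) = fun x => cauchyL beta f x - cauchyL beta g x.
Proof.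
move=> /test_smooth sf /test_smooth sg; apply/funext => x.
have -> : cauchyL beta (fun x => f x - g x) x =
    omega x * (laplacian f x - laplacian g x) - 2 * c * (radial f x - radial g x).
  rewrite /cauchyL; congr (_ * _ - _ * _).
    rewrite /laplacian -sumrB; apply: eq_bigr => i _.
    by have := congr1 (fun F => F x) (partial2_subr i i sf sg).
  rewrite /radial -sumrB; apply: eq_bigr => i _.
  by rewrite (partial_subr i sf sg) mulrBr.
rewrite /cauchyL; move: (laplacian f x) (laplacian g x) (radial f x) (radial g x) => p q r s.
ring.
Qed.

Lemma whessB f g i j : test_function f -> test_function g ->
  whess (fun x => f x - g x) i j = fun x => whess f i j x - whess g i j x.
Proof.
move=> /test_smooth sf /test_smooth sg; apply/funext => x.
rewrite /whess (partial2_subr i j sf sg) mulrBr.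
exact: erefl.
Qed.

Lemma Rintegral_by_parts i f phi : test_function f -> test_function phi ->
  \int[leb]_x (partial i f x * phi x) = - \int[leb]_x (f x * partial i phi x).
Proof.
move=> tf tp; have sp := test_smooth tp; have sf := test_smooth tf.
have ileb g : test_function g -> leb.-integrable setT (EFin \o g).
  by move=> tg; apply: continuous_bsupp_integrable; [exact: test_function_cont|exact: test_function_bsupp].
have i1 := ileb _ (test_functionM (test_function_partial i tf) sp).
have i2 := ileb _ (test_functionM tf (smooth_partial i sp)).
apply/eqP; rewrite -addr_eq0 -(RintegralD measurableT i1 i2); apply/eqP.
rewrite -[RHS](Rintegral_partial i (test_functionM tf sp)).
apply: eq_Rintegral => x _; symmetry; apply: partialM; exact: smooth_diff.
Qed.

Lemma Rintegral_whess i j f phi : test_function f -> test_function phi ->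
  \int[leb]_x ((omega x)^-1 * whess f i j x * phi x) =
  \int[leb]_x (f x * partial i (partial j phi) x).
Proof.
move=> tf tp; rewrite -[RHS]opprK -Rintegral_by_parts//; last exact: test_function_partial.
rewrite -Rintegral_by_parts//; last exact: test_function_partial.
by apply: eq_Rintegral => x _; rewrite /whess mulrA mulVf ?mul1r// gt_eqF// omega_gt0.
Qed.

End core.

(** * Inequalities and symmetry on the closure *)

Section closure_core.
Context (R : realType) (n : nat) (beta : R).
Hypothesis n2 : (2 <= n)%N.
Hypothesis nb : n%:R + 1 <= beta.
Notation leb := (lebesgue_rV R n).
Notation mu := (cauchy_measure n beta).
Notation c := (beta - 1).
Notation L2 := (LfunType mu (lee1n 2 : (1 <= 2%:E)%E)).
Local Notation ip := (fun f g : L2 => ipL2 mu f g).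
Local Notation N := (nrm ip).
Implicit Types (f g h u v : L2) (phi : 'rV[R]_n -> R).

Let nbeta : n%:R <= beta. Proof. by apply: le_trans nb; rewrite lerDl. Qed.
Let ipP := semi_inner_L2 mu.

Definition coreL (u v : L2) := test_function u /\ v = cauchyL beta u :> ('rV[R]_n -> R).

Definition oneL2 : L2 := @toL2 _ _ R mu (fun=> 1).

Lemma oneL2E : oneL2 = (fun=> 1) :> ('rV[R]_n -> R).
Proof. by apply: toL2E; exact: (Lfun_cst mu 1). Qed.

Lemma coreL_toL2 phi : test_function phi -> coreL (toL2 mu phi) (toL2 mu (cauchyL beta phi)).
Proof.
move=> tp; have tL : test_function (cauchyL beta phi) by apply: test_cauchyL.
by split; rewrite !toL2E//; exact: test_Lfun2.
Qed.

Lemma coreLB u v u' v' : coreL u v -> coreL u' v' -> coreL (u - u') (v - v').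
Proof.
move=> [tu vE] [tu' vE']; split; first exact: (test_functionB tu tu').
transitivity (fun x => v x - v' x); first by [].
by rewrite vE vE' -(cauchyLB beta tu tu').
Qed.

Lemma coreL_sym u v u' v' : coreL u v -> coreL u' v' -> ip v u' = ip u v'.
Proof.
move=> [tu vE] [tu' vE']; rewrite (ipC ipP) vE vE'.
exact: (ip_cauchyL_sym nb tu' tu).
Qed.

Lemma coreL_le0 u v : coreL u v -> ip u v <= 0.
Proof.
move=> [tu ->]; rewrite -oppr_ge0 -(energyE nb tu).
apply: Rintegral_ge0 => x _; apply: mulr_ge0; first exact: le_trans (omega_ge1 x).
by apply: sumr_ge0 => i _; rewrite -expr2 sqr_ge0.
Qed.

Lemma coreL_one u v : coreL u v -> ip v oneL2 = 0.
Proof.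
move=> [tu vE]; rewrite (ipC ipP) vE oneL2E.
have s1 : smooth (fun _ : 'rV[R]_n => 1 : R) := @smooth_cst R n 1.
rewrite /ipL2 (Rintegral_cauchyL nbeta tu s1).
have -> : (fun x => omega x * grad_dot u (fun=> 1) x) = fun=> 0.
  apply/funext => x; rewrite /grad_dot big1 ?mulr0// => i _.
  by rewrite partial_cst mulr0.
by rewrite Rintegral_cst//= mul0r oppr0.
Qed.

Lemma coreL_gap u v : coreL u v -> 0 <= ip v v + 2 * c * ip u v.
Proof. by move=> [tu ->]; exact: gap_core. Qed.

Local Notation Lcl := (graph_closure ip coreL).

Lemma closure_sym f g f' g' : Lcl f g -> Lcl f' g' -> ip g f' = ip f g'.
Proof.
move=> [u [v [uv uf vg]]] [u' [v' [uv' uf' vg']]].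
have A := ip_cvg ipP vg uf'; have B := ip_cvg ipP uf vg'.
have EQ : (fun k => ip (v k) (u' k)) = fun k => ip (u k) (v' k).
  by apply/funext => k; exact: (coreL_sym (uv k) (uv' k)).
by rewrite EQ in A; exact: (cvg_unique _ A B).
Qed.

Lemma closure_le0 f g : Lcl f g -> ip f g <= 0.
Proof.
move=> [u [v [uv uf vg]]]; have A := ip_cvg ipP uf vg.
rewrite -(cvg_lim _ A)//; apply: limr_le; first by apply/cvg_ex; exists (ip f g).
by apply: nearW => k; exact: coreL_le0.
Qed.

Lemma closure_one f g : Lcl f g -> ip g oneL2 = 0.
Proof.
move=> [u [v [uv uf vg]]]; have A := ip_cvg ipP vg (nrm_cvg_cst ipP oneL2).
rewrite -(cvg_lim _ A)//; apply/cvg_lim => //.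
rewrite (_ : (fun k => _) = fun=> 0); first exact: cvg_cst.
by apply/funext => k; exact: coreL_one (uv k).
Qed.

Lemma closure_gap f g : Lcl f g -> 0 <= ip g g + 2 * c * ip f g.
Proof.
move=> [u [v [uv uf vg]]].
have A : ip (v k) (v k) + 2 * c * ip (u k) (v k) @[k --> \oo] --> ip g g + 2 * c * ip f g.
  apply: cvgD; first exact: (ip_cvg ipP vg vg).
  by apply: cvgM; [exact: cvg_cst|exact: (ip_cvg ipP uf vg)].
rewrite -(cvg_lim _ A)//; apply: limr_ge; first by apply/cvg_ex; eexists; exact: A.
by apply: nearW => k; exact: coreL_gap.
Qed.

(** Convergence in the space implies convergence as distributions; all weak identities reach the
    closure this way. *)
Lemma ip_dual_cvg (u : nat -> L2) f phi : test_function phi -> nrm_cvg ip u f ->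
  \int[leb]_x (u k x * phi x) @[k --> \oo] --> \int[leb]_x (f x * phi x).
Proof.
move=> tp uf; have tc := test_Lfun2 nbeta (test_cauchy_dual beta tp).
have H g : \int[leb]_x (g x * phi x) = ip g (toL2 mu (cauchy_dual beta phi)).
  by rewrite /= toL2E// (Rintegral_leb_dual nbeta (LfunP g) tp).
rewrite H (_ : (fun k => _) = fun k => ip (u k) (toL2 mu (cauchy_dual beta phi))).
  exact: (ip_cvg ipP uf (nrm_cvg_cst ipP _)).
by apply/funext => k; exact: H.
Qed.

End closure_core.

Opaque whess.
Lemma integrable_Rintegral_sum d (T : measurableType d) (R : realType)
    (mu : {measure set T -> \bar R}) (I : Type) (r : seq I) (F : I -> T -> R) :
  (forall i, mu.-integrable setT (EFin \o F i)) ->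
  mu.-integrable setT (EFin \o (fun x => \sum_(i <- r) F i x)) /\
  \int[mu]_x (\sum_(i <- r) F i x) = \sum_(i <- r) \int[mu]_x F i x.
Proof.
move=> iF; elim: r => [|i r [IH1 IH2]].
  rewrite big_nil; under eq_fun do rewrite big_nil; split; first exact: integrable0.
  by rewrite /Rintegral integral0.
have E : (fun x => \sum_(j <- i :: r) F j x) = fun x => F i x + \sum_(j <- r) F j x.
  by apply/funext => x; rewrite big_cons.
rewrite E; split; first exact: (integrableD measurableT (iF i) IH1).
by rewrite (RintegralD measurableT (iF i) IH1) big_cons IH2.
Qed.

Lemma toL2B d (T : measurableType d) (R : realType) (mu : {measure set T -> \bar R})
    (f g : T -> R) : f \in Lfun mu 2%:E -> g \in Lfun mu 2%:E ->
  toL2 mu f - toL2 mu g = (fun x => f x - g x) :> (T -> R).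
Proof.
move=> lf lg; transitivity (fun x => toL2 mu f x - toL2 mu g x); first by [].
by rewrite !toL2E.
Qed.

Lemma cvg_sumr (R : realType) (I : Type) (r : seq I) (a : I -> nat -> R) (l : I -> R) :
  (forall i, a i k @[k --> \oo] --> l i) ->
  \sum_(i <- r) a i k @[k --> \oo] --> \sum_(i <- r) l i.
Proof.
move=> al; elim: r => [|i r IH].
  by rewrite big_nil; under eq_fun do rewrite big_nil; exact: cvg_cst.
rewrite big_cons; under eq_fun do rewrite big_cons.
exact: cvgD.
Qed.

(** * Kernel and weak Hessian on the closure *)

Section closure_regularity.
Context (R : realType) (n : nat) (beta : R).
Hypothesis n2 : (2 <= n)%N.
Hypothesis nb : n%:R + 1 <= beta.
Notation leb := (lebesgue_rV R n).
Notation mu := (cauchy_measure n beta).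
Notation c := (beta - 1).
Notation L2 := (LfunType mu (lee1n 2 : (1 <= 2%:E)%E)).
Local Notation ip := (fun f g : L2 => ipL2 mu f g).
Local Notation N := (nrm ip).
Implicit Types (f g h u v : L2) (phi : 'rV[R]_n -> R).

Let nbeta : n%:R <= beta. Proof. by apply: le_trans nb; rewrite lerDl. Qed.
Let ipP := semi_inner_L2 mu.
Local Notation Lcl := (graph_closure ip (@coreL R n beta)).

Let ltest phi : test_function phi -> phi \in Lfun mu 2%:E.
Proof. exact: test_Lfun2. Qed.

(** Integration by parts moves the derivative onto the approximants [u k], whose gradients are
    bounded by the square root of the energy [- <u k, v k>]; this energy tends to [- <f, 0> = 0]. *)
Lemma closure_weak_gradient0 i f phi : Lcl f 0 -> test_function phi ->
  \int[leb]_x (f x * partial i phi x) = 0.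
Proof.
move=> [u [v [uv uf v0]]] tp.
have A := ip_dual_cvg nb (test_function_partial i tp) uf.
apply: (cvg_unique _ A) => //.
pose psi := toL2 mu (cauchy_dual beta phi).
pose b k := Num.sqrt (- ip (u k) (v k)) * N psi.
have B : b k @[k --> \oo] --> 0.
  rewrite [X in _ --> X](_ : 0 = Num.sqrt (- ip f 0) * N psi); last first.
    by rewrite (ipC ipP) (ip0l ipP) oppr0 sqrtr0 mul0r.
  apply: cvgM; last exact: cvg_cst.
  apply: (cvg_comp _ _ (cvgN (ip_cvg ipP uf v0))); exact: sqrt_continuous.
apply: (@squeeze_cvgr _ _ _ _ (fun k => - b k) b) => //; last first.
  by rewrite -oppr0; exact: cvgN.
apply: nearW => k; rewrite -ler_norml.
have [tu vE] := uv k; have tdu := test_function_partial i tu.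
have E1 := Rintegral_by_parts i tu tp.
have E2 := Rintegral_leb_dual nbeta (ltest tdu) tp.
have -> : \int[leb]_x (u k x * partial i phi x) = - ip (toL2 mu (partial i (u k))) psi.
  rewrite /psi !toL2E; [|exact: ltest (test_cauchy_dual beta tp)|exact: ltest].
  by rewrite -E2 E1 opprK.
rewrite normrN; apply: le_trans (ip_le ipP _ _) _.
apply: ler_wpM2r; first exact: nrm_ge0.
rewrite /nrm ler_wsqrtr// toL2E; last exact: ltest.
by rewrite vE; exact: (partial_sqr_le nb i tu).
Qed.

Lemma closure_ker f : Lcl f 0 -> exists a : R, N (f - a *: oneL2 n beta) = 0.
Proof.
move=> Lf.
have lf : locally_integrable_rV f.
  have := L2_locally_integrable nbeta (LfunP f) (smooth_continuous (@smooth_cst R n 1)).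
  by congr locally_integrable_rV; apply/funext => x; rewrite mul1r.
have [a fa] := weak_gradient0_constant lf (fun i phi tp => closure_weak_gradient0 i Lf tp).
exists a; apply: nrm_ae0; apply: filterS (ae_leb_mu nbeta fa) => x -> _.
rewrite -[RHS]/(a * oneL2 n beta x) oneL2E.
by rewrite mulr1.
Qed.

Let K : R := 3 + 8 * c ^+ 2.

Let whess_cauchy (u v : nat -> L2) f g i j : (forall k, coreL (u k) (v k)) ->
  nrm_cvg ip u f -> nrm_cvg ip v g ->
  exists G : L2, nrm_cvg ip (fun k => toL2 mu (whess (u k) i j)) G.
Proof.
move=> uv uf vg.
have [|G GP] := @L2_complete _ _ _ mu (fun k => toL2 mu (whess (u k) i j)); last first.
  by exists G; apply/nrm_cvgP.
have K1 : 1 <= K by rewrite /K; have := sqr_ge0 c; lra.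
(* For approximants within [d = e / K], the estimate [whess_sqr_le] applied to differences gives a
   squared distance below [K d^2], and [K >= 1] bounds this by [(K d)^2 = e^2]. *)
move=> e e0; have d0 : 0 < e / K by apply: divr_gt0 => //; lra.
have [k1 k1P] := nrm_cvg_cauchy ipP uf d0.
have [k2 k2P] := nrm_cvg_cauchy ipP vg d0.
exists (maxn k1 k2) => p q; rewrite !geq_max => /andP[p1 p2] /andP[q1 q2].
have a1 := k1P p q p1 q1; have b1 := k2P p q p2 q2.
have [tw wE] := coreLB (uv p) (uv q).
have [tp _] := uv p; have [tq _] := uv q.
have W := whess_sqr_le n2 nb i j tw.
have lw p' : test_function (u p') -> whess (u p') i j \in Lfun mu 2%:E.
  by move=> t; apply: ltest; exact: test_whess.
have E : N (toL2 mu (whess (u p) i j) - toL2 mu (whess (u q) i j)) ^+ 2 =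
    ipL2 mu (whess (u p - u q) i j) (whess (u p - u q) i j).
  rewrite (sqr_nrm ipP) (whessB i j tp tq).
  have -> // : toL2 mu (whess (u p) i j) - toL2 mu (whess (u q) i j) =
    (fun x => whess (u p) i j x - whess (u q) i j x) :> ('rV[R]_n -> R).
  exact: (toL2B (lw p tp) (lw q tq)).
have S := ip_le ipP (u p - u q) (v p - v q).
rewrite -wE -E in W; have V2 := sqr_nrm ipP (v p - v q).
rewrite -(@ltr_pXn2r _ 2)// ?nnegrE ?nrm_ge0 ?ltW//.
apply: le_lt_trans W _.
have a0 := nrm_ge0 ip (u p - u q); have b0 := nrm_ge0 ip (v p - v q).
have S' : - ipL2 mu (u p - u q) (v p - v q) <= N (u p - u q) * N (v p - v q).
  by apply: le_trans S; rewrite -normrN ler_norm.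
rewrite -V2 (_ : e = K * (e / K)); last by field; rewrite gt_eqF//; lra.
have C0 : 0 <= 8 * c ^+ 2 by rewrite mulr_ge0 ?sqr_ge0.
move: K1 d0 a1 b1 S' a0 b0 C0; rewrite /K; move: (8 * c ^+ 2) (e / _) (N (u p - u q)) (N (v p - v q)) (- ipL2 mu _ _).
move=> C d A B s K1 d0 Ad Bd sAB A0 B0 C0.
have AB : A * B <= d ^+ 2 by rewrite expr2; exact: ler_pM A0 B0 (ltW Ad) (ltW Bd).
have BB : B ^+ 2 < d ^+ 2 by rewrite ltr_pXn2r// nnegrE; exact: ltW.
have Cs : C * s <= C * d ^+ 2 := ler_wpM2l C0 (le_trans sAB AB).
have D0 := sqr_ge0 d.
have KD : (3 + C) * d ^+ 2 <= ((3 + C) * d) ^+ 2.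
  by rewrite exprMn; apply: ler_wpM2r => //; rewrite expr2 ler_peMl//; lra.
by apply: lt_le_trans KD; rewrite mulrDl; lra.
Qed.

Let traceE (I : finType) (a : I -> I -> R) :
  (\sum_i a i i) ^+ 2 = \sum_i \sum_j a i i * a j j.
Proof. by rewrite expr2 mulr_suml; apply: eq_bigr => i _; rewrite mulr_sumr. Qed.

Definition hess_quad (G : 'I_n -> 'I_n -> 'rV[R]_n -> R) x :=
  c / (c - 1) * (\sum_i \sum_j G i j x ^+ 2) - (c - 1)^-1 * (\sum_i G i i x) ^+ 2.

(** The integral of [hess_quad], with the square of the trace expanded into a double sum: only inner
    products remain, and [ip_cvg] passes to the limit in each. *)
Definition hess_energy (G : 'I_n -> 'I_n -> L2) : R :=
  c / (c - 1) * (\sum_i \sum_j ip (G i j) (G i j)) -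
  (c - 1)^-1 * (\sum_i \sum_j ip (G i i) (G j j)).

Lemma hess_quadE (G : 'I_n -> 'I_n -> L2) :
  mu.-integrable setT (EFin \o (hess_quad (fun i j => G i j))) /\
  \int[mu]_x (hess_quad (fun i j => G i j) x) = hess_energy G.
Proof.
have iGG i j k l : mu.-integrable setT (EFin \o (fun x => G i j x * G k l x)).
  exact: (Lfun2_integrableM (LfunP (G i j)) (LfunP (G k l))).
have [A1 A2] := integrable_Rintegral_sum (index_enum 'I_n) (fun i =>
  (integrable_Rintegral_sum (index_enum 'I_n) (fun j => iGG i j i j)).1).
have [B1 B2] := integrable_Rintegral_sum (index_enum 'I_n) (fun i =>
  (integrable_Rintegral_sum (index_enum 'I_n) (fun j => iGG i i j j)).1).
have E : hess_quad (fun i j => G i j) = fun x =>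
    c / (c - 1) * (\sum_i \sum_j G i j x * G i j x) -
    (c - 1)^-1 * (\sum_i \sum_j G i i x * G j j x).
  apply/funext => x; rewrite /hess_quad (traceE (fun i j => G i j x)).
  congr (_ * _ - _); apply: eq_bigr => i _; apply: eq_bigr => j _; exact: expr2.
have A3 := integrableZl measurableT (c / (c - 1)) A1.
have B3 := integrableZl measurableT ((c - 1)^-1) B1.
rewrite E; split; first exact: (integrableB measurableT A3 B3).
rewrite (RintegralB measurableT A3 B3).
rewrite (RintegralZl (c / (c - 1)) measurableT A1) (RintegralZl (c - 1)^-1 measurableT B1).
rewrite A2 B2 /hess_energy; congr (_ * _ - _ * _); apply: eq_bigr => i _.
  exact: (integrable_Rintegral_sum (index_enum 'I_n) (fun j => iGG i j i j)).2.
exact: (integrable_Rintegral_sum (index_enum 'I_n) (fun j => iGG i i j j)).2.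
Qed.

(* The Hessian is a closed operator, by the a priori bound [whess_sqr_le]; its
   values, multiplied by [omega], are the [G i j]. *)
Lemma closure_hessian f g : Lcl f g -> exists G : 'I_n -> 'I_n -> L2,
  (forall i j phi, test_function phi ->
    \int[leb]_x ((omega x)^-1 * G i j x * phi x) =
    \int[leb]_x (f x * partial i (partial j phi) x)) /\
  ip g g + 2 * c * ip f g = hess_energy G.
Proof.
move=> [u [v [uv uf vg]]].
have /choice[G GP] (ij : 'I_n * 'I_n) : exists G : L2,
    nrm_cvg ip (fun k => toL2 mu (whess (u k) ij.1 ij.2)) G by exact: whess_cauchy uv uf vg.
have twL k i j : whess (u k) i j \in Lfun mu 2%:E.
  by apply: ltest; apply: test_whess; have [] := uv k.
exists (fun i j => G (i, j)); split.
  move=> i j phi tp.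
  (* The weight is moved from the limit to the test function, so that the pairing is again one with
     a fixed test function. *)
  pose phi' (x : 'rV[R]_n) := omega x `^ (- 1) * phi x.
  have tp' : test_function phi'.
    by apply: test_functionMl => //; exact: smooth_omega_powR.
  have D (h : 'rV[R]_n -> R) :
      \int[leb]_x ((omega x)^-1 * h x * phi x) = \int[leb]_x (h x * phi' x).
    apply: eq_Rintegral => x _.
    by rewrite /phi' powR_inv1 ?mulrA 1?[h x * _]mulrC// ltW// omega_gt0.
  have A := ip_dual_cvg nb tp' (GP (i, j)).
  have B := ip_dual_cvg nb (test_function_partial i (test_function_partial j tp)) uf.
  rewrite D; apply: (cvg_unique _ A) => //.
  rewrite (_ : (fun k => _) = (fun k => \int[leb]_x (u k x * partial i (partial j phi) x)))//.
  apply/funext => k; rewrite -D toL2E//; apply: Rintegral_whess => //.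
  by have [] := uv k.
have A : ip (v k) (v k) + 2 * c * ip (u k) (v k) @[k --> \oo] --> ip g g + 2 * c * ip f g.
  apply: cvgD; first exact: (ip_cvg ipP vg vg).
  by apply: cvgM; [exact: cvg_cst|exact: (ip_cvg ipP uf vg)].
apply: (cvg_unique _ A) => //.
have E k : ip (v k) (v k) + 2 * c * ip (u k) (v k) =
    hess_energy (fun i j => toL2 mu (whess (u k) i j)).
  have [tu vE] := uv k; have c1 := c1_ge1 n2 nb.
  have c10 : c - 1 != 0 by rewrite gt_eqF//; lra.
  have := bochner_identity nbeta c10 tu; rewrite -vE => ->.
  rewrite -(hess_quadE _).2; apply: eq_Rintegral => x _.
  rewrite /hess_form /hess_quad; congr (_ * _ - _ * _ ^+ 2); apply: eq_bigr => i _.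
    by apply: eq_bigr => j _; rewrite toL2E.
  by rewrite toL2E.
rewrite (_ : (fun k => _) = fun k => hess_energy (fun i j => toL2 mu (whess (u k) i j))).
  have S (a : 'I_n -> 'I_n -> nat -> R) (l : 'I_n -> 'I_n -> R) :
      (forall i j, a i j k @[k --> \oo] --> l i j) ->
      \sum_i \sum_j a i j k @[k --> \oo] --> \sum_i \sum_j l i j.
    by move=> H; apply: cvg_sumr => i; apply: cvg_sumr => j; exact: H.
  apply: cvgB; (apply: cvgM; first exact: cvg_cst); apply: S => i j.
    exact: (ip_cvg ipP (GP (i, j)) (GP (i, j))).
  exact: (ip_cvg ipP (GP (i, i)) (GP (j, j))).
by apply/funext => k.
Qed.

End closure_regularity.

(** * The spectral gap and the integral formula *)

Section final.
Context (R : realType) (n : nat) (beta : R).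
Hypothesis n2 : (2 <= n)%N.
Hypothesis nb : n%:R + 1 <= beta.
Notation leb := (lebesgue_rV R n).
Notation mu := (cauchy_measure n beta).
Notation c := (beta - 1).
Notation L2 := (LfunType mu (lee1n 2 : (1 <= 2%:E)%E)).
Local Notation ip := (fun f g : L2 => ipL2 mu f g).
Local Notation N := (nrm ip).
Implicit Types (f g h u v : L2) (phi : 'rV[R]_n -> R).

Let nbeta : n%:R <= beta. Proof. by apply: le_trans nb; rewrite lerDl. Qed.
Let ipP := semi_inner_L2 mu.
Local Notation Lcl := (graph_closure ip (@coreL R n beta)).

Definition bochner_integrand (H : 'rV[R]_n -> 'M[R]_n) x : R :=
  (beta - (n%:R + 1)) / (beta - 2) * norm_HS (omega x *: H x) ^+ 2
  + n%:R / (beta - 2) * (norm_HS (omega x *: H x) ^+ 2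
     - n%:R^-1 * (omega x * \tr (H x)) ^+ 2).

(** The coefficients of the Hilbert-Schmidt norm add up: [(beta - (n + 1)) + n = c] and
    [beta - 2 = c - 1]; in front of the trace, [n] cancels. *)
Lemma bochner_integrandE (G : 'I_n -> 'I_n -> R) (H : 'rV[R]_n -> 'M[R]_n) x :
  (forall i j, H x i j = (omega x)^-1 * G i j) ->
  bochner_integrand H x = c / (c - 1) * (\sum_i \sum_j G i j ^+ 2) -
    (c - 1)^-1 * (\sum_i G i i) ^+ 2.
Proof.
move=> HG; have w0 : omega x != 0 by rewrite gt_eqF// omega_gt0.
have E1 : norm_HS (omega x *: H x) ^+ 2 = \sum_i \sum_j G i j ^+ 2.
  rewrite /norm_HS sqr_sqrtr.
    apply: eq_bigr => i _; apply: eq_bigr => j _.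
    by rewrite mxE HG mulrA divff// mul1r.
  by apply: sumr_ge0 => i _; apply: sumr_ge0 => j _; rewrite sqr_ge0.
have E2 : omega x * \tr (H x) = \sum_i G i i.
  rewrite /mxtrace mulr_sumr; apply: eq_bigr => i _.
  by rewrite HG mulrA divff// mul1r.
rewrite /bochner_integrand E1 E2.
have c1 := c1_ge1 n2 nb.
have n0 : (n%:R : R) != 0 by rewrite pnatr_eq0 -lt0n (ltn_trans _ n2).
move: n0; set m := (n%:R : R); clearbody m => m0.
set S := \sum_i \sum_j _; set T := \sum_i _; clearbody S T; clear E1 E2.
by field; do ?[apply/andP; split] => //; rewrite gt_eqF//; lra.
Qed.

Lemma measurable_bochner_integrand (f : 'rV[R]_n -> R) (H : 'rV[R]_n -> 'M[R]_n) :
  is_weak_hessian f H -> measurable_fun setT (EFin \o bochner_integrand H).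
Proof.
move=> wH; have mH i j : measurable_fun setT (fun x : 'rV[R]_n => omega x * H x i j).
  apply: measurable_funM; first exact: measurable_omega.
  by have [[]] := wH i j.
apply/measurable_EFinP.
have -> : bochner_integrand H = fun x =>
    c / (c - 1) * (\sum_i \sum_j (omega x * H x i j) ^+ 2) -
    (c - 1)^-1 * (\sum_i omega x * H x i i) ^+ 2.
  apply/funext => x; apply: bochner_integrandE => i j.
  by rewrite mulrA mulVf ?mul1r// gt_eqF// omega_gt0.
apply: measurable_funB; apply: measurable_funM => //.
  apply: measurable_sum => i; apply: measurable_sum => j; exact: measurable_funX.
by apply: measurable_funX; apply: measurable_sum => i.
Qed.

(** [Hess f] is an arbitrary choice among weak Hessians, and so agrees almost everywhere with the
    limit of the Hessians of the approximants, for which the energy is known. *)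
Lemma closure_weak_hessian f g : Lcl f g -> has_weak_hessian f /\
  (\int[mu]_x (bochner_integrand (Hess f) x)%:E = (ip g g + 2 * c * ip f g)%:E)%E.
Proof.
move=> Lfg; have [G [GH Gid]] := closure_hessian n2 nb Lfg.
pose H x : 'M[R]_n := \matrix_(i, j) ((omega x)^-1 * G i j x).
have wH : is_weak_hessian f H.
  move=> i j; split.
    have cw : continuous (fun x : 'rV[R]_n => omega x `^ (- 1)).
      exact: smooth_continuous (@smooth_omega_powR R n (- 1)).
    have := L2_locally_integrable nbeta (LfunP (G i j)) cw.
    congr locally_integrable_rV; apply/funext => x.
    by rewrite mxE powR_inv1// ltW// omega_gt0.
  move=> phi tp; rewrite -GH//.
  by apply: eq_Rintegral => x _; rewrite mxE.
have eH : has_weak_hessian f by exists H.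
split=> //; have wHess : is_weak_hessian f (Hess f) by exact: (xgetPex _ eH).
have HE : {ae mu, forall x, forall i j, Hess f x i j = (omega x)^-1 * G i j x}.
  apply: (ae_leb_mu nbeta); apply: filter_forall => i; apply: filter_forall => j.
  have [l1 i1] := wHess i j; have [l2 i2] := wH i j.
  apply: filterS (ae_eq_test l1 l2 _) => [x ->|phi tp]; first by rewrite mxE.
  by rewrite i1// i2.
have [iG GE] := hess_quadE G.
rewrite Gid -GE.
transitivity (\int[mu]_x (hess_quad beta (fun i j => G i j) x)%:E)%E.
  apply: ae_eq_integral => //.
  - exact: measurable_bochner_integrand.
  - exact: measurable_int iG.
  - by apply: filterS HE => x Hx _; rewrite /= (bochner_integrandE Hx).
by rewrite /Rintegral fineK// integrable_fin_num.
Qed.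

End final.

Section main.
Context (R : realType) (n : nat) (beta : R).
Hypothesis n2 : (2 <= n)%N.
Hypothesis nb : n%:R + 1 <= beta.
Notation leb := (lebesgue_rV R n).
Notation mu := (cauchy_measure n beta).
Notation c := (beta - 1).
Notation L2 := (LfunType mu (lee1n 2 : (1 <= 2%:E)%E)).
Local Notation ip := (fun f g : L2 => ipL2 mu f g).
Local Notation N := (nrm ip).
Implicit Types (f g h u v : L2) (phi : 'rV[R]_n -> R).

Let nbeta : n%:R <= beta. Proof. by apply: le_trans nb; rewrite lerDl. Qed.
Let ipP := semi_inner_L2 mu.
Local Notation Lcl := (graph_closure ip (@coreL R n beta)).
Local Notation L := (op_closure mu (@test_function R n) (cauchyL beta)).

Lemma toL2_id f : toL2 mu f = f.
Proof. by apply: val_inj; apply: toL2E; exact: LfunP. Qed.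

Lemma core_L2 phi : test_function phi ->
  phi \in Lfun mu 2%:E /\ cauchyL beta phi \in Lfun mu 2%:E.
Proof. by move=> tp; split; apply: test_Lfun2 => //; apply: test_cauchyL. Qed.

Lemma cauchyL_closureP (f g : 'rV[R]_n -> R) : L f g <->
  [/\ f \in Lfun mu 2%:E, g \in Lfun mu 2%:E & Lcl (toL2 mu f) (toL2 mu g)].
Proof. exact: op_closureP core_L2 f g. Qed.

Lemma graph_closure_core u v : coreL u v -> Lcl u v.
Proof.
by move=> uv; exists (fun=> u), (fun=> v); split=> //; exact: (nrm_cvg_cst ipP).
Qed.

Lemma variance_ipL2 f : ('V_mu[f] = (ip f f - ip f (oneL2 n beta) ^+ 2)%:E)%E.
Proof.
have lf : (f : 'rV[R]_n -> R) \in Lfun mu 2%:E := LfunP f.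
have f1 : ip f (oneL2 n beta) = \int[mu]_x f x.
  by rewrite oneL2E; apply: eq_Rintegral => x _; rewrite mulr1.
have E1 : ('E_mu[f] = (ip f (oneL2 n beta))%:E)%E.
  rewrite f1 unlock /Rintegral fineK//.
  exact: (integrable_fin_num measurableT (Lfun2_integrable lf)).
rewrite varianceE// E1 EFinB EFin_expe; congr (_ - _)%E.
rewrite unlock -(sqr_nrm ipP) -L2_sqr.
by apply: eq_integral => x _.
Qed.

Section semigroup.
Variable P : R -> ('rV[R]_n -> R) -> 'rV[R]_n -> R.
Hypothesis sgP : generated_semigroup mu L P.
Local Notation PE := (@sgL2 _ _ _ mu P).
Local Notation gen := (generator ip PE).

Let genP f g : gen f g <-> Lcl f g.
Proof.
apply: iff_trans (generator_sgL2 sgP f g) _.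
apply: iff_trans (cauchyL_closureP f g) _; rewrite !toL2_id.
by split=> [[]//|H]; split=> //; exact: LfunP.
Qed.

Let sgE : seminormed_semigroup N PE := seminormed_sgL2 sgP.

Lemma gen_core phi : test_function phi -> gen (toL2 mu phi) (toL2 mu (cauchyL beta phi)).
Proof. by move=> tp; apply/genP/graph_closure_core; exact: coreL_toL2. Qed.

(** Both [phi] and [cauchyL beta phi] are test functions, so the generator can be applied twice, as
    the abstract identity asks. *)
Lemma energy_identity phi : test_function phi ->
  let f := toL2 mu phi in let g := toL2 mu (cauchyL beta phi) in
  (\int[lebesgue_measure]_(t in `[0%R, +oo[)
    (ip (PE t g) (PE t g) + 2 * c * ip (PE t f) (PE t g))%:E =
  (- ip f g / 2 - c * (ip f f - ip f (oneL2 n beta) ^+ 2))%:E)%E.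
Proof.
move=> tp f g; have tL : test_function (cauchyL beta phi) by apply: test_cauchyL.
have gsym u v u' v' : gen u v -> gen u' v' -> ip v u' = ip u v'.
  by move=> /genP A /genP B; exact: closure_sym A B.
have gle0 u v : gen u v -> ip u v <= 0 by move=> /genP; exact: closure_le0.
have gclosed (u v : nat -> L2) u0 v0 : (forall k, gen (u k) (v k)) ->
    (forall e, 0 < e -> exists k, forall m, (k <= m)%N -> N (u m - u0) < e) ->
    (forall e, 0 < e -> exists k, forall m, (k <= m)%N -> N (v m - v0) < e) -> gen u0 v0.
  move=> uv /nrm_cvgP uf /nrm_cvgP vg; apply/genP.
  by apply: (@graph_closure_closed _ _ _ ipP _ u v) => // k; exact/genP.
have one1 : ip (oneL2 n beta) (oneL2 n beta) = 1.
  rewrite oneL2E /ipL2; under eq_Rintegral do rewrite mulr1.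
  by rewrite Rintegral_cst// mul1r -[RHS]/(fine 1%E); congr fine; exact: probability_setT.
have gone u v : gen u v -> ip v (oneL2 n beta) = 0 by move=> /genP; exact: closure_one.
have gker u : gen u 0 -> exists a : R, N (u - a *: oneL2 n beta) = 0.
  by move=> /genP; exact: closure_ker.
have ggap u v : gen u v -> 0 <= ip v v + 2 * c * ip u v.
  by move=> /genP; exact: closure_gap.
have cP := L2_complete (mu := mu).
have := @semigroup_energy_identity _ _ _ _ ipP sgE cP gsym gle0 gclosed _ one1 gone gker _
  ggap _ _ _ (gen_core tp) (gen_core tL).
by [].
Qed.

Let var f := ip f f - ip f (oneL2 n beta) ^+ 2.

Lemma poincare_core u v : coreL u v -> 2 * c * var u <= - ip u v.
Proof.
move=> [tu vE]; have := energy_identity tu.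
have uE : toL2 mu u = u := toL2_id u.
have vE' : toL2 mu (cauchyL beta u) = v by rewrite -vE toL2_id.
rewrite uE vE' => H.
suff : 0 <= - ip u v / 2 - c * var u by lra.
rewrite -lee_fin -H; apply: integral_ge0 => t.
rewrite /= in_itv/= andbT => t0; rewrite lee_fin.
apply: (closure_gap n2 nb); apply/genP; apply: (generator_sg ipP sgE t0).
by apply/genP; apply: graph_closure_core.
Qed.

(** Variance and energy are continuous for the convergence of pairs of the graph, so the inequality
    passes from the test functions to the whole domain over which the spectral gap is an infimum. *)
Lemma poincare_closure f g : Lcl f g -> 2 * c * var f <= - ip f g.
Proof.
move=> [u [v [uv uf vg]]].
have one_cvg := nrm_cvg_cst ipP (oneL2 n beta).
have A : - ip (u k) (v k) - 2 * c * var (u k) @[k --> \oo] --> - ip f g - 2 * c * var f.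
  apply: cvgB; first by apply: cvgN; exact: (ip_cvg ipP uf vg).
  apply: cvgM; first exact: cvg_cst.
  apply: cvgB; first exact: (ip_cvg ipP uf uf).
  by apply: cvgM; exact: (ip_cvg ipP uf one_cvg).
rewrite -subr_ge0 -(cvg_lim _ A)//; apply: limr_ge; first by apply/cvg_ex; eexists; exact: A.
by apply: nearW => k; rewrite subr_ge0; exact: poincare_core.
Qed.

Lemma spectral_gap_ge : ((2 * c)%:E <= spectral_gap mu L)%E.
Proof.
apply: le_ereal_inf_tmp => _ [f [g [/cauchyL_closureP[lf lg Lfg] V0 ->]]].
have := poincare_closure Lfg; rewrite /var.
have := variance_ipL2 (toL2 mu f); rewrite !(toL2E lf) (toL2E lg) => VE.
have := variance_ge0 mu f; rewrite lee_fin.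
rewrite VE in V0 *; rewrite lee_fin /= => v0.
rewrite ler_pdivlMr; last by rewrite lt_neqAle v0 andbT eq_sym -eqe.
have -> // : \int[mu]_x (- f x * g x) = - ipL2 mu f g.
rewrite /ipL2 -mulN1r -RintegralZl//; last exact: (Lfun2_integrableM lf lg).
by apply: eq_Rintegral => x _; rewrite mulNr mulN1r.
Qed.

Lemma bochner_formula phi : test_function phi ->
  (forall t, 0 <= t -> has_weak_hessian (P t phi)) /\
  ((2 * c)%:E * 'V_mu[phi] - \int[mu]_x (sqgrad phi x * (1 + sqnorm x))%:E =
   (- 2)%:E * \int[lebesgue_measure]_(t in `[0%R, +oo[)
     \int[mu]_x (bochner_integrand beta (Hess (P t phi)) x)%:E)%E.
Proof.
move=> tp; have lp : phi \in Lfun mu 2%:E by exact: test_Lfun2.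
have tL : test_function (cauchyL beta phi) by apply: test_cauchyL.
have lL : cauchyL beta phi \in Lfun mu 2%:E by exact: test_Lfun2.
pose f := toL2 mu phi; pose g := toL2 mu (cauchyL beta phi).
have PL t : 0 <= t -> Lcl (PE t f) (PE t g).
  by move=> t0; apply/genP; apply: (generator_sg ipP sgE t0); exact: gen_core.
have PfE t : 0 <= t -> PE t f = P t phi :> ('rV[R]_n -> R).
  by move=> t0; rewrite (sgL2E sgP)// /f toL2E.
split=> [t t0|].
  by have [] := closure_weak_hessian n2 nb (PL t t0); rewrite PfE.
have -> : (\int[lebesgue_measure]_(t in `[0%R, +oo[)
     \int[mu]_x (bochner_integrand beta (Hess (P t phi)) x)%:E =
   (- ip f g / 2 - c * var f)%:E)%E.
  rewrite -(energy_identity tp); apply: eq_integral => t.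
  rewrite inE /= in_itv/= andbT => t0.
  by have [_ <-] := closure_weak_hessian n2 nb (PL t t0); rewrite PfE.
have -> : ('V_mu[phi] = (var f)%:E)%E by rewrite -variance_ipL2 /f toL2E.
have E : (\int[mu]_x (sqgrad phi x * (1 + sqnorm x))%:E = (- ip f g)%:E)%E.
  have iG := test_integrable_mu nbeta (test_omega_grad tp).
  rewrite /f /g (toL2E lp) (toL2E lL) -(energyE nb tp) /Rintegral fineK; last first.
    exact: (integrable_fin_num measurableT iG).
  have sg x : sqgrad phi x = grad_dot phi phi x by apply: eq_bigr => i _; exact: expr2.
  apply: eq_integral => x _; rewrite (sg x) [in LHS]mulrC.
  exact: erefl.
(* The factor [- 2] turns [A / 2 - c Var] into [2 c Var - A], where [A = - ip f g] is the weighted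
   integral of the squared gradient. *)
rewrite E -!EFinM -EFinB; congr EFin; lra.
Qed.

End semigroup.
End main.

Theorem corollary4p8 (R : realType) (n : nat) (beta : R)
    (P : R -> ('rV[R]_n -> R) -> 'rV[R]_n -> R) :
  (2 <= n)%N -> n%:R + 1 <= beta ->
  let mu := cauchy_measure n beta in
  let L := op_closure mu (@test_function R n) (cauchyL beta) in
  generated_semigroup mu L P ->
  ((2 * (beta - 1))%:E <= spectral_gap mu L)%E /\
  forall f : 'rV[R]_n -> R, test_function f ->
    (forall t, 0 <= t -> has_weak_hessian (P t f)) /\
    ((2 * (beta - 1))%:E * 'V_mu[f]
      - \int[mu]_x (sqgrad f x * (1 + sqnorm x))%:E =
     (- 2)%:E * \int[lebesgue_measure]_(t in `[0%R, +oo[)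
       \int[mu]_x
         ((beta - (n%:R + 1)) / (beta - 2)
            * norm_HS (omega x *: Hess (P t f) x) ^+ 2
          + n%:R / (beta - 2)
            * (norm_HS (omega x *: Hess (P t f) x) ^+ 2
               - n%:R^-1 * (omega x * \tr (Hess (P t f) x)) ^+ 2))%:E)%E.
Proof.
move=> n2 nb mu L sgP; split; first exact: (spectral_gap_ge n2 nb sgP).
by move=> f tf; exact: (bochner_formula n2 nb sgP tf).
Qed.
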